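(* Let $0<p<\infty$ and let $\omega\in\mathcal{I}nv$ be such that the polynomials are dense in $A^p_\omega$. Let $f\in A^p_\omega$, and let $0<p_1,p_2<\infty$ be such that $p^{-1}=p_1^{-1}+p_2^{-1}$. Then there exist $f_1\in A^{p_1}_\omega$ and $f_2\in A^{p_2}_\omega$ such that $f=f_1\cdot f_2$ and $$\|f_1\|_{A^{p_1}_\omega}^p\cdot\|f_2\|_{A^{p_2}_\omega}^p\le\frac{p}{p_1}\|f_1\|_{A^{p_1}_\omega}^{p_1}+\frac{p}{p_2}\|f_2\|_{A^{p_2}_\omega}^{p_2}\le C\|f\|_{A^p_\omega}^p$$ for some constant $C=C(p_1,p_2,\omega)>0$ (depending only on $p_1,p_2,\omega$).
   Context: $\mathbb{D}$ is the open unit disc of $\mathbb{C}$ and $dA=\frac{dx\,dy}{\pi}$. A weight is a function $\omega:\mathbb{D}\to(0,\infty)$ integrable over $\mathbb{D}$ (not necessarily radial or continuous). $A^p_\omega$ consists of analytic functions $f$ in $\mathbb{D}$ with $\|f\|_{A^p_\omega}^p=\int_{\mathbb{D}}|f|^p\omega\,dA<\infty$. For $a\in\mathbb{D}$ let $\varphi_a(z)=\frac{a-z}{1-\overline{a}z}$, and for $r\in(0,1)$ let $\Delta(a,r)=\{z\in\mathbb{D}:|\varphi_a(z)|<r\}$ be the pseudohyperbolic disc. The class $\mathcal{I}nv$ of invariant weights consists of weights $\omega$ such that for some (equivalently for all) $r\in(0,1)$ there is a constant $C=C(r)\ge1$ with $C^{-1}\omega(a)\le\omega(z)\le C\omega(a)$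 for all $a\in\mathbb{D}$ and $z\in\Delta(a,r)$. *)

(* Defs.v *)
From HB Require Import structures.
From mathcomp Require Import all_boot all_order all_algebra.
From mathcomp Require Import complex.
From mathcomp Require Import all_classical all_reals all_analysis.

Set Implicit Arguments.
Unset Strict Implicit.
Unset Printing Implicit Defensive.

Import Order.TTheory GRing.Theory Num.Theory.
Import numFieldNormedType.Exports.

Local Open Scope classical_set_scope.
Local Open Scope ring_scope.
Local Open Scope complex_scope.

(* The modulus as an element of R; the norm `|z| of z : R[i] lies in R[i]. *)
Definition cmod (R : realType) (z : R[i]) : R := ComplexField.Normc.normc z.

Definition disc (R : realType) : set R[i] := [set z | cmod z < 1].

(* R[i] carries no measurable structure in the library: area integrals are
   taken over R * R, identified with R[i] through this map. *)
Definition cplx (R : realType) (u : R * R) : R[i] := u.1 +i* u.2.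

Definition borel_area (R : realType) :
    {measure set (measurableTypeR R * measurableTypeR R) -> \bar R} :=
  (@lebesgue_measure R \x @lebesgue_measure R)%E.

(* R * R with the Lebesgue measurable sets: the product measure is defined on
   Borel sets only, and weights are merely Lebesgue measurable. *)
Notation lebesgue_plane R := (caratheodory_type ((borel_area R)^*)%mu).

(* Normalised area measure dx dy / pi. *)
Definition dA (R : realType) : {measure set (lebesgue_plane R) -> \bar R} :=
  mscale (NngNum (etrans (invr_ge0 (pi : R)) (pi_ge0 R)))
         (@completed_measure_extension _ _ _ (borel_area R)).

Definition rdisc (R : realType) : set (lebesgue_plane R) :=
  [set u | disc (cplx u)].

(* Functions on the disc are represented by total functions on R[i], of which
   only the values on the disc are constrained or used. *)
Definition weight (R : realType) (w : R[i] -> R) : Prop :=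
  (forall z, disc z -> 0 < w z) /\
  (dA R).-integrable (@rdisc R) (fun u => (w (cplx u))%:E).

(* Complex differentiability: R[i]^o is R[i] as a normed space over itself. *)
Definition analytic_disc (R : realType) (f : R[i] -> R[i]) : Prop :=
  forall z, disc z -> derivable (f : R[i]^o -> R[i]^o) z 1.

Definition bergman_integral (R : realType) (p : R) (w : R[i] -> R)
    (f : R[i] -> R[i]) : \bar R :=
  (\int[dA R]_(u in @rdisc R) (cmod (f (cplx u)) `^ p * w (cplx u))%:E)%E.

Definition bergman_norm (R : realType) (p : R) (w : R[i] -> R)
    (f : R[i] -> R[i]) : \bar R :=
  (bergman_integral p w f `^ p^-1)%E.

Definition bergman (R : realType) (p : R) (w : R[i] -> R) : set (R[i] -> R[i]) :=
  [set f | analytic_disc f /\ (bergman_integral p w f < +oo)%E].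

Definition mobius (R : realType) (a z : R[i]) : R[i] := (a - z) / (1 - a^* * z).

Definition pseudohyperbolic_disc (R : realType) (a : R[i]) (r : R) : set R[i] :=
  [set z | disc z /\ cmod (mobius a z) < r].

Definition invariant_weight (R : realType) (w : R[i] -> R) : Prop :=
  weight w /\
  exists r : R, [/\ 0 < r, r < 1 &
    exists2 C : R, 1 <= C &
      forall a z, disc a -> pseudohyperbolic_disc a r z ->
        C^-1 * w a <= w z <= C * w a].

Definition polynomials_dense (R : realType) (p : R) (w : R[i] -> R) : Prop :=
  forall f, bergman p w f -> forall e : R, 0 < e ->
    exists P : {poly R[i]},
      bergman p w (fun z => P.[z]) /\
      (bergman_norm p w (fun z => (f z - P.[z])%R) < e%:E)%E.

(* Main.v *)
From HB Require Import structures.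
From mathcomp Require Import all_boot all_order all_algebra.
From mathcomp Require Import complex.
From mathcomp Require Import all_classical all_reals all_analysis.
From mathcomp Require Import measurable_realfun cyclic separable cyclotomic.
From mathcomp Require Import ring lra.
Require Import Defs.

(** Why the theorem is true.  Write [s1 = p / p1] and [s2 = p / p2], so that
    [s1 + s2 = 1].  Let [P] be a polynomial, [c] its zeros in the disc, and
    [x_c(a) = cmod (mobius c a)].  Then [cmod P] is [G * \prod_c x_c] with [G] free
    of zeros in the disc.  Give each zero to the first factor with probability [s1]
    and to the second one with probability [s2], independently, and take factors
    with the moduli [G `^ s1 * \prod x_c] and [G `^ s2 * \prod x_c], the products
    being over the zeros received.  The expectation of [s1 * cmod f1 `^ p1 +
    s2 * cmod f2 `^ p2] is

      [G `^ p * (s1 * \prod_c (1 - s1 + s1 * x_c `^ p1) + s2 * \prod_c (1 - s2 + s2 * x_c `^ p2))],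

    and some distribution of the zeros does at least as well for the weighted
    integrals ([choose_zeros], where the zeros are assigned one by one).  Hence
    the theorem for polynomials follows from a bound of the weighted integral of
    this expression by a constant times that of [cmod P `^ p], uniformly in [P]:
    this is [weighted_zeros_le].

    For this bound, concavity replaces every factor by [exp (- (p / m) (1 - x_c^m))],
    and [1 - y] dominates the sum of [2^-n ln (1 / max y (1 - 2^-n))] over [n >= 1]
    ([dyadic_log_bound]).  So the expression is at most a geometric mean, with the
    weights [2^-n], of the numbers [(G * \prod_c max x_c R_n) `^ p], where [1 - R_n]
    is of order [2^-n] ([zeros_dyadic_le]).  By Jensen's formula for
    [P \o mobius a], such a number is at most the maximum of
    [cmod (P \o mobius a) `^ p] on the circle of radius [R_n] ([outer_max_le]), and
    by the sub-mean value property ([loglin_submean]) that maximum is at most an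
    integral of [cmod P `^ p] over a hyperbolic neighbourhood of [a] whose radius
    grows linearly with [n] ([zeros_modulus_near]).  An invariant weight varies by a
    factor at most geometric in [n] there ([invariant_growth]), so does the
    integral over [a] ([double_integral_le]), and such a growth is compensated by
    the inequality of the means, since the weights [2^-n] have a finite first moment
    ([dyadic_AMGM]).

    The functions [G `^ s1] and [G `^ s2] are moduli of analytic functions.  They
    are reached through polynomials: the binomial series of [(1 - v z)^s] gives
    polynomials whose moduli tend to the wanted ones and whose products tend to [P]
    ([splits_zeros]).  For general [f], polynomials converging to [f] in the Bergman
    norm are split in this way; the sub-mean value property makes the polynomial
    factors locally bounded, Montel's theorem provides limits [F1] and [F2], and
    Fatou's lemma gives both the bound for their norms and [f = F1 * F2].

    All facts of complex analysis in use (Jensen's formula, Cauchy's estimates, the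
    sub-mean value property) are obtained for polynomials, and for products of
    powers of moduli of affine functions ([loglin]), by averaging over roots of
    unity, where everything reduces to the factorization of [X^n - 1].  For the
    sub-mean value property on discs this is combined with the invariance of area
    under rotations, which are products of shears. *)

Set Implicit Arguments.
Unset Strict Implicit.
Unset Printing Implicit Defensive.
Import Order.TTheory GRing.Theory Num.Theory.
Import numFieldNormedType.Exports.
Local Open Scope classical_set_scope.
Local Open Scope ring_scope.
Local Open Scope complex_scope.

(** * The modulus of complex numbers *)

Section Modulus.
Variable R : realType.
Implicit Types (x y z a u : R[i]) (r : R).

Lemma cmodE z : cmod z = Num.sqrt (complex.Re z ^+ 2 + complex.Im z ^+ 2).
Proof. by case: z. Qed.

Lemma sqr_cmod z : cmod z ^+ 2 = complex.Re z ^+ 2 + complex.Im z ^+ 2.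
Proof. by rewrite cmodE sqr_sqrtr// addr_ge0// sqr_ge0. Qed.

Lemma cmod_ge0 z : 0 <= cmod z.
Proof. by rewrite cmodE sqrtr_ge0. Qed.

Lemma cmod0 : cmod (0 : R[i]) = 0.
Proof. exact: ComplexField.Normc.normc0. Qed.

Lemma cmod1 : cmod (1 : R[i]) = 1.
Proof. exact: ComplexField.Normc.normc1. Qed.

Lemma cmodM x y : cmod (x * y) = cmod x * cmod y.
Proof. exact: ComplexField.Normc.normcM. Qed.

Lemma cmodV x : cmod x^-1 = (cmod x)^-1.
Proof. exact: ComplexField.Normc.normcV. Qed.

Lemma cmodN x : cmod (- x) = cmod x.
Proof. by case: x => p q; rewrite !cmodE /= !sqrrN. Qed.

Lemma cmodB x y : cmod (x - y) = cmod (y - x).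
Proof. by rewrite -cmodN opprB. Qed.

Lemma cmodJ x : cmod (x^*%R) = cmod x.
Proof. by case: x => p q; rewrite !cmodE /= !sqrrN. Qed.

Lemma cmodX x n : cmod (x ^+ n) = cmod x ^+ n.
Proof. by elim: n => [|n IH]; rewrite ?expr0 ?cmod1// !exprS cmodM IH. Qed.

Lemma cmod_real r : cmod r%:C = `|r|.
Proof. by rewrite cmodE/= expr0n addr0 sqrtr_sqr. Qed.

Lemma cmod_normE z : `|z| = (cmod z)%:C.
Proof. by rewrite normc_def cmodE. Qed.

Lemma cmodD x y : cmod (x + y) <= cmod x + cmod y.
Proof. by rewrite -lecR rmorphD/= -!cmod_normE ler_normD. Qed.

Lemma cmodD3 x y z : cmod (x - z) <= cmod (x - y) + cmod (y - z).
Proof. by rewrite -[x - z](subrKA y); exact: cmodD. Qed.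

Lemma cmod_eq0 z : (cmod z == 0) = (z == 0).
Proof.
apply/eqP/eqP => [|->]; [exact: ComplexField.Normc.eq0_normc|exact: cmod0].
Qed.

Lemma cmod_gt0 z : (0 < cmod z) = (z != 0).
Proof. by rewrite lt_def cmod_ge0 andbT cmod_eq0. Qed.

Lemma cmod_prod (I : Type) (s : seq I) (P : pred I) (F : I -> R[i]) :
  cmod (\prod_(i <- s | P i) F i) = \prod_(i <- s | P i) cmod (F i).
Proof. by apply: (big_morph (@cmod R)); [exact: cmodM|exact: cmod1]. Qed.

Lemma cmod_sum (I : Type) (s : seq I) (P : pred I) (F : I -> R[i]) :
  cmod (\sum_(i <- s | P i) F i) <= \sum_(i <- s | P i) cmod (F i).
Proof.
apply: (big_ind2 (fun a b => cmod a <= b)) => [|x x' y y' h h'|//].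
  by rewrite cmod0.
by rewrite (le_trans (cmodD _ _))// lerD.
Qed.

Lemma cmod_dist x y : `|cmod x - cmod y| <= cmod (x - y).
Proof.
rewrite ler_norml; apply/andP; split; last first.
  by rewrite lerBlDr -{1}[x](subrK y) cmodD.
by rewrite lerNl opprB lerBlDr -{1}[y](subrK x) cmodB (le_trans (cmodD _ _))// cmodB.
Qed.

Lemma cmod_Re z : `|complex.Re z| <= cmod z.
Proof. by rewrite cmodE -sqrtr_sqr ler_wsqrtr// lerDl sqr_ge0. Qed.

Lemma cmod_Im z : `|complex.Im z| <= cmod z.
Proof. by rewrite cmodE -sqrtr_sqr ler_wsqrtr// lerDr sqr_ge0. Qed.

Lemma cmod_ReIm z : cmod z <= `|complex.Re z| + `|complex.Im z|.
Proof.
rewrite -(@ler_pXn2r _ 2)// ?nnegrE ?cmod_ge0 ?addr_ge0//.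
rewrite sqr_cmod sqrrD !real_normK ?num_real// lerD2r lerDl.
by rewrite mulrn_wge0// mulr_ge0.
Qed.

(** The identity behind the invariance of the pseudohyperbolic metric. *)
Lemma cmod_cross a u : cmod (1 - a^* * u) ^+ 2 - cmod (a - u) ^+ 2 =
  (1 - cmod a ^+ 2) * (1 - cmod u ^+ 2).
Proof. by rewrite !sqr_cmod; case: a => a b; case: u => c d /=; ring. Qed.

Lemma disc_cross_gt0 a u : disc a -> cmod u <= 1 -> 0 < cmod (1 - a^* * u).
Proof.
rewrite /disc/= => a1 u1; rewrite cmod_gt0 subr_eq0; apply/eqP => /(congr1 (@cmod R)).
rewrite cmod1 cmodM cmodJ => /esym /eqP; apply/negP; rewrite lt_eqF//.
by rewrite (@le_lt_trans _ _ (cmod a))// ler_piMr// cmod_ge0.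
Qed.

End Modulus.

(** * Products over roots of unity *)

Section RootsOfUnity.
Variable R : realType.
Implicit Types (x y z a u w : R[i]) (r : R).

Lemma primitive_root_exists n : (0 < n)%N ->
  exists w : R[i], n.-primitive_root w.
Proof.
move=> n_gt0; have [r Dp] := closed_field_poly_normal ('X^n - 1 : {poly R[i]}).
move/monicP: (monicXnsubC (1 : R[i]) n_gt0) Dp; rewrite polyC1 => -> Dp.
rewrite scale1r in Dp.
have rn1 : all n.-unity_root r.
  by apply/allP => z; rewrite -root_prod_XsubC -Dp unity_rootE rootE !hornerE subr_eq0.
have sz_r : (n < (size r).+1)%N.
  by rewrite -(size_prod_XsubC r id) -Dp size_XnsubC.
have [|z] := hasP (has_prim_root n_gt0 rn1 _ sz_r); last by exists z.
by rewrite -separable_prod_XsubC -Dp separable_Xn_sub_1 // pnatr_eq0 -lt0n.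
Qed.

Lemma cmod_root_of_unity n w : (0 < n)%N -> w ^+ n = 1 -> cmod w = 1.
Proof.
move=> n0 /(congr1 (@cmod R)); rewrite cmodX cmod1 => /eqP.
by rewrite pexpr_eq1 ?cmod_ge0// => /eqP.
Qed.

Lemma prod_roots_of_unity n w a b : n.-primitive_root w ->
  \prod_(0 <= i < n) (a - b * w ^+ i) = a ^+ n - b ^+ n.
Proof.
move=> wn; have n0 := prim_order_gt0 wn.
have [->|b0] := eqVneq b 0.
  rewrite expr0n gtn_eqF// subr0.
  under eq_bigr do rewrite mul0r subr0.
  by rewrite prodr_const_nat subn0.
have /(congr1 (fun q : {poly R[i]} => q.[a / b])) := factor_Xn_sub_1 wn.
have hE : ('X^n - 1 : {poly R[i]}).[a / b] = (a / b) ^+ n - 1.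
  rewrite hornerD hornerN.
  rewrite hornerXn.
  by rewrite hornerC.
rewrite horner_prod.
rewrite [RHS]hE.
rewrite expr_div_n.
move=> h.
transitivity (b ^+ n * \prod_(0 <= i < n) (a / b - w ^+ i)).
  rewrite -[in b ^+ n](subn0 n) -prodr_const_nat -big_split /=.
  by apply: eq_bigr => i _; field.
under eq_bigr => i _ do rewrite -hornerXsubC.
rewrite h mulrBr mulr1; congr (_ - _).
by field; rewrite expf_neq0.
Qed.

(** The logarithms of the [y k] are bounded and the exponents tend to 0. *)
Lemma cvg_powR_inv_odd (y : R^nat) (l h e : R) : 0 < l ->
  (forall k, l <= y k <= h) ->
  y k `^ (e / k.*2.+1%:R) @[k --> \oo] --> (1 : R).
Proof.
move=> l0 lyh.
have y0 k : 0 < y k by have /andP[/(lt_le_trans l0)] := lyh k.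
have -> : (fun k => y k `^ (e / k.*2.+1%:R)) =
          (fun k => expR (e * ln (y k) / k.*2.+1%:R)).
  by apply/funext => k; rewrite /powR gt_eqF//; congr expR; ring.
rewrite -[X in _ --> X](@expR0 R); apply: continuous_cvg; first exact: continuous_expR.
pose B := `|e| * (`|ln l| + `|ln h|).
have B0 : 0 <= B by rewrite mulr_ge0// addr_ge0.
apply/cvgrPdist_le => eps eps0.
have := @cvg_harmonic R => /cvgrPdist_le /(_ (eps / (B + 1))) [|N _ hN].
  by rewrite divr_gt0// ltr_wpDl.
exists N => // k /= Nk; rewrite sub0r normrN normrM.
have /andP[lyk hyk] := lyh k.
have lnB : `|ln (y k)| <= `|ln l| + `|ln h|.
  rewrite ler_norml; apply/andP; split.
    apply: (@le_trans _ _ (ln l)); last by rewrite ler_ln ?posrE.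
    by rewrite lerNl (le_trans (ler_norm _))// normrN lerDl.
  apply: (@le_trans _ _ (ln h)); first by rewrite ler_ln ?posrE// (lt_le_trans (y0 k)).
  by rewrite (le_trans (ler_norm _))// lerDr.
have h1 : `|e * ln (y k)| <= B by rewrite normrM ler_wpM2l.
apply: (@le_trans _ _ (B * harmonic k)).
  apply: ler_pM => //; rewrite normrV ?unitfE// ger0_norm//.
  by rewrite lef_pV2 ?posrE// ler_nat ltnS -addnn leq_addr.
have := hN k Nk; rewrite sub0r normrN ger0_norm ?invr_ge0// => h2.
apply: (@le_trans _ _ ((B + 1) * harmonic k)); first by rewrite ler_wpM2r ?invr_ge0// lerDl.
by rewrite mulrC -ler_pdivlMr// ltr_wpDl.
Qed.

(** Jensen's formula for one linear factor: by [prod_roots_of_unity] the left-hand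
    side is the geometric mean of [cmod (a - b * w ^+ i)] over the roots of unity
    of odd order.  After division by the larger term only roots of numbers that
    stay away from 0 are left. *)
Lemma jensen_factor a b (e : R) : cmod a != cmod b ->
  cmod (a ^+ k.*2.+1 - b ^+ k.*2.+1) `^ (e / k.*2.+1%:R) @[k --> \oo] -->
  Num.max (cmod a) (cmod b) `^ e.
Proof.
wlog ab : a b / cmod b < cmod a => [hw ab|_].
  have [ba|] := boolP (cmod b < cmod a); first exact: (hw a b ba ab).
  rewrite -leNgt => ab'.
  rewrite maxC; under eq_fun do rewrite cmodB.
  have ab2 : cmod a < cmod b by rewrite lt_def eq_sym ab ab'.
  by have := hw b a ab2; rewrite eq_sym => /(_ ab).
have a0 : 0 < cmod a by rewrite (le_lt_trans _ ab)// cmod_ge0.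
have a0' : a != 0 by rewrite -cmod_gt0.
pose u := b / a; pose y k := cmod (1 - u ^+ k.*2.+1).
have u1 : cmod u < 1 by rewrite cmodM cmodV ltr_pdivrMr// mul1r.
have -> : (fun k => cmod (a ^+ k.*2.+1 - b ^+ k.*2.+1) `^ (e / k.*2.+1%:R)) =
          (fun k => cmod a `^ e * y k `^ (e / k.*2.+1%:R)).
  apply/funext => k; have -> : a ^+ k.*2.+1 - b ^+ k.*2.+1 =
    a ^+ k.*2.+1 * (1 - u ^+ k.*2.+1).
    rewrite /u expr_div_n mulrBr mulr1 mulrCA mulfV ?mulr1//.
    by rewrite expf_neq0.
  rewrite cmodM cmodX powRM ?exprn_ge0 ?cmod_ge0//; congr (_ * _).
  rewrite -powR_mulrn ?cmod_ge0// -powRrM; congr (_ `^ _).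
  by rewrite mulrC divfK// pnatr_eq0.
rewrite max_l ?(ltW ab)// -[X in _ --> X]mulr1; apply: cvgM; first exact: cvg_cst.
apply: (@cvg_powR_inv_odd y (1 - cmod u) 2); first by rewrite subr_gt0.
move=> k; have ule : cmod (u ^+ k.*2.+1) <= cmod u.
  by rewrite cmodX exprS ler_piMr ?cmod_ge0// exprn_ile1 ?cmod_ge0// ltW.
apply/andP; split.
  rewrite (@le_trans _ _ (1 - cmod (u ^+ k.*2.+1)))// ?lerB//.
  have := cmod_dist 1 (u ^+ k.*2.+1); rewrite cmod1; apply: le_trans.
  exact: ler_norm.
rewrite (le_trans (cmodD _ _))// cmodN cmod1 -[2]/(1 + 1) lerD2l.
exact: le_trans ule (ltW u1).
Qed.

End RootsOfUnity.

(** * Jensen's formula by averages over roots of unity *)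

Section Jensen.
Variable R : realType.
Implicit Types (z w : R[i]) (K e M : R) (s : seq (R[i] * R[i] * R)).

(** Moduli of products of real powers of affine functions: everything to which
    Jensen's inequality gets applied has this form. *)
Definition loglin K s z : R :=
  K * \prod_(i <- s) cmod (i.1.1 - i.1.2 * z) `^ i.2.

Definition loglin_max K s z : R :=
  K * \prod_(i <- s) Num.max (cmod i.1.1) (cmod (i.1.2 * z)) `^ i.2.

Definition loglin_geo K s z (n : nat) : R :=
  K * \prod_(i <- s) cmod (i.1.1 ^+ n - (i.1.2 * z) ^+ n) `^ (i.2 / n%:R).

Lemma loglin_ge0 K s z : 0 <= K -> 0 <= loglin K s z.
Proof. by move=> K0; rewrite mulr_ge0// prodr_ge0// => i _; rewrite powR_ge0. Qed.

Lemma loglin_geo_cvg K s z :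
  (forall i, i \in s -> cmod i.1.1 != cmod (i.1.2 * z)) ->
  loglin_geo K s z k.*2.+1 @[k --> \oo] --> loglin_max K s z.
Proof.
move=> sz; apply: cvgM; first exact: cvg_cst.
elim: s sz => [|i s IH] sz.
  by under eq_fun do rewrite big_nil; rewrite big_nil; exact: cvg_cst.
under eq_fun do rewrite big_cons; rewrite big_cons.
apply: cvgM; last by apply: IH => j js; apply: sz; rewrite inE js orbT.
by apply: jensen_factor; apply: sz; rewrite inE eqxx.
Qed.

Lemma prod_powR (I : Type) (t : seq I) (F : I -> R) e :
  (forall i, 0 <= F i) -> \prod_(i <- t) F i `^ e = (\prod_(i <- t) F i) `^ e.
Proof.
move=> F0; elim: t => [|i t IH]; first by rewrite !big_nil powR1.
by rewrite !big_cons IH powRM// prodr_ge0.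
Qed.

(** The arithmetic mean over a regular polygon dominates the geometric mean, and
    the latter is explicit by [prod_roots_of_unity]. *)
Lemma loglin_geo_le_mean K s z n w : 0 <= K -> n.-primitive_root w ->
  loglin_geo K s z n <= n%:R^-1 * \sum_(i < n) loglin K s (z * w ^+ i).
Proof.
move=> K0 wn; have n0 := prim_order_gt0 wn.
have nR : 0 < (n%:R : R) by rewrite ltr0n.
set S := \sum_(i < n) _.
have S0 : 0 <= S by apply: sumr_ge0 => i _; exact: loglin_ge0.
have G0 : 0 <= loglin_geo K s z n.
  by rewrite mulr_ge0// prodr_ge0// => i _; rewrite powR_ge0.
rewrite mulrC -(@ler_pXn2r _ n)// ?nnegrE ?divr_ge0 ?ler0n//.
have := (@leif_AGM _ _ (predT : {pred 'I_n}) (fun i => loglin K s (z * w ^+ i)) _).1.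
rewrite card_ord => /(_ (fun i _ => loglin_ge0 s _ K0)); apply: le_trans.
rewrite le_eqVlt; apply/orP; left; apply/eqP.
rewrite /loglin_geo exprMn /loglin big_split /= prodr_const card_ord; congr (_ * _).
rewrite exchange_big /= -prodrXl; apply: eq_bigr => -[[a b] e] _ /=.
rewrite -powR_mulrn ?powR_ge0// -powRrM divfK ?gt_eqF//.
rewrite prod_powR; last by move=> i; exact: cmod_ge0.
rewrite -cmod_prod -(prod_roots_of_unity a (b * z) wn) big_mkord.
by congr (cmod _ `^ _); apply: eq_bigr => i _; rewrite mulrA.
Qed.

(** The averages over roots of unity are at most the supremum, and their
    geometric means tend to the product of the maxima of the two terms of each
    factor: this is Jensen's inequality for a circle that avoids the zeros. *)
Lemma loglin_max_le K s z M : 0 <= K ->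
  (forall i, i \in s -> cmod i.1.1 != cmod (i.1.2 * z)) ->
  (forall w, cmod w = 1 -> loglin K s (z * w) <= M) ->
  loglin_max K s z <= M.
Proof.
move=> K0 sz hM.
have cv := loglin_geo_cvg (K := K) sz.
rewrite -(cvg_lim _ cv)//; apply: limr_le; first by apply/cvg_ex; eexists; exact: cv.
apply: nearW => k; have [w wn] := @primitive_root_exists R k.*2.+1 isT.
apply: le_trans (loglin_geo_le_mean s z K0 wn) _.
rewrite mulrC ler_pdivrMr ?ltr0n// mulr_natr.
apply: le_trans (ler_sum _ _) _; first by move=> i _; apply: (hM (w ^+ i));
  rewrite cmodX (cmod_root_of_unity _ (prim_expr_order wn))// expr1n.
by rewrite sumr_const card_ord.
Qed.

End Jensen.

(** * Cauchy's estimates for polynomials *)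

Section CauchyEstimates.
Variable R : realType.
Implicit Types (z w : R[i]) (r M : R) (q : {poly R[i]}).

Lemma sum_prim_root_expr n w (j k : 'I_n) : n.-primitive_root w ->
  \sum_(i < n) (w ^+ j / w ^+ k) ^+ i = n%:R *+ (j == k).
Proof.
move=> wn; have w0 : w != 0.
  by apply/eqP => w0; have := prim_expr_order wn; rewrite w0 expr0n gtn_eqF ?(prim_order_gt0 wn)// => /esym/eqP; rewrite oner_eq0.
have [->|jk] := eqVneq j k.
  rewrite mulr1n divff ?expf_neq0//.
  by under eq_bigr do rewrite expr1n; rewrite sumr_const card_ord.
have v1 : w ^+ j / w ^+ k != 1.
  rewrite -subr_eq0 -[X in _ - X](@divff _ (w ^+ k)) ?expf_neq0// -mulrBl.
  rewrite mulf_eq0 invr_eq0 expf_eq0 (negbTE w0) andbF orbF subr_eq0.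
  by rewrite (eq_prim_root_expr wn) !modn_small.
have := subrX1 (w ^+ j / w ^+ k) n.
rewrite expr_div_n -[_ ^+ j ^+ n]exprM -[_ ^+ k ^+ n]exprM ![(_ * n)%N]mulnC.
rewrite !exprM (prim_expr_order wn) !expr1n divr1 subrr => /esym/eqP.
by rewrite mulf_eq0 subr_eq0 (negbTE v1) => /eqP ->; rewrite mulr0n.
Qed.

(** A coefficient is recovered from the values at sufficiently many roots of
    unity by discrete Fourier inversion. *)
Lemma cauchy_coef q r M k : 0 < r ->
  (forall z, cmod z = r -> cmod q.[z] <= M) -> cmod q`_k * r ^+ k <= M.
Proof.
move=> r0 hM; pose n := (maxn (size q) k).+1.
have [w wn] := @primitive_root_exists R n isT.
have kn : (k < n)%N by rewrite ltnS leq_maxr.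
have w1 i : cmod (w ^+ i) = 1.
  by rewrite cmodX (cmod_root_of_unity _ (prim_expr_order wn))// expr1n.
have w0 i : w ^+ i != 0 by rewrite -cmod_gt0 w1.
have nR : 0 < (n%:R : R) by rewrite ltr0n.
have E : n%:R * (q`_k * r%:C ^+ k) =
    \sum_(i < n) (w ^+ k)^-1 ^+ i * q.[r%:C * w ^+ i].
  under eq_bigr => i _.
    rewrite (@horner_coef_wide _ n) ?leqW ?leq_maxl// big_distrr /=.
    over.
  rewrite exchange_big /= (bigD1 (Ordinal kn)) //= [X in _ + X]big1 => [|j jk].
    have := sum_prim_root_expr (Ordinal kn) (Ordinal kn) wn.
    rewrite eqxx mulr1n addr0 => <-; rewrite mulrC big_distrr /=.
    apply: eq_bigr => i _.
    rewrite !exprMn -[(w ^+ i) ^+ k]exprM mulnC exprM.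
    by ring.
  transitivity (q`_j * r%:C ^+ j * \sum_(i < n) (w ^+ j / w ^+ k) ^+ i).
    rewrite big_distrr; apply: eq_bigr => i _ /=.
    rewrite !exprMn -[(w ^+ i) ^+ j]exprM mulnC exprM.
    by ring.
  by rewrite (sum_prim_root_expr j (Ordinal kn) wn) (negbTE jk) mulr0n mulr0.
have := congr1 (@cmod R) E.
rewrite cmodM -(rmorph_nat (real_complex R)) cmod_real (ger0_norm (ltW nR)).
rewrite cmodM cmodX cmod_real (ger0_norm (ltW r0)) => E2.
rewrite -(ler_pM2l nR) E2 (le_trans (cmod_sum _ _ _))//.
rewrite [leRHS]mulr_natl -[in leRHS](card_ord n) -sumr_const.
apply: ler_sum => i _; rewrite cmodM cmodX cmodV w1 invr1 expr1n mul1r.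
by apply: hM; rewrite cmodM w1 mulr1 cmod_real ger0_norm ?ltW.
Qed.

End CauchyEstimates.

(** * Montel's theorem for polynomials *)

Section Montel.
Variable R : realType.
Implicit Types (z w : R[i]) (r M e : R) (q : nat -> {poly R[i]}).

Definition cvg_loc (f : nat -> R[i] -> R[i]) (F : R[i] -> R[i]) : Prop :=
  forall r e, r < 1 -> 0 < e -> exists N, forall n, (N <= n)%N ->
    forall z, cmod z <= r -> cmod (f n z - F z) <= e.

(** The bound may ignore finitely many terms: the polynomials to which this is
    applied are controlled at index [n] only on a disc whose radius grows with
    [n]. *)
Definition bounded_loc (f : nat -> R[i] -> R[i]) : Prop :=
  forall r, r < 1 -> exists M, exists N, forall n, (N <= n)%N ->
    forall z, cmod z <= r -> cmod (f n z) <= M.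

Lemma ultra_cvg_real (U : set_system nat) (x : nat -> R) M N :
  UltraFilter U -> \oo `<=` U -> (forall n, (N <= n)%N -> `|x n| <= M) ->
  exists l, forall e, 0 < e -> U [set n | `|x n - l| <= e].
Proof.
move=> UU ooU xM.
have UA : (x @ U) `[- M, M]%classic.
  apply: ooU; exists N => // n Nn /=; rewrite in_itv/= -ler_norml; exact: xM.
have [l [_ cl]] := @segment_compact R (- M) M (x @ U) _ UA.
exists l => e e0; have [//|Uc] := in_ultra_setVsetC [set n | `|x n - l| <= e] UU.
have [] := cl [set t | e < `|t - l|] (ball l e) _ (nbhsx_ballx l e e0).
  change (U [set n | e < `|x n - l|]); apply: filterS Uc => n /= hn.
  by rewrite ltNge; exact/negP.
by move=> y [/= hn]; rewrite /ball/= distrC => /(lt_trans hn); rewrite ltxx.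
Qed.

Lemma ultra_cvg_complex (U : set_system nat) (x : nat -> R[i]) M N :
  UltraFilter U -> \oo `<=` U -> (forall n, (N <= n)%N -> cmod (x n) <= M) ->
  exists l, forall e, 0 < e -> U [set n | cmod (x n - l) <= e].
Proof.
move=> UU ooU xM.
have [n Nn|l1 h1] := @ultra_cvg_real U (fun n => complex.Re (x n)) M N UU ooU.
  exact: le_trans (cmod_Re _) (xM n Nn).
have [n Nn|l2 h2] := @ultra_cvg_real U (fun n => complex.Im (x n)) M N UU ooU.
  exact: le_trans (cmod_Im _) (xM n Nn).
exists (l1 +i* l2) => e e0; have e2 : 0 < e / 2 by rewrite divr_gt0.
apply: filterS (filterI (h1 _ e2) (h2 _ e2)) => n [/= a b].
rewrite (le_trans (cmod_ReIm _))// [leRHS](splitr e).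
by case: (x n) a b => p s /= a b; rewrite lerD.
Qed.

(** The first [K] coefficients are controlled by [e], the others by a geometric
    series. *)
Lemma horner_coef_tail (d : {poly R[i]}) r t M e (K : nat) :
  0 <= r -> 0 <= t -> t < 1 ->
  (forall k, (k < K)%N -> cmod d`_k * r ^+ k <= e) ->
  (forall k, cmod d`_k * r ^+ k <= M * t ^+ k) ->
  forall z, cmod z <= r -> cmod d.[z] <= K%:R * e + M * (t ^+ K / (1 - t)).
Proof.
move=> r0 t0 t1 hK hM z zr.
have M0 : 0 <= M by have := hM 0%N; rewrite !expr0 !mulr1; apply: le_trans; exact: cmod_ge0.
pose n := maxn (size d) K.
rewrite (@horner_coef_wide _ n) ?leq_maxl// (le_trans (cmod_sum _ _ _))//.
apply: (@le_trans _ _ (\sum_(0 <= k < n) cmod d`_k * r ^+ k)).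
  rewrite big_mkord; apply: ler_sum => k _; rewrite cmodM cmodX.
  by rewrite ler_wpM2l ?cmod_ge0// lerXn2r ?nnegrE ?cmod_ge0.
rewrite (@big_cat_nat _ _ _ K)/= ?leq_maxr//; apply: lerD.
  rewrite big_mkord mulr_natl -[X in _ *+ X]card_ord -sumr_const.
  by apply: ler_sum => k _; exact: hK.
apply: (@le_trans _ _ (\sum_(K <= k < n) M * t ^+ k)).
  by apply: ler_sum => k _; exact: hM.
rewrite -mulr_sumr ler_wpM2l// -{1}[K]add0n big_addn.
under eq_bigr do rewrite exprD.
rewrite -mulr_suml mulrC ler_wpM2l ?exprn_ge0//.
have -> : \sum_(0 <= i < n - K) t ^+ i = (1 - t ^+ (n - K)) / (1 - t).
  have := subrX1 t (n - K); rewrite big_mkord => h.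
  apply: (@mulIf _ (1 - t)); first by rewrite subr_eq0 gt_eqF.
  rewrite divfK; last by rewrite subr_eq0 gt_eqF.
  by rewrite -[RHS]opprB h mulrC -mulNr opprB.
rewrite ler_pdivrMr ?subr_gt0// mulVf ?subr_eq0 ?gt_eqF//.
by rewrite lerBlDr lerDl exprn_ge0.
Qed.

Lemma cvg_pow_lt t e : 0 <= t -> t < 1 -> 0 < e -> exists K : nat, t ^+ K <= e.
Proof.
move=> t0 t1 e0; have /cvgrPdist_le /(_ e e0) [K _ hK] : t ^+ k @[k --> \oo] --> (0:R).
  by apply: cvg_expr; rewrite ger0_norm.
by exists K; have := hK K (leqnn _); rewrite sub0r normrN ger0_norm ?exprn_ge0.
Qed.

(** A locally bounded sequence of polynomials is uniformly Cauchy, on every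
    smaller disc, along any ultrafilter: by Cauchy's estimates only finitely
    many coefficients matter, and these converge along the ultrafilter. *)
Lemma ultra_uniformly_cauchy (U : set_system nat) q :
  UltraFilter U -> \oo `<=` U -> bounded_loc (fun n => horner (q n)) ->
  forall r e, r < 1 -> 0 < e -> exists2 A, U A &
    forall n m, A n -> A m -> forall z, cmod z <= r ->
      cmod ((q n).[z] - (q m).[z]) <= e.
Proof.
move=> UU ooU bq r0 e r01 e0.
pose r := Num.max r0 2^-1.
have r1 : r < 1 by rewrite /r gt_max r01 invf_lt1// ltr1n.
have rpos : 0 < r by rewrite lt_max invr_gt0 ltr0n orbT.
pose r' := (1 + r) / 2.
have [rr' r'1] : r < r' /\ r' < 1 by rewrite /r'; split; lra.
have r'0 : 0 < r' by lra.
have [M [N hM]] := bq r' r'1.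
pose t := r / r'; have t0 : 0 <= t by rewrite divr_ge0 ?ltW.
have t1 : t < 1 by rewrite ltr_pdivrMr// mul1r.
have M0 : 0 <= M.
  by have := hM N (leqnn _) 0; rewrite cmod0 => /(_ (ltW r'0)); apply: le_trans; exact: cmod_ge0.
have hc n k : (N <= n)%N -> cmod (q n)`_k * r' ^+ k <= M.
  by move=> Nn; apply: cauchy_coef => // z zr; apply: hM; rewrite ?zr.
have hcM n k : (N <= n)%N -> cmod (q n)`_k <= M / r' ^+ k.
  by move=> Nn; rewrite ler_pdivlMr ?exprn_gt0// hc.
have /choice[c hcc] : forall k, exists l, forall e, 0 < e -> U [set n | cmod ((q n)`_k - l) <= e].
  move=> k; apply: (@ultra_cvg_complex U (fun n => (q n)`_k) (M / r' ^+ k) N) => // n Nn.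
  exact: hcM.
have [K hK] : exists K : nat, t ^+ K <= e / 4 / (M + 1) * (1 - t).
  by apply: cvg_pow_lt => //; rewrite mulr_gt0 ?subr_gt0// !divr_gt0// ltr_wpDl.
pose e' := e / 4 / (K%:R + 1).
have e'0 : 0 < e' by rewrite !divr_gt0// ltr_wpDl.
have UK : U (\bigcap_(k in `I_K) [set n | cmod ((q n)`_k - c k) <= e']).
  elim: K {hK e' e'0} (e') (e'0) => [|K IH] d d0.
    by rewrite II0 bigcap_set0; exact: filterT.
  rewrite IIS bigcap_setU; apply: filterI; first exact: IH.
  by rewrite bigcap_set1; exact: hcc.
exists ([set n | (N <= n)%N] `&` \bigcap_(k in `I_K) [set n | cmod ((q n)`_k - c k) <= e']).
  by apply: filterI => //; apply: ooU; exists N.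
move=> n m [/= Nn cn] [/= Nm cm] z zr; rewrite -hornerN -hornerD.
apply: (@le_trans _ _ (K%:R * (2 * e') + 2 * M * (t ^+ K / (1 - t)))).
  apply: (@horner_coef_tail _ r) => //; last by rewrite (le_trans zr)// le_max lexx.
  - exact: ltW.
  - move=> k kK; rewrite coefB (@le_trans _ _ (cmod ((q n)`_k - (q m)`_k)))//.
      by rewrite ler_piMr ?cmod_ge0// exprn_ile1// ltW.
    rewrite (le_trans (cmodD3 _ (c k) _))// mulr2n mulrDl mul1r lerD//; first exact: cn.
    by rewrite cmodB; exact: cm.
  - move=> k; rewrite coefB expr_div_n mulrA mulrAC ler_wpM2r ?exprn_ge0 ?(ltW rpos)//.
    rewrite (le_trans (cmodD _ _))// cmodN -mulrA mulr2n mulrDl mul1r.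
    by rewrite lerD// hcM.
have h1 : K%:R * (2 * e') <= e / 2.
  rewrite /e' (_ : K%:R * _ = e / 2 * (K%:R / (K%:R + 1))); last by field; rewrite gt_eqF// ltr_wpDl.
  by rewrite ler_piMr ?divr_ge0 ?ltW// ltr_pdivrMr ?ltr_wpDl// mul1r ltrDl.
have h2 : M * (t ^+ K / (1 - t)) <= e / 4.
  apply: (@le_trans _ _ (M * (e / 4 / (M + 1)))).
    by rewrite ler_wpM2l// ler_pdivrMr ?subr_gt0.
  rewrite mulrCA ler_piMr ?divr_ge0 ?ltW//.
  by rewrite ltr_pdivrMr ?ltr_wpDl// mul1r ltrDl.
lra.
Qed.

(** An ultrafilter finer than the filter of cofinite sets provides limits at all
    points at once, uniformly on smaller discs by [ultra_uniformly_cauchy]; the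
    subsequence is then picked along radii tending to 1. *)
Theorem montel q : bounded_loc (fun n => horner (q n)) ->
  exists (phi : nat -> nat) (F : R[i] -> R[i]),
    (forall m, (m <= phi m)%N) /\ cvg_loc (fun m => horner (q (phi m))) F.
Proof.
move=> bq; have [U [UU ooU]] := ultraFilterLemma (_ : ProperFilter (\oo : set_system nat)).
have /choice[F hF] : forall z, exists l, cmod z < 1 -> forall e, 0 < e -> U [set n | cmod ((q n).[z] - l) <= e].
  move=> z; have [z1|] := boolP (cmod z < 1); last by exists 0.
  have [M [N hM]] := bq _ z1.
  have [n Nn|l hl] := @ultra_cvg_complex U (fun n => (q n).[z]) M N UU ooU.
    exact: hM.
  by exists l => _.
have hA r e : r < 1 -> 0 < e -> exists2 A, U A & forall n, A n -> forall z, cmod z <= r -> cmod ((q n).[z] - F z) <= e.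
  move=> r1 e0; have e2 : 0 < e / 2 by rewrite divr_gt0.
  have [A UA hA] := ultra_uniformly_cauchy UU ooU bq r1 e2.
  exists A => // n An z zr.
  have Uz := hF z (le_lt_trans zr r1) _ e2.
  have [m [Am /= hm]] := filter_ex (filterI UA Uz).
  by rewrite (le_trans (cmodD3 _ (q m).[z] _))// [leRHS](splitr e) lerD// hA.
have /choice[phi hphi] : forall m, exists n, (m <= n)%N /\
    forall z, cmod z <= 1 - harmonic m -> cmod ((q n).[z] - F z) <= harmonic m :> R.
  move=> m; have h0 : 0 < harmonic m :> R by rewrite invr_gt0 ltr0n.
  have [|A UA hm] := hA (1 - harmonic m) (harmonic m) _ h0; first by rewrite ltrBlDr ltrDl.
  have Um : U [set n | (m <= n)%N] by apply: ooU; exists m.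
  have [n [An /= mn]] := filter_ex (filterI UA Um); exists n; split => //; exact: hm.
exists phi, F; split => [m|r e r1 e0]; first by have [] := hphi m.
pose d := Num.min e (1 - r); have d0 : 0 < d by rewrite lt_min e0 subr_gt0.
have /cvgrPdist_le /(_ d d0) [N _ hN] := @cvg_harmonic R.
exists N => n Nn z zr; have [_ h] := hphi n.
have := hN n Nn; rewrite sub0r normrN ger0_norm ?invr_ge0// => hd.
have [h1 h2] : harmonic n <= e /\ harmonic n <= 1 - r.
  by move: hd; rewrite le_min => /andP.
by rewrite (le_trans _ h1)// h// (le_trans zr)// lerBrDr addrC -lerBrDr.
Qed.

End Montel.

(** * Analyticity of locally uniform limits of polynomials *)

Section Analyticity.
Variable R : realType.
Implicit Types (z w h : R[i]) (r M e : R) (q : {poly R[i]}) (F : R[i] -> R[i]).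

Lemma bounded_poly q r : exists2 M, 0 <= M & forall z, cmod z <= r -> cmod q.[z] <= M.
Proof.
exists (\sum_(i < size q) cmod q`_i * `|r| ^+ i).
  by apply: sumr_ge0 => i _; rewrite mulr_ge0 ?cmod_ge0// exprn_ge0.
move=> z zr; rewrite horner_coef (le_trans (cmod_sum _ _ _))//.
apply: ler_sum => i _; rewrite cmodM cmodX ler_wpM2l ?cmod_ge0//.
by rewrite lerXn2r ?nnegrE ?cmod_ge0// (le_trans zr)// ler_norm.
Qed.

Lemma cvg_loc_bounded (q : nat -> {poly R[i]}) F :
  cvg_loc (fun n => horner (q n)) F -> bounded_loc (fun n => horner (q n)).
Proof.
move=> cq r r1; have [N hN] := cq r 1 r1 ltr01.
have [M M0 hM] := bounded_poly (q N) r.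
exists (M + 1 + 1), N => n Nn z zr.
rewrite -[(q n).[z]](subrK (F z)) (le_trans (cmodD _ _))// [leRHS]addrC lerD//; first exact: hN.
rewrite -[F z](subrK (q N).[z]) (le_trans (cmodD _ _))// [leRHS]addrC lerD//; last exact: hM.
by rewrite cmodB; apply: hN.
Qed.

(** Cauchy's estimates for the polynomial recentred at [z] bound the terms of
    degree at least two. *)
Lemma taylor2 q z (d : R) M : 0 < d ->
  (forall h, cmod h <= d -> cmod q.[z + h] <= M) ->
  cmod q^`().[z] * d <= M /\
  forall h, cmod h <= d / 2 ->
    cmod (q.[z + h] - q.[z] - q^`().[z] * h) <= 2 * M * (cmod h / d) ^+ 2.
Proof.
move=> d0 hM; pose s := q \Po ('X + z%:P).
have sE h : s.[h] = q.[z + h] by rewrite horner_comp !hornerE addrC.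
have s0 : s`_0 = q.[z] by rewrite -horner_coef0 sE addr0.
have s1 : s`_1 = q^`().[z].
  have -> : s`_1 = s^`()`_0 by rewrite coef_deriv mulr1n.
  rewrite -horner_coef0 deriv_comp derivD derivX derivC addr0 mulr1.
  by rewrite horner_comp !hornerE.
have cs k : cmod s`_k * d ^+ k <= M.
  by apply: cauchy_coef => // h hd; rewrite sE hM// hd.
have M0 : 0 <= M by apply: le_trans (cs 0%N); rewrite mulr_ge0 ?cmod_ge0// exprn_ge0// ltW.
split; first by have := cs 1%N; rewrite expr1 s1.
move=> h hd; set t := cmod h / d.
have t0 : 0 <= t by rewrite divr_ge0 ?cmod_ge0 ?ltW.
have t2 : t <= 2^-1 by rewrite ler_pdivrMr// mulrC.
pose s2 := s - (s`_0)%:P - s`_1 *: 'X.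
have s2E : s2.[h] = q.[z + h] - q.[z] - q^`().[z] * h.
  by rewrite !hornerE sE s0 s1.
have cs2 k : cmod s2`_k * cmod h ^+ k <= if (k < 2)%N then 0 else M * t ^+ k.
  rewrite !coefB coefC coefZ coefX; case: k => [|[|k]] /=.
  - by rewrite mulr0 subr0 subrr cmod0 mul0r.
  - by rewrite subr0 mulr1 subrr cmod0 mul0r.
  - rewrite mulr0 !subr0; have := cs k.+2; move: {k} k.+2 => n csn.
    rewrite expr_div_n mulrCA [leLHS]mulrC.
    by rewrite ler_wpM2l ?exprn_ge0 ?cmod_ge0// ler_pdivlMr ?exprn_gt0.
rewrite -s2E (le_trans (@horner_coef_tail _ s2 (cmod h) t M 0 2 _ _ _ _ _ _ _))//.
- exact: cmod_ge0.
- by rewrite (le_lt_trans t2)// invf_lt1// ltr1n.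
- by move=> k k2; have := cs2 k; rewrite k2.
- by move=> k; rewrite (le_trans (cs2 k))//; case: ifP => // _; rewrite mulr_ge0 ?exprn_ge0.
- rewrite mulr0 add0r [2 * M]mulrC -[leRHS]mulrA ler_wpM2l// mulrC ler_wpM2r ?exprn_ge0//.
  by rewrite invf_ple ?posrE//; lra.
Qed.

Lemma derivable_of_taylor F z D (C d : R) : 0 < d ->
  (forall h, cmod h <= d -> cmod (F (z + h) - F z - D * h) <= C * cmod h ^+ 2) ->
  derivable (F : R[i]^o -> R[i]^o) z 1.
Proof.
move=> d0 hC; apply/cvg_ex; exists D; apply/cvgrPdist_le => /= e e0.
have [eR e0'] : e = (complex.Re e)%:C /\ 0 < complex.Re e.
  by move: e0; rewrite ltcE/=; case: e => a b /= /andP[/eqP -> ->].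
pose c := Num.min d (complex.Re e / (`|C| + 1)).
have c0 : 0 < c by rewrite lt_min d0 divr_gt0// ltr_wpDl.
rewrite near_withinE; exists (c%:C); first by rewrite /= ltcR.
move=> h; rewrite /ball/= sub0r normrN cmod_normE ltcR => hc h0.
have h0' : 0 < cmod h by rewrite cmod_gt0.
have [hd he] : cmod h <= d /\ cmod h <= complex.Re e / (`|C| + 1).
  by apply/andP; rewrite -le_min ltW.
rewrite cmod_normE eR lecR.
have -> : D - h^-1 *: (F (h *: 1 + z) - F z) = - (h^-1 * (F (z + h) - F z - D * h)).
  rewrite /GRing.scale /= mulr1 addrC [h + z]addrC; field; exact: h0.
rewrite cmodN cmodM cmodV mulrC ler_pdivrMr//.
apply: le_trans (hC _ hd) _; rewrite expr2 mulrA ler_wpM2r ?cmod_ge0//.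
apply: (@le_trans _ _ ((`|C| + 1) * cmod h)).
  by rewrite ler_wpM2r ?cmod_ge0// (le_trans (ler_norm _))// lerDl.
by rewrite mulrC -ler_pdivlMr// ltr_wpDl.
Qed.

(** The derivatives are locally bounded, so that a subsequence of them converges
    to some [D] by Montel's theorem; the second order Taylor bounds, which are
    uniform in the polynomial, then pass to the limit and show that [D] is the
    derivative of [F]. *)
Lemma cvg_loc_analytic (q : nat -> {poly R[i]}) F :
  cvg_loc (fun n => horner (q n)) F -> analytic_disc F.
Proof.
move=> cq; have bq := cvg_loc_bounded cq.
have hT r : r < 1 -> exists d, exists M, exists N, [/\ 0 < d, r + d < 1 & forall n, (N <= n)%N ->
    forall z, cmod z <= r -> forall h, cmod h <= d -> cmod (q n).[z + h] <= M].
  move=> r1; pose d := (1 - r) / 2; have rd : r + d < 1 by rewrite /d; lra.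
  have [M [N hM]] := bq (r + d) rd.
  exists d, M, N; split => //; first by rewrite /d; lra.
  by move=> n Nn z zr h hd; rewrite hM// (le_trans (cmodD _ _))// lerD.
have bq' : bounded_loc (fun n => horner (q n)^`()).
  move=> r r1; have [d [M [N [d0 rd hM]]]] := hT r r1.
  exists (M / d), N => n Nn z zr; rewrite ler_pdivlMr//.
  by have [] := taylor2 d0 (hM n Nn z zr).
have [phi [D [phim cD]]] := montel bq'.
move=> z; rewrite /disc/= => z1.
have [d [M [N [d0 rd hM]]]] := hT _ z1.
apply: (@derivable_of_taylor F z (D z) (2 * M / d ^+ 2) (d / 2)); first by rewrite divr_gt0.
move=> h hd; apply/ler_addgt0Pr => e e0.
pose e' := e / (2 + cmod h).
have h2 : 0 < 2 + cmod h by rewrite ltr_wpDr ?cmod_ge0.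
have e'0 : 0 < e' by rewrite divr_gt0.
have [N1 hN1] := cq _ e' rd e'0.
have [N2 hN2] := cD _ e' z1 e'0.
pose n := maxn N (maxn N1 N2).
have Nn : (N <= phi n)%N by apply: leq_trans (phim n); rewrite leq_maxl.
have N1n : (N1 <= phi n)%N by apply: leq_trans (phim n); rewrite leq_max leq_maxl orbT.
have N2n : (N2 <= n)%N by rewrite leq_max leq_maxr orbT.
have [_ /(_ h hd) T] := taylor2 d0 (hM _ Nn z (lexx _)).
have zh : cmod (z + h) <= cmod z + d.
  by rewrite (le_trans (cmodD _ _))// lerD2l (le_trans hd)// ler_pdivrMr//; lra.
have A1 := hN1 _ N1n _ zh.
have A2 := hN1 _ N1n z (_ : cmod z <= cmod z + d).
have A3 := hN2 _ N2n z (lexx _).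
set P := q (phi n) in T A1 A2 A3.
have -> : F (z + h) - F z - D z * h = (P.[z + h] - P.[z] - P^`().[z] * h) +
  ((F (z + h) - P.[z + h]) + ((P.[z] - F z) + (P^`().[z] - D z) * h)) by ring.
rewrite (le_trans (cmodD _ _))// lerD//.
  by rewrite (le_trans T)// expr_div_n; rewrite le_eqVlt; apply/orP; left; apply/eqP; ring.
rewrite (le_trans (cmodD _ _))// [X in X + _ <= _]cmodB.
have -> : e = e' + (e' + e' * cmod h) by rewrite /e'; field; rewrite gt_eqF.
rewrite lerD// (le_trans (cmodD _ _))// lerD//; first by apply: A2; rewrite lerDl ltW.
by rewrite cmodM ler_wpM2r ?cmod_ge0.
Qed.

Lemma derivable_continuous F z e : derivable (F : R[i]^o -> R[i]^o) z 1 -> 0 < e ->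
  exists2 d, 0 < d & forall u, cmod (u - z) <= d -> cmod (F u - F z) <= e.
Proof.
move=> /derivable1_diffP/differentiable_continuous /cvgrPdist_le cF e0.
have := cF e%:C; rewrite ltcR => /(_ e0) [c /= c0 hc].
have [cR c0'] : c = (complex.Re c)%:C /\ 0 < complex.Re c.
  by move: c0; rewrite ltcE/=; case: c {hc} => a b /= /andP[/eqP -> ->].
exists (complex.Re c / 2); first by rewrite divr_gt0.
move=> u hu; have := hc u; rewrite /ball/= cmod_normE cR ltcR cmodB => /(_ _).
rewrite cmod_normE lecR cmodB; apply.
by rewrite cmodB (le_lt_trans hu)// ltr_pdivrMr// ltr_pMr// ltr1n.
Qed.

End Analyticity.

(** * The binomial series *)

Section BinomialSeries.
Variable R : realType.
Implicit Types (z w : R[i]) (s t r e : R).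

(** The coefficients of the power series of (1 - z)^s at the origin. *)
Definition binc s (k : nat) : R := \prod_(0 <= i < k) ((i%:R - s) / i.+1%:R).

Definition binpoly s n : {poly R[i]} := \poly_(k < n) (binc s k)%:C.

Lemma binc0 s : binc s 0 = 1.
Proof. by rewrite /binc big_geq. Qed.

Lemma bincS s k : k.+1%:R * binc s k.+1 = (k%:R - s) * binc s k.
Proof.
by rewrite /binc big_nat_recr//= mulrC -mulrA divfK ?pnatr_eq0// mulrC.
Qed.

Lemma binc_le1 s k : -1 <= s <= 1 -> `|binc s k| <= 1.
Proof.
move=> /andP[s1 s2]; rewrite /binc normr_prod; apply: prodr_ile1 => i _.
rewrite normr_ge0/= normrM normrV ?unitfE ?pnatr_eq0// [X in _ / X]ger0_norm//.
have i0 : 0 <= (i%:R : R) by [].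
by rewrite ler_pdivrMr ?ltr0n// mul1r ler_norml -natr1; apply/andP; split; lra.
Qed.

(** Vandermonde's convolution, from the recurrence [bincS]. *)
Lemma bincD s t k : \sum_(i < k.+1) binc s i * binc t (k - i) = binc (s + t) k.
Proof.
elim: k => [|k IH]; first by rewrite big_ord1 !binc0 mulr1.
apply: (@mulfI _ k.+1%:R); first by rewrite pnatr_eq0.
rewrite bincS -IH big_distrr /=.
transitivity (\sum_(i < k.+2) (i%:R * binc s i) * binc t (k.+1 - i) +
              \sum_(i < k.+2) binc s i * ((k.+1 - i)%:R * binc t (k.+1 - i))).
  rewrite -big_split; apply: eq_bigr => i _ /=.
  have -> : k.+1%:R = i%:R + (k.+1 - i)%:R :> R by rewrite -natrD subnKC ?leq_ord.
  by ring.
rewrite big_ord_recl /= !mul0r add0r [X in _ + X]big_ord_recr /= subnn mul0r mulr0 addr0.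
rewrite -big_split big_distrr /=; apply: eq_bigr => i _ /=.
rewrite /bump/= add1n subSS bincS subSn ?leq_ord// bincS natrB ?leq_ord//.
by ring.
Qed.

Lemma binpoly_coef s n k : cmod (binpoly s n)`_k = if (k < n)%N then `|binc s k| else 0.
Proof. by rewrite coef_poly; case: ifP => _; [exact: cmod_real|exact: cmod0]. Qed.

Lemma binpoly1 n : (1 < n)%N -> binpoly 1 n = 1 - 'X.
Proof.
move=> n1; apply/polyP => k; rewrite coef_poly coefB coef1 coefX.
have bS j : binc 1 j.+2 = 0.
  by rewrite /binc (@big_nat_recl _ _ _ j.+1)//= big_nat_recl//= subrr mul0r mul0r mulr0.
case: k => [|[|k]] /=.
- by rewrite (ltn_trans _ n1)// binc0 subr0.
- by rewrite n1 /binc big_nat1 sub0r divr1 rmorphN1 sub0r.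
- by rewrite bS subr0; case: ifP.
Qed.

Lemma binpoly0 n : (0 < n)%N -> binpoly 0 n = 1.
Proof.
move=> n1; apply/polyP => k; rewrite coef_poly coef1.
case: k => [|k] /=; first by rewrite n1 binc0.
by rewrite /binc big_nat_recl//= subrr mul0r mul0r; case: ifP.
Qed.

Lemma binpoly_cauchy s r n m z : -1 <= s <= 1 -> 0 <= r < 1 -> (n <= m)%N ->
  cmod z <= r -> cmod ((binpoly s m).[z] - (binpoly s n).[z]) <= r ^+ n / (1 - r).
Proof.
move=> s1 /andP[r0 r1] nm zr; rewrite -hornerN -hornerD.
have hk k : cmod (binpoly s m - binpoly s n)`_k <= (n <= k)%:R.
  rewrite coefB !coef_poly; have [kn|nk] := ltnP k n.
    by rewrite (leq_trans kn nm) subrr cmod0.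
  by rewrite subr0; case: ifP => _; rewrite ?cmod0 ?ler01// cmod_real binc_le1.
apply: le_trans (@horner_coef_tail _ _ r r 1 0 n r0 r0 r1 _ _ z zr) _.
- move=> k kn; rewrite mulr_le0_ge0 ?exprn_ge0// (le_trans (hk k))//.
  by rewrite leqNgt kn.
- by move=> k; rewrite ler_wpM2r ?exprn_ge0// (le_trans (hk k))// lern1 leq_b1.
- by rewrite mulr0 add0r mul1r.
Qed.

Lemma binpoly_le s r n z : -1 <= s <= 1 -> 0 <= r < 1 -> cmod z <= r ->
  cmod (binpoly s n).[z] <= (1 - r)^-1.
Proof.
move=> s1 r01 zr; have := binpoly_cauchy s1 r01 (leq0n n) zr.
have -> : binpoly s 0 = 0 by apply/polyP => k; rewrite coef_poly coef0.
by rewrite expr0 mul1r horner0 subr0.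
Qed.

Lemma succn_expr_le (u : R) k : 0 <= u -> u < 1 -> k.+1%:R * u ^+ k <= (1 - u)^-1.
Proof.
move=> u0 u1; rewrite -[leRHS]mul1r ler_pdivlMr ?subr_gt0//.
apply: (@le_trans _ _ ((\sum_(i < k.+1) u ^+ i) * (1 - u))).
  rewrite ler_wpM2r ?subr_ge0 ?(ltW u1)// mulr_natl -[X in _ *+ X]card_ord -sumr_const.
  apply: ler_sum => i _; apply: ler_wiXn2l => //; first exact: ltW.
  by rewrite -ltnS.
by rewrite mulrC -[X in X * _]opprB mulNr -subrX1 opprB lerBlDr lerDl exprn_ge0.
Qed.

(** The product agrees with the partial sum for the exponent [s + t] in
    degrees below [n], and for exponents in [-1, 1] its other coefficients grow
    at most linearly. *)
Lemma binpoly_mul s t r e : -1 <= s <= 1 -> -1 <= t <= 1 -> -1 <= s + t <= 1 ->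
  r < 1 -> 0 < e -> exists N, forall n, (N <= n)%N -> forall z, cmod z <= r ->
  cmod ((binpoly s n).[z] * (binpoly t n).[z] - (binpoly (s + t) n).[z]) <= e.
Proof.
move=> s1 t1 st1 r1 e0.
pose r' := Num.max r 0; have r'1 : r' < 1 by rewrite gt_max r1 ltr01.
have r'0 : 0 <= r' by rewrite le_max lexx orbT.
pose v := (1 + r') / 2; have [rv v1] : r' < v /\ v < 1 by rewrite /v; split; lra.
have v0 : 0 < v by lra.
pose u := r' / v; have u0 : 0 <= u by rewrite divr_ge0// ltW.
have u1 : u < 1 by rewrite ltr_pdivrMr// mul1r.
pose M := (1 - u)^-1; have M0 : 0 < M by rewrite invr_gt0 subr_gt0.
have [|K hK] := @cvg_pow_lt R v (e / M * (1 - v)) (ltW v0) v1.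
  by rewrite mulr_gt0 ?subr_gt0// divr_gt0.
exists K => n Kn z zr; rewrite -hornerM -hornerN -hornerD.
have zr' : cmod z <= r' by rewrite le_max zr.
have hk k : cmod (binpoly s n * binpoly t n - binpoly (s + t) n)`_k <=
    if (k < n)%N then 0 else k.+1%:R.
  rewrite coefB coefM coef_poly; case: ifP => kn.
    have -> : \sum_(j < k.+1) (binpoly s n)`_j * (binpoly t n)`_(k - j) = (binc (s + t) k)%:C.
      rewrite -bincD rmorph_sum; apply: eq_bigr => i _.
      have ik : (i <= k)%N by rewrite -ltnS.
      by rewrite !coef_poly (leq_ltn_trans ik kn) (leq_ltn_trans (leq_subr _ _) kn) rmorphM.
    by rewrite subrr cmod0.
  rewrite subr0 (le_trans (cmod_sum _ _ _))// -[X in _ <= X%:R]card_ord -sumr_const.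
  apply: ler_sum => i _; rewrite cmodM !binpoly_coef mulr_ile1 ?(fun_if (fun x => 0 <= x))//.
  - by case: ifP.
  - by case: ifP.
  - by case: ifP => // _; exact: binc_le1.
  - by case: ifP => // _; exact: binc_le1.
apply: le_trans (@horner_coef_tail _ _ r' v M 0 n r'0 (ltW v0) v1 _ _ z zr') _.
- by move=> k kn; rewrite mulr_le0_ge0 ?exprn_ge0// (le_trans (hk k))// kn.
- move=> k; have -> : r' = u * v by rewrite /u divfK// gt_eqF.
  rewrite exprMn mulrA ler_wpM2r ?exprn_ge0 ?(ltW v0)//.
  apply: le_trans (@succn_expr_le u k u0 u1).
  by rewrite ler_wpM2r ?exprn_ge0// (le_trans (hk k))//; case: ifP.
rewrite mulr0 add0r mulrC -ler_pdivlMr// ler_pdivrMr ?subr_gt0//.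
by apply: le_trans hK; rewrite ler_wiXn2l// ltW.
Qed.

(** Doubling the argument, up to periodicity, squares the value: iterating, a
    value above 1 would contradict boundedness. *)
Lemma bounded_doubling (f : R -> R) (K : R) :
  (forall s, 0 <= s <= 1 -> 0 <= f s <= K) ->
  (forall s, 0 <= s <= 1 -> exists2 s', 0 <= s' <= 1 & f s ^+ 2 = f s') ->
  forall s, 0 <= s <= 1 -> f s <= 1.
Proof.
move=> fK f2.
have fX k s : 0 <= s <= 1 -> f s ^+ (2 ^ k) <= K.
  elim: k s => [|k IH] s s01; first by have /andP[] := fK s s01.
  have [s' s'01 e] := f2 s s01.
  by rewrite expnS exprM e IH.
move=> s s01; rewrite leNgt; apply/negP => f1.
have f0 : 0 < f s by rewrite (lt_trans ltr01).
have K0 : 0 < K by rewrite (lt_le_trans _ (fX 0%N s s01))// exprn_gt0.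
have [|||k hk] := @cvg_pow_lt R (f s)^-1 (2 * K)^-1.
- by rewrite invr_ge0 ltW.
- by rewrite invf_lt1.
- by rewrite invr_gt0 mulr_gt0.
have := fX k s s01; apply/negP; rewrite -ltNge.
apply: (@lt_le_trans _ _ (f s ^+ k)); last first.
  by apply: ler_weXn2l; [exact: ltW|rewrite ltnW// ltn_expl].
move: hk; rewrite exprVn lef_pV2 ?posrE ?mulr_gt0 ?exprn_gt0// => hk.
by apply: lt_le_trans hk; rewrite ltr_pMl// ltr1n.
Qed.

(** The limit of [cmod (binpoly s n).[z]] exists, is multiplicative in the
    exponent and bounded, and equals [cmod (1 - z)] at exponent 1. Divided by
    [cmod (1 - z) `^ s] it extends to a bounded multiplicative function of
    period 1 in [s], hence is constant. *)
Lemma binpoly_cvg s r e : -1 <= s <= 1 -> r < 1 -> 0 < e ->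
  exists N, forall n, (N <= n)%N -> forall z, cmod z <= r ->
    `|cmod (binpoly s n).[z] - cmod (1 - z) `^ s| <= e.
Proof.
move=> s1 r1 e0; pose r' := Num.max r 0.
have r'1 : r' < 1 by rewrite gt_max r1 ltr01.
have r'0 : 0 <= r' by rewrite le_max lexx orbT.
have r'01 : 0 <= r' < 1 by apply/andP.
suff lim z : cmod z <= r' ->
    cmod (binpoly s n).[z] @[n --> \oo] --> cmod (1 - z) `^ s.
  have [|N hN] := @cvg_pow_lt R r' (e * (1 - r')) r'0 r'1; first by rewrite mulr_gt0// subr_gt0.
  exists N => n Nn z zr; have zr' : cmod z <= r' by rewrite le_max zr.
  have e1 : r' ^+ n / (1 - r') <= e.
    by rewrite ler_pdivrMr ?subr_gt0// (le_trans _ hN)// ler_wiXn2l// ltW.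
  apply: le_trans e1; rewrite distrC.
  have c := lim z zr'.
  have c' : `|cmod (binpoly s m).[z] - cmod (binpoly s n).[z]| @[m --> \oo] -->
      `|cmod (1 - z) `^ s - cmod (binpoly s n).[z]|.
    by apply: cvg_norm; apply: cvgB => //; exact: cvg_cst.
  rewrite -(cvg_lim _ c')//; apply: limr_le; first by apply/cvg_ex; eexists; exact: c'.
  exists n => // m /= nm; rewrite (le_trans (cmod_dist _ _))//.
  exact: binpoly_cauchy.
move=> zr; pose A := cmod (1 - z).
have A0 : 0 < A.
  have := cmod_dist 1 z; rewrite cmod1 => /(le_trans (ler_norm _)).
  by apply: lt_le_trans; rewrite subr_gt0 (le_lt_trans zr).
have cv t : -1 <= t <= 1 -> cvg (cmod (binpoly t n).[z] @[n --> \oo]).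
  move=> t1; apply: cauchy_cvg; apply/cauchy_ballP => d d0.
  have [|N hN] := @cvg_pow_lt R r' (d / 2 * (1 - r')) r'0 r'1.
    by rewrite mulr_gt0 ?subr_gt0// divr_gt0.
  have hd n m : (N <= n)%N -> (n <= m)%N ->
      `|cmod (binpoly t m).[z] - cmod (binpoly t n).[z]| < d.
    move=> Nn nm; apply: (@le_lt_trans _ _ (d / 2)); last by rewrite ltr_pdivrMr// ltr_pMr// ltr1n.
    rewrite (le_trans (cmod_dist _ _))// (le_trans (binpoly_cauchy t1 r'01 nm zr))//.
    by rewrite ler_pdivrMr ?subr_gt0// (le_trans _ hN)// ler_wiXn2l// ltW.
  pose S := [set cmod (binpoly t n).[z] | n in [set n | (N <= n)%N]].
  have SN : nbhs (cmod (binpoly t n).[z] @[n --> \oo]) S by exists N => // n Nn; exists n.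
  exists (S, S); first by split.
  move=> [_ _] [[n /= Nn <-] [m /= Nm <-]]; rewrite /ball/=; have [nm|/ltnW mn] := leqP n m.
    by rewrite distrC hd.
  by rewrite hd.
pose L t := limn (fun n => cmod (binpoly t n).[z]).
have hL t : -1 <= t <= 1 -> cmod (binpoly t n).[z] @[n --> \oo] --> L t by exact: cv.
have L0 t : -1 <= t <= 1 -> 0 <= L t.
  move=> t1; apply: limr_ge; first exact: cv.
  by apply: nearW => n; exact: cmod_ge0.
have LB t : -1 <= t <= 1 -> L t <= (1 - r')^-1.
  move=> t1; apply: limr_le; first exact: cv.
  by apply: nearW => n; exact: binpoly_le.
have LD t v : -1 <= t <= 1 -> -1 <= v <= 1 -> -1 <= t + v <= 1 -> L t * L v = L (t + v).
  move=> t1 v1 tv1; have c2 :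
      cmod (binpoly t n).[z] * cmod (binpoly v n).[z] - cmod (binpoly (t + v) n).[z]
        @[n --> \oo] --> L t * L v - L (t + v).
    by apply: cvgB; [apply: cvgM|]; exact: hL.
  apply/eqP; rewrite -subr_eq0; apply/eqP; rewrite -(cvg_lim _ c2)//; apply: cvg_lim => //.
  apply/cvgrPdist_le => d d0.
  have [N hN] := binpoly_mul t1 v1 tv1 r'1 d0.
  exists N => // n /= Nn; rewrite sub0r normrN -cmodM (le_trans (cmod_dist _ _))//.
  exact: hN.
have L1 : L 1 = A.
  apply: cvg_lim => //; apply: (@cvg_trans _ (A @[n --> \oo])); last exact: cvg_cst.
  apply: near_eq_cvg; exists 2 => // n /= n2.
  by rewrite binpoly1// !hornerE.
have L0' : L 0 = 1.
  apply: cvg_lim => //; apply: (@cvg_trans _ ((1:R) @[n --> \oo])); last exact: cvg_cst.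
  apply: near_eq_cvg; exists 1 => // n /= n1.
  by rewrite binpoly0// hornerC cmod1.
pose f t := L t / A `^ t.
have f0 t : -1 <= t <= 1 -> 0 <= f t.
  by move=> t1; rewrite divr_ge0 ?L0// powR_ge0.
have fD t v : -1 <= t <= 1 -> -1 <= v <= 1 -> -1 <= t + v <= 1 -> f t * f v = f (t + v).
  move=> t1 v1 tv1; rewrite /f -LD// powRD; last by rewrite (gt_eqF A0) implybT.
  by field; rewrite !gt_eqF ?powR_gt0.
have f1 : f 1 = 1 by rewrite /f L1 powRr1 ?divff ?gt_eqF// ltW.
have f00 : f 0 = 1 by rewrite /f L0' powRr0 divr1.
have fN1 : f (-1) = 1.
  by have := fD (-1) 1; rewrite f1 addNr f00 mulr1; apply; lra.
pose K := (1 - r')^-1 * (1 + A^-1).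
have fK t : 0 <= t <= 1 -> 0 <= f t <= K.
  move=> t01; have t1 : -1 <= t <= 1 by lra.
  rewrite f0//= /f ler_pM ?LB ?L0 ?invr_ge0 ?powR_ge0//.
  have [A1|A1] := leP A 1.
    apply: (@le_trans _ _ A^-1); last by rewrite lerDr.
    rewrite lef_pV2 ?posrE ?powR_gt0// ger1_powR ?A0//; lra.
  apply: (@le_trans _ _ 1); last by rewrite lerDl invr_ge0 ltW.
  rewrite invf_le1 ?powR_gt0// -(@powRr0 _ A) ler_powR//; lra.
have f2 t : 0 <= t <= 1 -> exists2 t', 0 <= t' <= 1 & f t ^+ 2 = f t'.
  move=> t01; have [h|h] := leP (2 * t) 1.
    by exists (2 * t); [lra|rewrite expr2 fD; [congr f| | |]; lra].
  exists (2 * t - 1); first lra.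
  have e1 : f (t - 1) = f t by rewrite -fD ?fN1 ?mulr1//; lra.
  by rewrite expr2 -[X in _ * X]e1 fD; [congr f| | |]; lra.
have le1 := bounded_doubling fK f2.
have fE : f s = 1.
  have h t : 0 <= t <= 1 -> f t = 1 /\ f (- t) = 1.
    move=> t01; have h1 := le1 _ t01.
    have h2 : f (- t) <= 1.
      have <- : f (1 - t) = f (- t) by rewrite -fD ?f1 ?mul1r//; lra.
      by apply: le1; lra.
    have h3 : f t * f (- t) = 1 by rewrite fD ?subrr//; lra.
    have h4 : 0 <= f t by apply: f0; lra.
    have h5 : 0 <= f (- t) by apply: f0; lra.
    by split; nra.
  have [s0|s0] := leP 0 s; first by apply: (h s _).1; lra.
  by rewrite -[s]opprK; apply: (h (- s) _).2; lra.
have -> : A `^ s = L s.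
  by have := fE; rewrite /f => /divr1_eq.
exact: hL.
Qed.

End BinomialSeries.

(** * Area and its invariance under rotations *)

Section PlaneMeasure.
Variable R : realType.
Local Notation borelR := (measurableTypeR R).
Local Notation plane := (borelR * borelR)%type.

Lemma borel_lebesgue (A : set plane) : measurable A ->
  measurable (A : set (lebesgue_plane R)).
Proof. exact: caratheodory_measurable_mu_ext. Qed.

Lemma measurable_to_plane (D : set (lebesgue_plane R)) : measurable D ->
  measurable_fun D (fun u : lebesgue_plane R => (u : plane)).
Proof. by move=> mD _ B mB; apply: measurableI => //; exact: borel_lebesgue. Qed.

Lemma completed_borel_area (A : set plane) : measurable A ->
  @completed_measure_extension _ _ _ (borel_area R) A = borel_area R A.
Proof. by move=> mA; rewrite /completed_measure_extension/= measurable_mu_extE. Qed.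

Lemma dA_borel (A : set plane) : measurable A ->
  dA R A = ((pi^-1 : R)%:E * borel_area R A)%E.
Proof. by move=> mA; rewrite -completed_borel_area. Qed.

Lemma borel_fun_lebesgue (D : set plane) d (T : measurableType d) (h : plane -> T) :
  measurable D -> measurable_fun D h ->
  measurable_fun (D : set (lebesgue_plane R)) (h : lebesgue_plane R -> T).
Proof.
move=> mD mh; move=> _ B mB.
exact: (borel_lebesgue (mh mD B mB)).
Qed.

Lemma integral_dA_borel (D : set plane) (h : plane -> \bar R) :
  measurable D -> @measurable_fun _ _ plane (\bar R) D h -> (forall u, D u -> 0 <= h u)%E ->
  (\int[dA R]_(u in (D : set (lebesgue_plane R))) h u =
   (pi^-1 : R)%:E * \int[borel_area R]_(u in D) h u)%E.
Proof.
move=> mD mh h0; rewrite /dA.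
have mD' : measurable (D : set (lebesgue_plane R)) by exact: borel_lebesgue.
rewrite ge0_integral_mscale//=; last exact: borel_fun_lebesgue.
congr (_ * _)%E.
pose phi := fun u : lebesgue_plane R => (u : plane).
have mphi : measurable_fun setT phi by exact: measurable_to_plane.
transitivity (\int[pushforward (@completed_measure_extension _ _ _ (borel_area R)) phi]_(u in D) h u)%E.
  rewrite (ge0_integral_pushforward mphi)// => y; rewrite inE; exact: h0.
apply: eq_measure_integral => A mA AD.
exact: completed_borel_area.
Qed.

Lemma borel_area_rect (A B : set borelR) : measurable A -> measurable B ->
  borel_area R (A `*` B) = (lebesgue_measure A * lebesgue_measure B)%E.
Proof. by move=> mA mB; exact: product_measure1E. Qed.

Lemma borel_area_xsection (A : set plane) :
  borel_area R A = (\int[lebesgue_measure]_x lebesgue_measure (xsection A x))%E.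
Proof. by []. Qed.

Lemma borel_area_ysection (A : set plane) : measurable A ->
  borel_area R A = (\int[lebesgue_measure]_y lebesgue_measure (ysection A y))%E.
Proof.
move=> mA; apply: (@product_measure_unique _ _ _ _ R lebesgue_measure lebesgue_measure
  (lebesgue_measure \x^ lebesgue_measure)%E) => // C D mC mD.
exact: product_measure2E.
Qed.

Lemma borel_area_sigma_finite : sigma_finite setT (borel_area R).
Proof.
have /sigma_finiteP[F [TF ndF Foo]] := sigma_finiteT (@lebesgue_measure R).
exists (fun n => F n `*` F n).
  rewrite -setXTT TF predeqE => -[x y]; split.
    move=> [/= [n _ Fnx] [k _ Gky]]; exists (maxn n k) => //; split.
      by move: x Fnx; exact/subsetPset/ndF/leq_maxl.
    by move: y Gky; exact/subsetPset/ndF/leq_maxr.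
  by move=> [n _ []/= ? ?]; split; exists n.
move=> k; have [mF Fk] := Foo k; split; first exact: measurableX.
by rewrite borel_area_rect// lte_mul_pinfty// ge0_fin_numE.
Qed.

Lemma dA_sigma_finite : sigma_finite setT (dA R).
Proof.
have [F FT Foo] := @completed_measure_extension_sigma_finite _ _ _ (borel_area R) borel_area_sigma_finite.
exists F => // i; have [mF Fi] := Foo i; split => //.
by rewrite /dA /mscale/= lte_mul_pinfty.
Qed.

(** The measure [dA R] with sigma-finiteness attached, as Tonelli's theorem
    requires. *)
Definition area : set (lebesgue_plane R) -> \bar R := dA R.
HB.instance Definition _ := Measure.copy area (dA R).
HB.instance Definition _ := Measure_isSigmaFinite.Build _ _ _ area dA_sigma_finite.

Definition area_preserving (f : plane -> plane) : Prop :=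
  measurable_fun setT f /\
  forall A, measurable A -> borel_area R (f @^-1` A) = borel_area R A.

Lemma area_preserving_comp f g :
  area_preserving f -> area_preserving g -> area_preserving (f \o g).
Proof.
move=> [mf pf] [mg pg]; split; first exact: measurableT_comp.
move=> A mA; rewrite comp_preimage pg ?pf//.
by rewrite -[_ @^-1` _]setTI; exact: mf.
Qed.

Lemma area_preserving_of_rect (f : plane -> plane) : measurable_fun setT f ->
  (forall A B : set R, measurable A -> measurable B ->
     borel_area R (f @^-1` (A `*` B)) = (lebesgue_measure A * lebesgue_measure B)%E) ->
  area_preserving f.
Proof.
move=> mf fE; split => // A mA.
pose mf_mixin := isMeasurableFun.Build _ _ _ _ _ mf.
pose F : {mfun plane >-> plane} := HB.pack f mf_mixin.
exact/esym/(@product_measure_unique _ _ _ _ R lebesgue_measure lebesgue_measure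
  (pushforward (borel_area R) F)).
Qed.

Lemma lebesgue_translation (A : set borelR) (c : R) : measurable A ->
  lebesgue_measure ((fun x : R => x + c) @^-1` A) = lebesgue_measure A.
Proof.
move=> mA.
have mf : measurable_fun setT (fun x : borelR => (x + c : borelR)).
  by apply: measurable_funD => //; exact: measurable_id.
pose mf_mixin := isMeasurableFun.Build _ _ _ _ _ mf.
pose F : {mfun borelR >-> borelR} := HB.pack (fun x : borelR => (x + c : borelR)) mf_mixin.
apply/esym/(@lebesgue_measure_unique R (pushforward lebesgue_measure F)) => //= _ [[a b]] _ <-.
rewrite /pushforward/=.
have -> : (fun x : R => x + c) @^-1` `]a, b]%classic = `]a - c, b - c]%classic.
  by apply/seteqP; split => x /=; rewrite !in_itv/= ltrBlDr lerBrDr.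
rewrite !lebesgue_measure_itv/= !lte_fin ltrD2r; case: ifP => // _.
by rewrite -!EFinB; congr _%:E; ring.
Qed.

Lemma area_preserving_shearx (t : R) : area_preserving (fun u => (u.1 + t * u.2, u.2)).
Proof.
have mf : measurable_fun setT (fun u : plane => (u.1 + t * u.2 : borelR, u.2 : borelR)).
  apply: measurable_fun_pair; last exact: measurable_snd.
  by apply: measurable_funD; [exact: measurable_fst|apply: measurable_funM => //; exact: measurable_snd].
apply: area_preserving_of_rect => // A B mA mB.
have mAB : measurable ((fun u : plane => (u.1 + t * u.2 : borelR, u.2 : borelR)) @^-1` (A `*` B)).
  by rewrite -[_ @^-1` _]setTI; apply: mf => //; exact: measurableX.
rewrite borel_area_ysection//.
under eq_integral => y _.
  have -> : lebesgue_measure (ysection ((fun u : plane => (u.1 + t * u.2 : borelR, u.2 : borelR)) @^-1` (A `*` B)) y) =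
    (lebesgue_measure A * (\1_B y)%:E)%E.
    rewrite indicE; have [yB|yB] := boolP (y \in B).
      rewrite mule1 -(lebesgue_translation (t * y) mA); congr lebesgue_measure.
      apply/seteqP; split => x; rewrite /ysection/= inE/=; first by case.
      by move=> xA; split => //=; move: yB; rewrite inE.
    rewrite mule0 (_ : ysection _ _ = set0) ?measure0//.
    apply/seteqP; split => x //; rewrite /ysection/= inE/= => -[_ /= yB'].
    by move: yB; rewrite notin_setE; apply.
  over.
rewrite ge0_integralZl//; last by apply/measurable_EFinP; exact: measurable_indic.
by rewrite integral_indic// setIT.
Qed.

Lemma area_preserving_sheary (t : R) : area_preserving (fun u => (u.1, u.2 + t * u.1)).
Proof.
have mf : measurable_fun setT (fun u : plane => (u.1 : borelR, u.2 + t * u.1 : borelR)).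
  apply: measurable_fun_pair; first exact: measurable_fst.
  by apply: measurable_funD; [exact: measurable_snd|apply: measurable_funM => //; exact: measurable_fst].
apply: area_preserving_of_rect => // A B mA mB.
rewrite borel_area_xsection.
under eq_integral => x _.
  have -> : lebesgue_measure (xsection ((fun u : plane => (u.1 : borelR, u.2 + t * u.1 : borelR)) @^-1` (A `*` B)) x) =
    (lebesgue_measure B * (\1_A x)%:E)%E.
    rewrite indicE; have [xA|xA] := boolP (x \in A).
      rewrite mule1 -(lebesgue_translation (t * x) mB); congr lebesgue_measure.
      apply/seteqP; split => y; rewrite /xsection/= inE/=; first by case.
      by move=> yB; split => //=; move: xA; rewrite inE.
    rewrite mule0 (_ : xsection _ _ = set0) ?measure0//.
    apply/seteqP; split => y //; rewrite /xsection/= inE/= => -[/= xA' _].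
    by move: xA; rewrite notin_setE; apply.
  over.
rewrite ge0_integralZl//; last by apply/measurable_EFinP; exact: measurable_indic.
by rewrite integral_indic// setIT muleC.
Qed.

Lemma area_preserving_translation (a b : R) :
  area_preserving (fun u => (u.1 + a, u.2 + b)).
Proof.
have mf : measurable_fun setT (fun u : plane => (u.1 + a : borelR, u.2 + b : borelR)).
  by apply: measurable_fun_pair; apply: measurable_funD.
apply: area_preserving_of_rect => // A B mA mB.
have mt (C : set borelR) c : measurable C -> measurable ((fun x : borelR => (x + c : borelR)) @^-1` C).
  move=> mC; rewrite -[_ @^-1` _]setTI; apply: measurable_funD => //; exact: measurable_id.
rewrite -(lebesgue_translation a mA) -(lebesgue_translation b mB).
by rewrite -borel_area_rect//; exact: mt.
Qed.

(** A rotation other than the half turn is a product of three shears, and shears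
    preserve area by Tonelli's theorem and the invariance of the Lebesgue
    measure of the line. *)
Lemma area_preserving_rotation (w : R[i]) : cmod w = 1 -> w != -1 ->
  exists2 f, area_preserving f & forall u, cplx (f u) = w * cplx u.
Proof.
case: w => c s w1 wN1.
have cs : c ^+ 2 + s ^+ 2 = 1 by have := sqr_cmod (c +i* s); rewrite w1 expr1n.
have c1 : 1 + c != 0.
  apply: contra wN1 => c1; have ec : c = -1 by lra.
  rewrite ec sqrrN expr1n in cs; have es : s = 0.
    by apply/eqP; rewrite -sqrf_eq0; apply/eqP; lra.
  by rewrite ec es; apply/eqP; simpc.
exists ((fun u => (u.1 + - (s / (1 + c)) * u.2, u.2)) \o
        ((fun u => (u.1, u.2 + s * u.1)) \o
         (fun u => (u.1 + - (s / (1 + c)) * u.2, u.2)))).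
  apply: area_preserving_comp; first exact: area_preserving_shearx.
  by apply: area_preserving_comp; [exact: area_preserving_sheary|exact: area_preserving_shearx].
move=> [x y]; rewrite /cplx/=; simpc; congr (_ +i* _).
  have ss : s ^+ 2 = (1 - c) * (1 + c) by rewrite -subr_sqr expr1n -cs addrAC subrr add0r.
  have sk : s / (1 + c) * s = 1 - c by rewrite mulrAC -expr2 ss mulfK.
  have kc : s / (1 + c) * (1 + c) = s by rewrite divfK.
  move: sk kc; set k := s / (1 + c) => sk kc.
  transitivity (x - k * y - k * y - (k * s) * x + (k * s) * (k * y)); first by ring.
  rewrite sk; transitivity (c * x - (k * (1 + c)) * y); first by ring.
  by rewrite kc.
have ss : s ^+ 2 = (1 - c) * (1 + c) by rewrite -subr_sqr expr1n -cs addrAC subrr add0r.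
have sk : s / (1 + c) * s = 1 - c by rewrite mulrAC -expr2 ss mulfK.
move: sk; set k := s / (1 + c) => sk.
transitivity (y + s * x - (k * s) * y); first by ring.
by rewrite sk; ring.
Qed.

Lemma integral_area_preserving f (D : set plane) (h : plane -> \bar R) :
  area_preserving f -> measurable D -> measurable_fun D h ->
  (forall u, D u -> 0 <= h u)%E ->
  (\int[borel_area R]_(u in f @^-1` D) h (f u) = \int[borel_area R]_(u in D) h u)%E.
Proof.
move=> [mf pf] mD mh h0.
transitivity (\int[pushforward (borel_area R) f]_(u in D) h u)%E.
  by rewrite (ge0_integral_pushforward mf)// => y; rewrite inE; exact: h0.
apply: eq_measure_integral => A mA AD; exact: pf.
Qed.

End PlaneMeasure.

(** * Measurability of complex functions *)

Section ComplexMeasurability.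
Variable R : realType.
Local Notation borelR := (measurableTypeR R).

Definition cmeasurable d (T : measurableType d) (D : set T) (f : T -> R[i]) : Prop :=
  measurable_fun D (fun x => complex.Re (f x)) /\
  measurable_fun D (fun x => complex.Im (f x)).

Lemma cmeasurable_cst d (T : measurableType d) (D : set T) c :
  cmeasurable D (fun=> c).
Proof. by split; exact: measurable_cst. Qed.

Lemma cmeasurableD d (T : measurableType d) (D : set T) f g :
  cmeasurable D f -> cmeasurable D g -> cmeasurable D (fun x => f x + g x).
Proof.
move=> [f1 f2] [g1 g2]; split.
  by rewrite (_ : (fun x => _) = (fun x => complex.Re (f x) + complex.Re (g x)));
    [exact: measurable_funD|apply/funext => x; case: (f x) (g x) => a b [c e]].
by rewrite (_ : (fun x => _) = (fun x => complex.Im (f x) + complex.Im (g x)));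
  [exact: measurable_funD|apply/funext => x; case: (f x) (g x) => a b [c e]].
Qed.

Lemma cmeasurableM d (T : measurableType d) (D : set T) f g :
  cmeasurable D f -> cmeasurable D g -> cmeasurable D (fun x => f x * g x).
Proof.
move=> [f1 f2] [g1 g2]; split.
  rewrite (_ : (fun x => _) = (fun x => complex.Re (f x) * complex.Re (g x) -
      complex.Im (f x) * complex.Im (g x))).
    by apply: measurable_funB; exact: measurable_funM.
  by apply/funext => x; case: (f x) (g x) => a b [c e].
rewrite (_ : (fun x => _) = (fun x => complex.Re (f x) * complex.Im (g x) +
    complex.Im (f x) * complex.Re (g x))).
  by apply: measurable_funD; exact: measurable_funM.
by apply/funext => x; case: (f x) (g x) => a b [c e].
Qed.

Lemma cmeasurableN d (T : measurableType d) (D : set T) f :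
  cmeasurable D f -> cmeasurable D (fun x => - f x).
Proof.
move=> hf; rewrite (_ : (fun x => _) = (fun x => -1 * f x)).
  by apply: cmeasurableM => //; exact: cmeasurable_cst.
by apply/funext => x; rewrite mulN1r.
Qed.

Lemma cmeasurableJ d (T : measurableType d) (D : set T) f :
  cmeasurable D f -> cmeasurable D (fun x => (f x)^*%R).
Proof.
move=> [f1 f2]; split.
  by rewrite (_ : (fun x => _) = (fun x => complex.Re (f x)))//;
    apply/funext => x; case: (f x).
rewrite (_ : (fun x => _) = (fun x => - complex.Im (f x))); first exact: measurable_funN.
by apply/funext => x; case: (f x).
Qed.

Lemma cmeasurable_horner d (T : measurableType d) (D : set T) (q : {poly R[i]}) f :
  cmeasurable D f -> cmeasurable D (fun x => q.[f x]).
Proof.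
move=> hf; elim/poly_ind: q => [|q c IH].
  by under eq_fun do rewrite horner0; exact: cmeasurable_cst.
under eq_fun do rewrite !hornerE.
by apply: cmeasurableD; [exact: cmeasurableM|exact: cmeasurable_cst].
Qed.

Lemma measurable_powR_fun d (T : measurableType d) (D : set T) (f : T -> R) (p : R) :
  measurable_fun D f -> measurable_fun D (fun x => f x `^ p).
Proof.
by move=> mf; apply: (@measurableT_comp _ _ _ _ _ _ (fun y => y `^ p)) => //;
  exact: measurable_powR.
Qed.

Lemma cmeasurable_cmod d (T : measurableType d) (D : set T) f :
  cmeasurable D f -> measurable_fun D (fun x => cmod (f x)).
Proof.
move=> [f1 f2].
rewrite (_ : (fun x => _) =
  (fun x => (complex.Re (f x) ^+ 2 + complex.Im (f x) ^+ 2) `^ 2^-1)).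
  by apply: measurable_powR_fun; apply: measurable_funD; exact: measurable_funX.
by apply/funext => x; rewrite powR12_sqrt ?cmodE// addr_ge0 ?sqr_ge0.
Qed.

Lemma measurable_fun_prods d (T : measurableType d) (D : set T) (I : Type)
    (s : seq I) (f : I -> T -> R) :
  (forall i, measurable_fun D (f i)) -> measurable_fun D (fun x => \prod_(i <- s) f i x).
Proof.
move=> mf; elim: s => [|i s IH].
  by under eq_fun do rewrite big_nil; exact: measurable_cst.
by under eq_fun do rewrite big_cons; exact: measurable_funM.
Qed.

Lemma cmeasurable_cplx (D : set (measurableTypeR R * measurableTypeR R)) :
  cmeasurable D (@cplx R).
Proof.
by split; [exact: measurable_funTS measurable_fst|exact: measurable_funTS measurable_snd].
Qed.

Lemma measurable_loglin d (T : measurableType d) (D : set T) K s (f : T -> R[i]) :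
  cmeasurable D f -> measurable_fun D (fun x => loglin K s (f x)).
Proof.
move=> hf; apply: measurable_funM; first exact: measurable_cst.
apply: measurable_fun_prods => i; apply: measurable_powR_fun; apply: cmeasurable_cmod.
apply: cmeasurableD; first exact: cmeasurable_cst.
by apply: cmeasurableN; apply: cmeasurableM => //; exact: cmeasurable_cst.
Qed.

Lemma measurable_loglin_geo d (T : measurableType d) (D : set T) K s n (f : T -> R[i]) :
  cmeasurable D f -> measurable_fun D (fun x => loglin_geo K s (f x) n).
Proof.
move=> hf; apply: measurable_funM; first exact: measurable_cst.
apply: measurable_fun_prods => i; apply: measurable_powR_fun; apply: cmeasurable_cmod.
apply: cmeasurableD; first exact: cmeasurable_cst.
apply: cmeasurableN.
rewrite (_ : (fun x => _) = (fun x => ('X^n : {poly R[i]}).[i.1.2 * f x])).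
  by apply: cmeasurable_horner; apply: cmeasurableM => //; exact: cmeasurable_cst.
by apply/funext => x; rewrite hornerXn.
Qed.

Lemma cmeasurable_cplx_lebesgue (D : set (lebesgue_plane R)) : measurable D ->
  cmeasurable D (@cplx R).
Proof.
move=> mD; split; move=> _ B mB; apply: measurableI => //; apply: borel_lebesgue.
  by rewrite -[X in measurable X]setTI; exact: (@measurable_fst _ _ borelR borelR).
by rewrite -[X in measurable X]setTI; exact: (@measurable_snd _ _ borelR borelR).
Qed.

End ComplexMeasurability.

(** * The sub-mean value property *)

Section SubMeanValue.
Variable R : realType.
Local Notation borelR := (measurableTypeR R).
Local Notation plane := (borelR * borelR)%type.

Definition eball (z : R[i]) (r : R) : set plane := [set u | cmod (cplx u - z) < r].

Lemma measurable_cmod_lt (D : set plane) (f : plane -> R[i]) (r : R) : measurable D ->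
  cmeasurable D f -> measurable (D `&` [set u | cmod (f u) < r]).
Proof.
move=> mD /cmeasurable_cmod mf.
rewrite (_ : [set u | _] = (fun u => cmod (f u)) @^-1` `]-oo, r[%classic).
  by apply: mf => //; exact: measurable_itv.
by apply/seteqP; split => u /=; rewrite in_itv.
Qed.

Lemma measurable_eball z r : measurable (eball z r).
Proof.
rewrite -[eball z r]setTI; apply: measurable_cmod_lt => //.
by apply: cmeasurableD; [exact: cmeasurable_cplx|exact: cmeasurable_cst].
Qed.

(** The sections of a circle have at most two points. *)
Lemma borel_area_circle (t : R) :
  borel_area R [set u | cmod (cplx u) = t] = 0%E.
Proof.
rewrite borel_area_xsection.
under eq_integral => x _.
  have -> : lebesgue_measure (xsection [set u : plane | cmod (cplx u) = t] x) = 0%E.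
    set S := xsection _ _; pose c := Num.sqrt (t ^+ 2 - x ^+ 2).
    apply/countable_lebesgue_measure0; apply: (@sub_countable _ _ S [set c; - c]); last first.
      by apply/finite_set_countable; exact: finite_set2.
    apply: subset_card_le => y; rewrite /S /xsection/= inE/= => h.
    have := sqr_cmod (x +i* y); rewrite cmodE/= h => e.
    have : c ^+ 2 = y ^+ 2 by rewrite /c e sqr_sqrtr addrC addKr// sqr_ge0.
    by move/eqP; rewrite eq_sym eqf_sqr => /orP[]/eqP ->; [left|right].
  over.
by rewrite integral0.
Qed.

Lemma borel_area_eball_ge r : 0 < r -> ((r ^+ 2)%:E <= borel_area R (eball 0%R r))%E.
Proof.
move=> r0; pose I : set borelR := `]- (r / 2), r / 2[%classic.
have mI : measurable I by exact: measurable_itv.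
have -> : ((r ^+ 2)%:E = borel_area R (I `*` I))%E.
  rewrite borel_area_rect// /I lebesgue_measure_itv/= lte_fin ifT; last by lra.
  by rewrite -EFinB -EFinM; congr _%:E; field.
apply: le_measure; rewrite ?inE//; first exact: measurableX.
  exact: measurable_eball.
move=> [x y] [/=]; rewrite /I/= !in_itv/= => /andP[x1 x2] /andP[y1 y2].
rewrite /eball /mkset subr0 -(@ltr_pXn2r _ 2)// ?nnegrE ?cmod_ge0 ?(ltW r0)//.
by rewrite sqr_cmod/=; nra.
Qed.

Lemma loglin_shift (K : R) s (z h : R[i]) :
  loglin K s (z + h) = loglin K [seq (i.1.1 - i.1.2 * z, i.1.2, i.2) | i <- s] h.
Proof.
rewrite /loglin big_map; congr (_ * _); apply: eq_bigr => -[[a b] e] _ /=.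
by congr (cmod _ `^ _); ring.
Qed.

Lemma loglin_powR (K : R) s z p : 0 <= K ->
  loglin K s z `^ p = loglin (K `^ p) [seq (i.1, i.2 * p) | i <- s] z.
Proof.
move=> K0; rewrite /loglin big_map powRM ?prodr_ge0//; last first.
  by move=> i _; exact: powR_ge0.
congr (_ * _); rewrite -prod_powR; last by move=> i; exact: powR_ge0.
by apply: eq_bigr => -[[a b] e] _ /=; rewrite -powRrM.
Qed.

(** Exponents may be negative only for factors without zeros in the disc of
    radius [r]. *)
Definition loglin_admissible (s : seq (R[i] * R[i] * R)) (r : R) : Prop :=
  forall i, i \in s -> (i.1.1 != 0) || (i.1.2 != 0) /\
    (0 <= i.2 \/ forall h, cmod h < r -> cmod (i.1.2 * h) < cmod i.1.1).

Lemma integral_rotate_loglin (K : R) s r (w : R[i]) : 0 <= K -> cmod w = 1 -> w != -1 ->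
  (\int[borel_area R]_(u in eball 0%R r) (loglin K s (cplx u * w))%:E =
   \int[borel_area R]_(u in eball 0%R r) (loglin K s (cplx u))%:E)%E.
Proof.
move=> K0 w1 wN1; have [f pf fE] := area_preserving_rotation w1 wN1.
rewrite -[RHS](integral_area_preserving pf).
- have -> : f @^-1` eball 0%R r = eball 0%R r.
    by apply/seteqP; split => u; rewrite /preimage /eball /mkset !subr0 fE cmodM w1 mul1r.
  by apply: eq_integral => u _; rewrite fE mulrC.
- exact: measurable_eball.
- by apply/measurable_EFinP; apply: measurable_loglin; exact: cmeasurable_cplx.
- by move=> u _; rewrite lee_fin loglin_ge0.
Qed.

Lemma loglin_max_ge (K : R) s r z : 0 <= K -> loglin_admissible s r -> cmod z < r ->
  loglin K s 0 <= loglin_max K s z.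
Proof.
move=> K0 sr zr; rewrite ler_wpM2l//.
elim: s sr => [|i s IH] sr; first by rewrite !big_nil.
rewrite !big_cons ler_pM ?powR_ge0 ?prodr_ge0//.
- by move=> j _; exact: powR_ge0.
- rewrite mulr0 subr0; have [_ [e0|/(_ z zr) h]] := sr i (mem_head _ _).
    by rewrite ge0_ler_powR ?nnegrE ?cmod_ge0 ?le_max ?cmod_ge0 ?lexx.
  by rewrite max_l// ltW.
- by apply: IH => j js; apply: sr; rewrite inE js orbT.
Qed.

(** The points at which the two terms of some factor have equal modulus lie on
    finitely many circles. *)
Lemma borel_area_bad (s : seq (R[i] * R[i] * R)) :
  (forall i, i \in s -> (i.1.1 != 0) || (i.1.2 != 0)) ->
  let bad := [set u : plane | exists2 i, i \in s & cmod i.1.1 = cmod (i.1.2 * cplx u)] in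
  measurable bad /\ borel_area R bad = 0%E.
Proof.
elim: s => [|i s IH] hs /=.
  by rewrite (_ : [set u | _] = set0) ?measure0//; apply/seteqP; split => // u [].
have [m2 b2] := IH (fun j js => hs j (mem_behead (s := i :: s) js)).
set S := [set u | _] in m2 b2 *; pose S1 := [set u : plane | cmod i.1.1 = cmod (i.1.2 * cplx u)].
have -> : [set u : plane | exists2 j, j \in i :: s & cmod j.1.1 = cmod (j.1.2 * cplx u)] = S1 `|` S.
  apply/seteqP; split => u.
    by move=> [j]; rewrite inE => /orP[/eqP -> |js] h; [left|right; exists j].
  by move=> [h|[j js h]]; [exists i => //; rewrite mem_head|exists j => //; rewrite inE js orbT].
have [m1 b1] : measurable S1 /\ borel_area R S1 = 0%E.
  have hi := hs i (mem_head _ _); have [b0|b0] := eqVneq i.1.2 0.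
    rewrite b0 eqxx orbF in hi; rewrite (_ : S1 = set0) ?measure0//.
    apply/seteqP; split => // u; rewrite /S1 /mkset b0 mul0r cmod0 => h.
    by move: hi; rewrite -cmod_eq0 h eqxx.
  rewrite (_ : S1 = [set u | cmod (cplx u) = cmod i.1.1 / cmod i.1.2]).
    split; last exact: borel_area_circle.
    have mf : measurable_fun setT (fun u : plane => cmod (cplx u)).
      by apply: cmeasurable_cmod; exact: cmeasurable_cplx.
    rewrite (_ : [set u | _] = setT `&` (fun u : plane => cmod (cplx u)) @^-1` [set cmod i.1.1 / cmod i.1.2]).
      by apply: mf => //; exact: measurable_set1.
    by rewrite setTI.
  apply/seteqP; split => u; rewrite /S1 /mkset cmodM => h.
    by rewrite h mulrC mulKf// cmod_eq0.
  by rewrite h mulrC divfK// cmod_eq0.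
split; first exact: measurableU.
by rewrite measureU0.
Qed.

Lemma measurable_loglin_max (D : set plane) (K : R) s : measurable D ->
  measurable_fun D (fun u => loglin_max K s (cplx u)).
Proof.
move=> mD; apply: measurable_funM; first exact: measurable_cst.
apply: measurable_fun_prods => i; apply: measurable_powR_fun.
apply: measurable_maxr; first exact: measurable_cst.
apply: cmeasurable_cmod; apply: cmeasurableM; first exact: cmeasurable_cst.
exact: cmeasurable_cplx.
Qed.

(** Rotations preserve area, so that the integral is unchanged when the
    integrand is replaced by its average over rotations by roots of unity; this
    dominates the geometric mean, which tends almost everywhere to [loglin_max],
    and that is at least the value at the centre. The odd orders avoid the half
    turn. *)
Lemma loglin_submean0 (K : R) s r : 0 <= K -> 0 < r -> loglin_admissible s r ->
  ((loglin K s 0)%:E * borel_area R (eball 0%R r) <=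
   \int[borel_area R]_(u in eball 0%R r) (loglin K s (cplx u))%:E)%E.
Proof.
move=> K0 r0 sr; set I := (X in (_ <= X)%E).
have mB := measurable_eball 0%R r.
have mcp (D : set plane) := @cmeasurable_cplx R D.
pose g k (u : plane) := (loglin_geo K s (cplx u) k.*2.+1)%:E.
have g0 k u : (0 <= g k u)%E.
  by rewrite lee_fin mulr_ge0// prodr_ge0// => i _; exact: powR_ge0.
have mg k : measurable_fun (eball 0%R r) (g k).
  by apply/measurable_EFinP; apply: measurable_loglin_geo.
have gI k : (\int[borel_area R]_(u in eball 0%R r) g k u <= I)%E.
  have [w wn] := @primitive_root_exists R k.*2.+1 isT; set n := k.*2.+1 in wn *.
  have wi (i : nat) : cmod (w ^+ i) = 1 /\ w ^+ i != -1.
    split; first by rewrite cmodX (cmod_root_of_unity _ (prim_expr_order wn))// expr1n.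
    apply/eqP => /(congr1 (fun x => x ^+ n)); rewrite -exprM mulnC exprM.
    rewrite (prim_expr_order wn) expr1n -signr_odd /n/= odd_double/= expr1 => /esym/eqP.
    by rewrite eq_sym -addr_eq0 -mulr2n pnatr_eq0.
  apply: (@le_trans _ _ (\int[borel_area R]_(u in eball 0%R r)
      \sum_(i < n) (n%:R^-1 * loglin K s (cplx u * w ^+ i))%:E)%E).
    apply: ge0_le_integral => //.
    - apply: emeasurable_sum => i; apply/measurable_EFinP.
      apply: measurable_funM; first exact: measurable_cst.
      by apply: measurable_loglin; apply: cmeasurableM => //; exact: cmeasurable_cst.
    - move=> u _; rewrite sumEFin lee_fin -mulr_sumr.
      exact: loglin_geo_le_mean.
  rewrite ge0_integral_sum//; last 2 first.
  - move=> i; apply/measurable_EFinP; apply: measurable_funM; first exact: measurable_cst.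
    by apply: measurable_loglin; apply: cmeasurableM => //; exact: cmeasurable_cst.
  - by move=> i u _; rewrite lee_fin mulr_ge0// loglin_ge0.
  under eq_bigr => i _.
    under eq_integral do rewrite EFinM.
    rewrite ge0_integralZl//; last 2 first.
    - by apply/measurable_EFinP; apply: measurable_loglin; apply: cmeasurableM => //; exact: cmeasurable_cst.
    - by move=> u _; rewrite lee_fin loglin_ge0.
    rewrite integral_rotate_loglin// ?(wi i).1 ?(wi i).2//.
    over.
  rewrite [X in (X <= _)%E]/= -ge0_sume_distrl; last by move=> i _; rewrite lee_fin.
  rewrite sumEFin (_ : \sum_(i < n) _ = 1) ?mul1e//.
  by rewrite sumr_const card_ord -[LHS]mulr_natr mulVf// pnatr_eq0.
have [mbad bad0] := borel_area_bad (fun i is_ => (sr i is_).1).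
set bad := [set u | _] in mbad bad0.
pose G := eball 0%R r `\` bad.
have mG : measurable G by exact: measurableD.
have -> : borel_area R (eball 0%R r) = borel_area R G.
  rewrite (measureDI (borel_area R) mB mbad) [X in (_ + X)%E](_ : _ = 0%E) ?adde0//.
  by apply: (subset_measure0 _ mbad) => //; exact: measurableI.
have -> : ((loglin K s 0)%:E * borel_area R G =
    \int[borel_area R]_(u in G) (cst (loglin K s 0)%:E) u)%E.
  by rewrite (integral_cst (borel_area R) mG).
apply: (@le_trans _ _ (\int[borel_area R]_(u in G) limn_einf (g^~ u))%E).
  have -> : (\int[borel_area R]_(u in G) limn_einf (g^~ u) =
      \int[borel_area R]_(u in G) (loglin_max K s (cplx u))%:E)%E.
    apply: eq_integral => u; rewrite inE => -[_ ubad].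
    have cu : g k u @[k --> \oo] --> (loglin_max K s (cplx u))%:E.
      apply: cvg_EFin; first by apply: nearW.
      apply: loglin_geo_cvg => i is_; apply/eqP => h; apply: ubad; exists i.
        exact: is_.
      exact: h.
    rewrite is_cvg_limn_einfE; first exact: cvg_lim cu.
    by apply/cvg_ex; eexists; exact: cu.
  apply: ge0_le_integral => //.
  - by move=> u _; rewrite lee_fin loglin_ge0.
  - by apply/measurable_EFinP; exact: measurable_loglin_max.
  - move=> u [uB _]; rewrite lee_fin; apply: loglin_max_ge sr _ => //.
    by move: uB; rewrite /eball /mkset subr0.
apply: le_trans (fatou _ mG _ _) _.
- by move=> k; apply: measurable_funS (mg k) => //; exact: subDsetl.
- by move=> k u _; exact: g0.
have gGI k : (\int[borel_area R]_(u in G) g k u <= I)%E.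
  apply: le_trans (gI k); apply: ge0_subset_integral => //; exact: subDsetl.
rewrite limn_einf_lim; apply: lime_le; first exact: is_cvg_einfs.
apply: nearW => n; apply: le_trans (gGI n); apply: ereal_inf_lbound.
by exists n => /=.
Qed.

(** By translation from the disc centred at the origin. This is the only source
    of pointwise bounds by integrals in what follows, for polynomials as well as
    for the moduli of the factors, whose exponents are not integers. *)
Lemma loglin_submean (K : R) s z r : 0 <= K -> 0 < r ->
  loglin_admissible [seq (i.1.1 - i.1.2 * z, i.1.2, i.2) | i <- s] r ->
  ((loglin K s z * (r ^+ 2 / pi))%:E <=
   \int[dA R]_(u in (eball z r : set (lebesgue_plane R))) (loglin K s (cplx u))%:E)%E.
Proof.
move=> K0 r0 adm; have mb := measurable_eball z r.
have ml : measurable_fun (eball z r) (fun u => (loglin K s (cplx u))%:E).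
  by apply/measurable_EFinP; apply: measurable_loglin; exact: cmeasurable_cplx.
have l0 (u : plane) : eball z r u -> (0 <= (loglin K s (cplx u))%:E)%E.
  by move=> _; rewrite lee_fin loglin_ge0.
rewrite (integral_dA_borel mb ml l0).
rewrite mulrA mulrC EFinM; apply: lee_wpmul2l; first by rewrite lee_fin invr_ge0 pi_ge0.
rewrite -(integral_area_preserving (area_preserving_translation (complex.Re z) (complex.Im z)) mb ml l0).
have fE (u : plane) : cplx (u.1 + complex.Re z, u.2 + complex.Im z) = z + cplx u.
  by rewrite /cplx/=; case: z {adm mb ml l0} => a b; simpc; rewrite addrC [X in _ +i* X]addrC.
set f := (f in f @^-1` _); have -> : f @^-1` eball z r = eball 0%R r.
  by apply/seteqP; split => u; rewrite /f /preimage /eball /mkset fE subr0 addrC addKr.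
under eq_integral do rewrite fE loglin_shift.
have := loglin_submean0 K0 r0 adm; rewrite -loglin_shift addr0; apply: le_trans.
by rewrite EFinM lee_wpmul2l ?lee_fin ?loglin_ge0// borel_area_eball_ge.
Qed.

End SubMeanValue.

(** * Hyperbolic geometry of the disc and growth of invariant weights *)

Section Hyperbolic.
Variable R : realType.
Implicit Types (a b u v z : R[i]) (r k : R).

Lemma conjM a b : (a * b)^*%R = a^*%R * b^*%R.
Proof. exact: rmorphM. Qed.

Lemma conjB a b : (a - b)^*%R = a^*%R - b^*%R.
Proof. exact: rmorphB. Qed.

Lemma conj1 : (1 : R[i])^*%R = 1.
Proof. exact: rmorph1. Qed.

Lemma conjV a : (a^-1)^*%R = (a^*%R)^-1.
Proof. exact: fmorphV. Qed.

Lemma conj_real r : (r%:C)^*%R = r%:C.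
Proof. exact: conjc_real. Qed.

Lemma conj_eq0 a : (a^*%R == 0) = (a == 0).
Proof. exact: conjc_eq0. Qed.

Definition conjE := (conjM, conjB, conj1, @conjCK R[i], conjV, conj_real).

(** One minus the squared pseudohyperbolic distance, by [hk_mobius]: small
    values mean that the two points are far apart. *)
Definition hk a u : R :=
  (1 - cmod a ^+ 2) * (1 - cmod u ^+ 2) / cmod (1 - a^* * u) ^+ 2.

Lemma hkC a u : hk a u = hk u a.
Proof.
rewrite /hk [X in X / _]mulrC; congr (_ / (_ ^+ 2)).
by rewrite -[RHS]cmodJ !conjE [u * _]mulrC.
Qed.

Lemma disc_sqr a : disc a -> 0 < 1 - cmod a ^+ 2.
Proof.
by rewrite /disc/= => a1; rewrite subr_gt0 expr_lt1// cmod_ge0.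
Qed.

Lemma disc_cross a u : disc a -> disc u -> 0 < cmod (1 - a^* * u).
Proof. by move=> da du; apply: disc_cross_gt0 => //; exact: ltW. Qed.

Lemma hk_mobius a u : disc a -> disc u -> hk a u = 1 - cmod (mobius a u) ^+ 2.
Proof.
move=> da du; have c0 := disc_cross da du.
rewrite /hk -cmod_cross /mobius cmodM cmodV expr_div_n mulrBl divff//.
by rewrite gt_eqF// exprn_gt0.
Qed.

Lemma hk_gt0 a u : disc a -> disc u -> 0 < hk a u.
Proof.
by move=> da du; rewrite divr_gt0 ?mulr_gt0 ?disc_sqr ?exprn_gt0 ?disc_cross.
Qed.

Lemma disc_mobius a u : disc a -> disc u -> disc (mobius a u).
Proof.
move=> da du; have := hk_gt0 da du; rewrite hk_mobius// subr_gt0 expr_lt1 ?cmod_ge0//.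
Qed.

Lemma cross_ge a u : disc a -> disc u -> 1 - cmod u <= cmod (1 - a^* * u).
Proof.
rewrite /disc/= => da du; have := cmod_dist 1 (a^* * u).
rewrite cmod1 cmodM cmodJ => /(le_trans (ler_norm _)); apply: le_trans.
by rewrite lerD2l lerN2 ler_piMl ?cmod_ge0// ltW.
Qed.

(** Two points at bounded hyperbolic distance have comparable distances to the
    circle, and their Euclidean distance is of that order at most. *)
Lemma hk_boundary a u k : disc a -> disc u -> 0 < k -> k <= hk a u ->
  k * (1 - cmod u) <= 4 * (1 - cmod a) /\ k * cmod (a - u) <= 4 * (1 - cmod a).
Proof.
move=> da du k0; have c0 := disc_cross da du; have cg := cross_ge da du.
have := cmod_cross a u; have := disc_sqr da; have := disc_sqr du.
rewrite /hk ler_pdivlMr ?exprn_gt0//; move: da du; rewrite /disc/= => da du.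
have a0 := cmod_ge0 a; have u0 := cmod_ge0 u; have e0 := cmod_ge0 (a - u).
set A := cmod a in da a0 cg *; set U := cmod u in du u0 cg *; set E := cmod (a - u) in e0 *.
set c := cmod _ in c0 cg * => U2 A2 cE h.
have h1 : k * c ^+ 2 <= 4 * ((1 - A) * (1 - U)).
  apply: le_trans h _.
  rewrite (_ : (1 - A ^+ 2) * _ = (1 + A) * (1 + U) * ((1 - A) * (1 - U))); last by ring.
  by rewrite ler_wpM2r ?mulr_ge0 ?subr_ge0 ?(ltW da) ?(ltW du)//; nra.
have h2 : k * (1 - U) <= 4 * (1 - A).
  have h3 : k * (1 - U) ^+ 2 <= k * c ^+ 2 by rewrite ler_pM2l// lerXn2r ?nnegrE ?subr_ge0// ltW.
  have := le_trans h3 h1; by rewrite expr2 !mulrA ler_pM2r ?subr_gt0.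
split => //; rewrite -(@ler_pXn2r _ 2)// ?nnegrE ?mulr_ge0 ?(ltW k0)// ?subr_ge0 ?(ltW da)//.
have h4 : E ^+ 2 <= c ^+ 2 by rewrite -subr_ge0 cE ltW// mulr_gt0.
rewrite exprMn; apply: (@le_trans _ _ (k * (k * c ^+ 2))).
  by rewrite mulrA -expr2 ler_pM2l ?exprn_gt0.
apply: (@le_trans _ _ (k * (4 * ((1 - A) * (1 - U))))); first by rewrite ler_pM2l.
rewrite (_ : k * _ = (4 * (1 - A)) * (k * (1 - U))); last by ring.
by rewrite [leRHS]expr2 ler_pM2l// mulr_gt0// subr_gt0.
Qed.

Lemma ball_sub_disc z u : disc z -> cmod (u - z) < (1 - cmod z) / 2 ->
  disc u /\ (1 - cmod z) / 2 <= 1 - cmod u.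
Proof.
rewrite /disc/= => dz h; have := cmodD (u - z) z; rewrite subrK => h2.
by split; lra.
Qed.

(** A Euclidean disc about [z] whose radius is half the distance to the circle
    is hyperbolically bounded, so that [hk a] varies by a bounded factor on it. *)
Lemma hk_ball a z u : disc a -> disc z -> cmod (u - z) < (1 - cmod z) / 2 ->
  hk a z / 9 <= hk a u.
Proof.
move=> da dz h; have [du hu] := ball_sub_disc dz h.
have cz := disc_cross da dz; have cu := disc_cross da du.
have cg := cross_ge da dz.
have cuz : cmod (1 - a^* * u) <= 3 / 2 * cmod (1 - a^* * z).
  rewrite (_ : 1 - a^* * u = (1 - a^* * z) + a^* * (z - u)); last by ring.
  rewrite (le_trans (cmodD _ _))// cmodM cmodJ [cmod (z - u)]cmodB.
  have : cmod a * cmod (u - z) <= cmod (u - z) by rewrite ler_piMl ?cmod_ge0 ?ltW.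
  lra.
rewrite /hk ler_pdivlMr ?exprn_gt0//.
apply: (@le_trans _ _ ((1 - cmod a ^+ 2) * ((1 - cmod z ^+ 2) / 4))).
  have : cmod (1 - a^* * u) ^+ 2 <= (3 / 2 * cmod (1 - a^* * z)) ^+ 2.
    by rewrite lerXn2r ?nnegrE ?mulr_ge0 ?cmod_ge0.
  set X := cmod (1 - a^* * u) ^+ 2; set Y := cmod (1 - a^* * z) in cz *; rewrite exprMn => hX.
  rewrite (_ : _ * X = (1 - cmod a ^+ 2) * (1 - cmod z ^+ 2) / (9 * Y ^+ 2) * X); last first.
    by field; rewrite gt_eqF.
  apply: (@le_trans _ _ ((1 - cmod a ^+ 2) * (1 - cmod z ^+ 2) / (9 * Y ^+ 2) * ((3 / 2) ^+ 2 * Y ^+ 2))).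
    by apply: ler_wpM2l => //; rewrite divr_ge0 ?mulr_ge0 ?exprn_ge0 ?(ltW (disc_sqr da)) ?(ltW (disc_sqr dz)) ?(ltW cz).
  by rewrite le_eqVlt; apply/orP; left; apply/eqP; field; rewrite gt_eqF.
rewrite ler_pM2l ?disc_sqr//.
move: dz du hu; rewrite /disc/= => dz du hu; have u0 := cmod_ge0 u; have z0 := cmod_ge0 z.
by nra.
Qed.

Lemma mobiusK a u : disc a -> disc u -> mobius a (mobius a u) = u.
Proof.
move=> da du; have c0 : 1 - a^* * u != 0 by rewrite -cmod_gt0 disc_cross.
have a0 : 1 - a^* * a != 0 by rewrite -cmod_gt0 disc_cross.
rewrite /mobius.
have e1 : a - (a - u) / (1 - a^* * u) = u * (1 - a^* * a) / (1 - a^* * u) by field.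
have e2 : 1 - a^* * ((a - u) / (1 - a^* * u)) = (1 - a^* * a) / (1 - a^* * u) by field.
by rewrite e1 e2; field; rewrite a0 c0.
Qed.

Lemma mobius_invariant a x y : disc a -> disc x -> disc y ->
  cmod (mobius (mobius a x) (mobius a y)) = cmod (mobius x y).
Proof.
move=> da dx dy.
have x0 : 1 - a^* * x != 0 by rewrite -cmod_gt0 disc_cross.
have y0 : 1 - a^* * y != 0 by rewrite -cmod_gt0 disc_cross.
have a0 : 1 - a^* * a != 0 by rewrite -cmod_gt0 disc_cross.
have xy0 : 1 - x^* * y != 0 by rewrite -cmod_gt0 disc_cross.
have x0' : 1 - a * x^* != 0 by rewrite -conj_eq0 !conjE.
have e1 : mobius a x - mobius a y = (1 - a^* * a) * (y - x) / ((1 - a^* * x) * (1 - a^* * y)).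
  by rewrite /mobius; field; rewrite x0 y0.
have e2 : 1 - (mobius a x)^* * mobius a y =
    (1 - a^* * a) * (1 - x^* * y) / ((1 - a * x^*) * (1 - a^* * y)).
  rewrite /mobius !conjE.
  by field; rewrite x0' y0.
have -> : mobius (mobius a x) (mobius a y) =
  (mobius a x - mobius a y) / (1 - (mobius a x)^* * mobius a y) by [].
rewrite e1 e2 /mobius !(cmodM, cmodV).
have ex : cmod (1 - a * x^*) = cmod (1 - a^* * x).
  by rewrite -cmodJ !conjE.
rewrite ex [cmod (y - x)]cmodB.
have := x0; have := y0; have := a0; have := xy0; rewrite -!cmod_gt0.
set A := cmod _ => A0; set B := cmod _ => B0; set C := cmod _ => C0; set D := cmod _ => D0.
by field; rewrite !gt_eqF.
Qed.

Lemma mobius_eq0 a u : disc a -> disc u -> cmod (mobius a u) = 0 -> a = u.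
Proof.
move=> da du /eqP; rewrite cmod_eq0 mulf_eq0 invr_eq0 subr_eq0.
by move=> /orP[/eqP//|]; rewrite -cmod_eq0 gt_eqF// disc_cross.
Qed.

Section Growth.
Variables (w : R[i] -> R) (r C : R).
Hypotheses (r0 : 0 < r) (C1 : 1 <= C).
Hypothesis wC : forall a z, disc a -> pseudohyperbolic_disc a r z ->
  C^-1 * w a <= w z <= C * w a.

(** Walking from [a] to [u] along the hyperbolic segment in steps of
    pseudohyperbolic length less than [r], the distance to the circle, seen from
    [a], shrinks by a fixed factor at each step. *)
Lemma weight_chain (n : nat) a u : disc a -> disc u ->
  cmod (mobius a u) <= 1 - (1 + r / 2) ^- n -> w a <= C ^+ n * w u.
Proof.
have l1 : 1 < 1 + r / 2 by rewrite ltrDl divr_gt0.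
have l0 : 0 < 1 + r / 2 by rewrite (lt_trans ltr01).
elim: n u => [|n IH] u da du.
  rewrite expr0 invr1 subrr => h; rewrite expr0 mul1r.
  by rewrite (@mobius_eq0 a u)//; apply/le_anti; rewrite h cmod_ge0.
move=> h; set z := mobius a u; have dz : disc z by exact: disc_mobius.
set rho := cmod z; have rho1 : rho < 1 by [].
have rho0 : 0 <= rho by exact: cmod_ge0.
pose rho' := Num.max 0 (1 - (1 + r / 2) * (1 - rho)).
have rho'0 : 0 <= rho' by rewrite le_max lexx.
have rr : rho' <= rho by rewrite ge_max rho0/=; nra.
have rho'1 : rho' < 1 by exact: le_lt_trans rr rho1.
pose t := rho' / rho.
have trho : t * rho = rho'.
  have [e|e] := eqVneq rho 0; last by rewrite /t divfK.
  by rewrite e mulr0; apply/le_anti; rewrite rho'0 -e rr.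
have t0 : 0 <= t by rewrite divr_ge0.
pose z' := t%:C * z.
have z'E : cmod z' = rho' by rewrite cmodM cmod_real ger0_norm.
have dz' : disc z' by rewrite /disc/= z'E.
pose b := mobius a z'; have db : disc b by exact: disc_mobius.
have ab : cmod (mobius a b) <= 1 - (1 + r / 2) ^- n.
  rewrite mobiusK// z'E ge_max; apply/andP; split.
    by rewrite subr_ge0 invf_le1 ?exprn_gt0// exprn_ege1// ltW.
  rewrite lerD2l lerN2; move: h; rewrite -/z -/rho exprS invfM => h.
  have h2 : (1 + r / 2)^-1 * (1 + r / 2) ^- n <= 1 - rho by lra.
  by rewrite -ler_pdivrMl.
have bu : cmod (mobius b u) < r.
  rewrite -(mobiusK da du) -/z /b mobius_invariant//.
  have e1 : cmod (z' - z) = rho - rho'.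
    rewrite cmodB /z' -[X in X - _]mul1r -mulrBl cmodM -(rmorph1 (real_complex R)) -rmorphB cmod_real.
    rewrite ger0_norm ?mulrBl ?mul1r ?trho// subr_ge0.
    have [e|e] := eqVneq rho 0; first by rewrite /t e invr0 mulr0.
    by rewrite /t ler_pdivrMr ?mul1r// lt_def e.
  have e2 : cmod (1 - z'^* * z) = 1 - rho * rho'.
    have -> : 1 - z'^* * z = (1 - rho * rho')%:C.
      rewrite /z' conjM conj_real -mulrA rmorphB rmorph1; congr (_ - _).
      have -> : z^* * z = (rho ^+ 2)%:C.
        by rewrite /rho sqr_cmod; case: (z) => x y; simpc; congr (_ +i* _); ring.
      by rewrite -rmorphM; congr (_%:C); rewrite -trho; ring.
    rewrite cmod_real ger0_norm// subr_ge0 mulr_ile1// ltW//.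
  rewrite /mobius cmodM cmodV e1 e2.
  have hpos : 0 < 1 - rho * rho' by nra.
  rewrite ltr_pdivrMr//.
  have : 1 - (1 + r / 2) * (1 - rho) <= rho' by rewrite le_max lexx orbT.
  nra.
have /andP[h1 _] := wC db (conj du bu).
have h2 := IH b da db ab.
rewrite exprSr -mulrA (le_trans h2)// ler_pM2l ?exprn_gt0 ?(lt_le_trans ltr01)//.
by move: h1; rewrite ler_pdivrMl ?(lt_le_trans ltr01).
Qed.

End Growth.

(** The condition [2 ^- n <= hk a u] allows to join [a] to [u] by a chain whose
    length is proportional to [n], and [weight_chain] bounds the cost of each
    step. *)
Lemma invariant_growth (w : R[i] -> R) : invariant_weight w ->
  exists2 D, 1 <= D & forall (n : nat) a u, disc a -> disc u ->
    2 ^- n <= hk a u -> w a <= D ^+ n.+1 * w u.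
Proof.
move=> [[w0 _] [r [r0 r1 [C C1 wC]]]].
have l1 : 1 < 1 + r / 2 by rewrite ltrDl divr_gt0.
have l0 : 0 < 1 + r / 2 by rewrite (lt_trans ltr01).
have [|||l hl] := @cvg_pow_lt R (1 + r / 2)^-1 2^-1.
- by rewrite invr_ge0 ltW.
- by rewrite invf_lt1.
- by rewrite invr_gt0.
exists (C ^+ l); first by rewrite exprn_ege1.
move=> n a u da du h; rewrite -exprM; apply: (weight_chain r0 C1 wC) => //.
have m1 : cmod (mobius a u) < 1 by exact: disc_mobius.
have m0 := cmod_ge0 (mobius a u).
rewrite hk_mobius// in h.
have h2 : (1 + r / 2) ^- (l * n.+1) <= 2 ^- n.+1.
  rewrite exprM -!exprVn lerXn2r ?nnegrE ?invr_ge0 ?exprn_ge0 ?(ltW l0)//.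
  by rewrite invr_ge0 ltW.
have h3 : 2 ^- n.+1 = 2 ^- n / 2 :> R by rewrite exprS invfM mulrC.
nra.
Qed.

End Hyperbolic.

(** * A double integral *)

Section Schur.
Local Open Scope ereal_scope.
Context d (T : measurableType d) (R : realType).
Variable mu : {sigma_finite_measure set T -> \bar R}.

Lemma integral_xsection_restrict (D : set T) (S : set (T * T)) (g : T -> R) :
  (forall x, S x -> D x.2) -> forall a,
  \int[mu]_(u in xsection S a) (g u)%:E = \int[mu]_u (\1_S (a, u) * (g \_ D) u)%:E.
Proof.
move=> SD a; rewrite integral_mkcond; apply: eq_integral => u _.
rewrite /patch indicE; have -> : (u \in xsection S a) = ((a, u) \in S).
  by apply/idP/idP; rewrite !inE /xsection/= inE.
case: ifPn => aS; rewrite ?mul0r// mul1r ifT//.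
by move: aS; rewrite !inE => /SD.
Qed.

Lemma measurable_integral_xsection (D : set T) (S : set (T * T)) (g : T -> R) :
  measurable D -> measurable S -> (forall x, S x -> D x.2) -> (forall u, (0 <= g u)%R) ->
  measurable_fun D g ->
  measurable_fun setT (fun a => \int[mu]_(u in xsection S a) (g u)%:E).
Proof.
move=> mD mS SD g0 mg.
pose g' := (g \_ D).
have mg' : measurable_fun setT g' by apply/(measurable_restrictT _ mD).
have g'0 u : (0 <= g' u)%R by rewrite /g' /patch; case: ifPn.
pose f' (x : T * T) := (\1_S x * g' x.2)%:E.
have mf' : measurable_fun setT f'.
  apply/measurable_EFinP; apply: measurable_funM; first exact: measurable_indic.
  exact: (measurableT_comp mg' measurable_snd).
have f'0 x : 0 <= f' x by rewrite lee_fin mulr_ge0.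
pose F' a := \int[mu]_u f' (a, u).
have mF' : measurable_fun setT F' by exact: (measurable_fun_fubini_tonelli_F (m2 := mu)).
have -> : (fun a => \int[mu]_(u in xsection S a) (g u)%:E) = F'.
  by apply/funext => a; rewrite (integral_xsection_restrict g SD).
exact: mF'.
Qed.

(** The value [w a] is first replaced by [K * w u], which is legitimate where
    [(a, u)] is in [S]; Tonelli's theorem then leaves the integral of [q] over a
    section of [S]. *)
Lemma schur_double_integral (D : set T) (S : set (T * T)) (w q g : T -> R) (K C : R) :
  measurable D -> measurable S -> (forall x, S x -> D x.1 /\ D x.2) ->
  (forall a, D a -> (0 <= w a)%R) -> (forall a, (0 <= q a)%R) -> (forall u, (0 <= g u)%R) ->
  measurable_fun D w -> measurable_fun setT q -> measurable_fun D g ->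
  (0 <= K)%R -> (0 <= C)%R ->
  (forall a u, S (a, u) -> (w a <= K * w u)%R) ->
  (forall u, D u -> \int[mu]_(a in ysection S u) (q a)%:E <= C%:E) ->
  \int[mu]_(a in D) ((w a * q a)%:E * \int[mu]_(u in xsection S a) (g u)%:E) <=
  (C * K)%:E * \int[mu]_(u in D) (g u * w u)%:E.
Proof.
move=> mD mS SD w0 q0 g0 mw mq mg K0 C0 wK qC.
pose G := ((fun u => g u * w u)%R \_ D).
have mG : measurable_fun setT G.
  by apply/(measurable_restrictT _ mD); exact: measurable_funM.
have G0 u : (0 <= G u)%R.
  by rewrite /G /patch; case: ifPn => //; rewrite inE => ud; rewrite mulr_ge0// w0.
pose f (x : T * T) := (\1_S x * (q x.1 * G x.2))%:E.
have f0 x : 0 <= f x by rewrite lee_fin mulr_ge0// mulr_ge0.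
have mf : measurable_fun setT f.
  apply/measurable_EFinP; apply: measurable_funM; first exact: measurable_indic.
  apply: measurable_funM; first exact: (measurableT_comp mq measurable_fst).
  exact: (measurableT_comp mG measurable_snd).
pose F a := \int[mu]_u f (a, u).
have F0 a : 0 <= F a by apply: integral_ge0.
have mF : measurable_fun setT F by exact: (measurable_fun_fubini_tonelli_F (m2 := mu)).
pose g' := (g \_ D).
have mg' : measurable_fun setT g' by apply/(measurable_restrictT _ mD).
have g'0 u : (0 <= g' u)%R by rewrite /g' /patch; case: ifPn.
have SD2 x : S x -> D x.2 by move=> /SD[].
have hE := integral_xsection_restrict g SD2.
have mh : measurable_fun setT (fun a => \int[mu]_u (\1_S (a, u) * g' u)%:E).
  have -> : (fun a => \int[mu]_u (\1_S (a, u) * g' u)%:E) =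
      (fun a => \int[mu]_(u in xsection S a) (g u)%:E).
    by apply/funext => a; rewrite hE.
  exact: measurable_integral_xsection SD2 g0 mg.
have Fle a : D a -> (w a * q a)%:E * \int[mu]_u (\1_S (a, u) * g' u)%:E <= K%:E * F a.
  move=> Da.
  have m1 : measurable_fun setT (fun u => (\1_S (a, u) * g' u)%:E).
    apply/measurable_EFinP; apply: measurable_funM => //.
    have mI : measurable_fun setT (\1_S : T * T -> R) by exact: measurable_indic.
    exact: (measurableT_comp mI (pair1_measurable a)).
  have m2 : measurable_fun setT (fun u => f (a, u)).
    by apply: (measurableT_comp mf); exact: pair1_measurable.
  rewrite -ge0_integralZl//; last 2 first.
  - by move=> u _; rewrite lee_fin mulr_ge0.
  - by rewrite lee_fin mulr_ge0// w0.
  rewrite -ge0_integralZl//; apply: ge0_le_integral => //.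
  - by move=> u _; rewrite mule_ge0// lee_fin mulr_ge0// w0.
  - by apply: measurable_funeM.
  - by apply: measurable_funeM.
  - move=> u _; rewrite -!EFinM lee_fin indicE.
    have [aS|aS] := boolP ((a, u) \in S); last by rewrite !mul0r !mulr0.
    rewrite !mul1r; move: aS; rewrite inE => aS; have [_ Du] := SD _ aS.
    rewrite /= /G /g' /patch mem_set//= mulrAC [leRHS]mulrCA.
    rewrite [leRHS]mulrC ler_wpM2r// mulrC [leRHS]mulrCA ler_wpM2l//.
    exact: wK.
under eq_integral do rewrite hE.
apply: (@le_trans _ _ (\int[mu]_(a in D) (K%:E * F a))).
  apply: ge0_le_integral => //.
  - move=> a Da; apply: mule_ge0; first by rewrite lee_fin mulr_ge0// w0.
    by apply: integral_ge0 => u _; rewrite lee_fin mulr_ge0.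
  - apply: emeasurable_funM; last exact: measurable_funTS.
    by apply/measurable_EFinP; apply: measurable_funM => //; exact: measurable_funTS.
  - by apply: measurable_funeM; exact: measurable_funTS.
rewrite ge0_integralZl//; last exact: measurable_funTS.
rewrite mulrC EFinM -muleA; apply: lee_wpmul2l; first by rewrite lee_fin.
apply: (@le_trans _ _ (\int[mu]_a F a)); first exact: ge0_subset_integral.
have -> : \int[mu]_a F a = \int[mu]_u fubini_G mu f u by exact: (@fubini_tonelli _ _ _ _ _ mu mu f mf f0).
apply: (@le_trans _ _ (\int[mu]_u (C%:E * (G u)%:E))).
  apply: ge0_le_integral => //.
  - by move=> u _; exact: integral_ge0.
  - exact: (measurable_fun_fubini_tonelli_G (m1 := mu)).
  - by apply: measurable_funeM; apply/measurable_EFinP.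
  - move=> u _; rewrite /fubini_G.
    have [Du|Du] := pselect (D u); last first.
      rewrite integral0_eq ?mule_ge0 ?lee_fin// => a _.
      by rewrite /f /= /G /patch memNset// !mulr0.
    have -> : \int[mu]_a f (a, u) = (G u)%:E * \int[mu]_(a in ysection S u) (q a)%:E.
      rewrite -ge0_integralZl ?lee_fin//; first last.
      + by move=> a _; rewrite lee_fin.
      + by apply/measurable_EFinP; exact: measurable_funTS.
      + exact: measurable_ysection.
      rewrite [RHS]integral_mkcond; apply: eq_integral => a _.
      rewrite /patch /f indicE/=; have -> : (a \in ysection S u) = ((a, u) \in S).
        by apply/idP/idP; rewrite !inE /ysection/= inE.
      by case: ifPn; rewrite ?mul0r// mul1r mulrC.
    by rewrite muleC lee_wpmul2r ?lee_fin// qC.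
have -> : \int[mu]_u (C%:E * (G u)%:E) = C%:E * \int[mu]_u (G u)%:E.
  by apply: ge0_integralZl => //; [apply/measurable_EFinP|move=> u _; rewrite lee_fin].
apply: lee_wpmul2l; first by rewrite lee_fin.
rewrite [leRHS]integral_mkcond.
by rewrite le_eqVlt; apply/orP; left; apply/eqP; apply: eq_integral => u _; rewrite /G restrict_EFin.
Qed.

End Schur.

(** * Integrals over hyperbolic neighbourhoods *)

Section DoubleIntegral.
Variable R : realType.
Local Notation borelR := (measurableTypeR R).
Local Notation plane := (borelR * borelR)%type.
Local Notation lplane := (lebesgue_plane R).
Implicit Types (k : R).

Lemma rdiscE : @rdisc R = eball 0%R 1.
Proof. by apply/seteqP; split => u; rewrite /rdisc /eball /disc /mkset subr0. Qed.

Lemma measurable_rdisc : measurable (@rdisc R).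
Proof. by rewrite rdiscE; exact: borel_lebesgue (measurable_eball _ _). Qed.

Lemma measurable_weight (w : R[i] -> R) : weight w ->
  measurable_fun (@rdisc R) (fun u : lplane => w (cplx u)).
Proof. by move=> [_ wint]; apply/measurable_EFinP; exact: measurable_int wint. Qed.

Definition near_diag k : set (lplane * lplane) :=
  [set x | [/\ disc (cplx x.1), disc (cplx x.2) & k <= hk (cplx x.1) (cplx x.2)]].

Definition near_set k (a : R[i]) : set lplane :=
  [set u | disc (cplx u) /\ k <= hk a (cplx u)].

Lemma cmeasurable_fst : cmeasurable setT (fun x : lplane * lplane => cplx x.1).
Proof.
have [h1 h2] := cmeasurable_cplx_lebesgue (@measurableT _ lplane).
split.
  exact: (@measurableT_comp _ _ _ _ _ _ (fun u : lplane => complex.Re (cplx u)) _ _ h1 measurable_fst).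
exact: (@measurableT_comp _ _ _ _ _ _ (fun u : lplane => complex.Im (cplx u)) _ _ h2 measurable_fst).
Qed.

Lemma cmeasurable_snd : cmeasurable setT (fun x : lplane * lplane => cplx x.2).
Proof.
have [h1 h2] := cmeasurable_cplx_lebesgue (@measurableT _ lplane).
split.
  exact: (@measurableT_comp _ _ _ _ _ _ (fun u : lplane => complex.Re (cplx u)) _ _ h1 measurable_snd).
exact: (@measurableT_comp _ _ _ _ _ _ (fun u : lplane => complex.Im (cplx u)) _ _ h2 measurable_snd).
Qed.

Lemma measurable_near_diag k : measurable (near_diag k).
Proof.
pose d (x : lplane * lplane) := (1 - cmod (cplx x.1) ^+ 2) * (1 - cmod (cplx x.2) ^+ 2) -
   k * cmod (1 - (cplx x.1)^*%R * cplx x.2) ^+ 2.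
have mc1 := cmeasurable_cmod cmeasurable_fst.
have mc2 := cmeasurable_cmod cmeasurable_snd.
have md : measurable_fun setT d.
  have m1 (f : lplane * lplane -> R) : measurable_fun setT f -> measurable_fun setT (fun x : lplane * lplane => 1 - f x ^+ 2).
    by move=> mf; apply: measurable_funB; [exact: measurable_cst|exact: measurable_funX].
  apply: measurable_funB; first by apply: measurable_funM; exact: m1.
  apply: measurable_funM; first exact: measurable_cst.
  apply: measurable_funX; apply: cmeasurable_cmod.
  apply: cmeasurableD; first exact: cmeasurable_cst.
  apply: cmeasurableN; apply: cmeasurableM; last exact: cmeasurable_snd.
  exact: cmeasurableJ cmeasurable_fst.
have -> : near_diag k = (@rdisc R `*` @rdisc R) `&` (d @^-1` `[0, +oo[%classic).
  apply/seteqP; split => x.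
    move=> [d1 d2 h]; split; first by split.
    rewrite /preimage/= in_itv/= andbT subr_ge0.
    by move: h; rewrite /hk ler_pdivlMr// exprn_gt0// disc_cross.
  move=> [[d1 d2]]; rewrite /preimage/= in_itv/= andbT subr_ge0 => h.
  by split => //; rewrite /hk ler_pdivlMr// exprn_gt0// disc_cross.
apply: measurableI; first by apply: measurableX; exact: measurable_rdisc.
by rewrite -[X in measurable X]setTI; apply: md => //; exact: measurable_itv.
Qed.

Lemma near_diag_xsection k (a : lplane) : disc (cplx a) ->
  near_set k (cplx a) = xsection (near_diag k) a.
Proof.
move=> da; apply/seteqP; split => u; rewrite /near_set /xsection/= inE.
  by move=> [du h]; split.
by move=> [].
Qed.

Lemma measurable_near_set k (a : lplane) : disc (cplx a) ->
  measurable (near_set k (cplx a)).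
Proof.
by move=> da; rewrite near_diag_xsection//; apply: measurable_xsection; exact: measurable_near_diag.
Qed.

(** Up to a constant, the reciprocal of the area of a hyperbolic disc about
    [a] of fixed radius. *)
Definition boundary_weight (a : R[i]) : R := (1 - cmod a) `^ (- 2).

Lemma boundary_weightE a : disc a -> boundary_weight a = ((1 - cmod a) ^+ 2)^-1.
Proof.
by rewrite /disc/= => da; rewrite /boundary_weight powR_invn// subr_ge0 ltW.
Qed.

(** Only the order of magnitude of the area of a disc is used, which a square
    provides. *)
Lemma dA_square_le (z : R[i]) r : 0 < r ->
  exists Q : set lplane, [/\ measurable Q,
    (forall u, cmod (cplx u - z) <= r -> Q u) & (dA R Q <= (2 * r ^+ 2)%:E)%E].
Proof.
move=> r0; pose I (c : R) : set borelR := `[c - r, c + r]%classic.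
have mI c : measurable (I c) by exact: measurable_itv.
exists (I (complex.Re z) `*` I (complex.Im z) : set plane); split.
- by apply: borel_lebesgue; exact: measurableX.
- move=> [x y] h; have := le_trans (cmod_Re _) h; have := le_trans (cmod_Im _) h.
  case: z h => c d h; rewrite /cplx/= !ler_norml => /andP[h1 h2] /andP[h3 h4].
  by split; rewrite /I/= in_itv/=; apply/andP; split; lra.
- rewrite dA_borel; last exact: measurableX.
  have hI c : lebesgue_measure (I c) = (2 * r)%:E.
    rewrite /I lebesgue_measure_itv/= lte_fin ifT; last by lra.
    by rewrite -EFinB; congr _%:E; ring.
  rewrite borel_area_rect// !hI -!EFinM lee_fin.
  rewrite (_ : pi^-1 * _ = 4 * r ^+ 2 / pi); last first.
    by move: (pi_gt0 R); move: (pi : R) => x x0; field; exact: lt0r_neq0.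
  rewrite ler_pdivrMr ?pi_gt0//; have := pi_ge2 R; have : 0 < r ^+ 2 by rewrite exprn_gt0.
  nra.
Qed.

Lemma measurable_boundary_weight :
  measurable_fun setT (fun a : lplane => boundary_weight (cplx a)).
Proof.
apply: measurable_powR_fun; apply: measurable_funB; first exact: measurable_cst.
apply: cmeasurable_cmod; exact: cmeasurable_cplx_lebesgue.
Qed.

Lemma hk_near (k : R) (u a : R[i]) : 0 < k -> disc u -> disc a -> k <= hk a u ->
  boundary_weight a <= (4 / (k * (1 - cmod u))) ^+ 2 /\
  cmod (a - u) <= 4 * (1 - cmod u) / k.
Proof.
move=> k0 du da h; have u1 : 0 < 1 - cmod u by rewrite subr_gt0.
have [h1 _] := hk_boundary da du k0 h.
rewrite hkC in h; have [_ h2] := hk_boundary du da k0 h.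
have a1 : 0 < 1 - cmod a by rewrite subr_gt0.
split; last by rewrite cmodB ler_pdivlMr// mulrC.
rewrite boundary_weightE// -exprVn lerXn2r ?nnegrE ?invr_ge0 ?divr_ge0 ?mulr_ge0 ?(ltW a1) ?(ltW k0) ?(ltW u1)//.
rewrite -[leLHS]mul1r ler_pdivrMr// mulrAC ler_pdivlMr ?mulr_gt0// mul1r.
exact: h1.
Qed.

Lemma integral_near_diag_le (k : R) (u : lplane) : 0 < k -> disc (cplx u) ->
  (\int[@area R]_(a in ysection (near_diag k) u) (boundary_weight (cplx a))%:E <=
   (512 * k^-1 ^+ 4)%:E)%E.
Proof.
move=> k0 du; pose r := 4 * (1 - cmod (cplx u)) / k.
have u1 : 0 < 1 - cmod (cplx u) by rewrite subr_gt0.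
have r0 : 0 < r by rewrite divr_gt0 ?mulr_gt0.
have [Q [mQ uQ AQ]] := dA_square_le (cplx u) r0.
pose c := (4 / (k * (1 - cmod (cplx u)))) ^+ 2.
have c0 : 0 <= c by rewrite exprn_ge0 ?divr_ge0 ?mulr_ge0 ?(ltW k0) ?(ltW u1).
have hS (a : lplane) : near_diag k (a, u) -> boundary_weight (cplx a) <= c /\ Q a.
  move=> [da _ h]; have [h1 h2] := hk_near k0 du da h.
  by split; [exact: h1|exact: uQ].
have mY := measurable_ysection u (measurable_near_diag k).
have mq := measurable_boundary_weight.
apply: (@le_trans _ _ (\int[@area R]_(a in Q) c%:E)%E).
  rewrite [leLHS]integral_mkcond [leRHS]integral_mkcond.
  apply: ge0_le_integral.
  - exact: measurableT.
  - move=> a _; rewrite /patch; case: ifP => _; last exact: lexx.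
    by rewrite lee_fin; exact: powR_ge0.
  - apply/(measurable_restrictT _ mY); apply/measurable_EFinP.
    apply: measurable_funS mq; [exact: measurableT|exact: subsetT].
  - apply/(measurable_restrictT _ mQ); exact: measurable_cst.
  - move=> a _; rewrite /patch; case: ifPn => [|_].
      rewrite inE /ysection/= inE => /hS[h1 h2].
      by rewrite mem_set// lee_fin.
    by case: ifP => _; [rewrite lee_fin|exact: lexx].
rewrite (integral_cst (@area R) mQ).
apply: (@le_trans _ _ (c%:E * (2 * r ^+ 2)%:E)%E).
  by apply: lee_wpmul2l; [rewrite lee_fin|exact: AQ].
rewrite -EFinM lee_fin /c /r.
have -> : (4 / (k * (1 - cmod (cplx u)))) ^+ 2 * (2 * (4 * (1 - cmod (cplx u)) / k) ^+ 2) =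
    512 * (k^-1) ^+ 4.
  by move: u1 k0; set x := 1 - _ => x0 k0; field; rewrite !gt_eqF.
exact: lexx.
Qed.

(** Fubini, and the fact that the points [a] within a given hyperbolic distance
    of [u] fill an area comparable with [(1 - cmod u) ^+ 2]. *)
Lemma double_integral_le (w g : R[i] -> R) (k D : R) : 0 < k -> 0 <= D -> weight w ->
  (forall a u, disc a -> disc u -> k <= hk a u -> w a <= D * w u) ->
  (forall u, 0 <= g u) -> measurable_fun (@rdisc R) (fun u => g (cplx u)) ->
  (\int[dA R]_(a in @rdisc R) ((w (cplx a) * boundary_weight (cplx a))%:E *
     \int[dA R]_(u in near_set k (cplx a)) (g (cplx u))%:E) <=
   (512 * k^-1 ^+ 4 * D)%:E * \int[dA R]_(u in @rdisc R) (g (cplx u) * w (cplx u))%:E)%E.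
Proof.
move=> k0 D0.
have c0 : 0 <= 512 * k^-1 ^+ 4.
  by apply: mulr_ge0; [exact: ler0n|rewrite exprn_ge0 ?invr_ge0 ?(ltW k0)].
move=> [w0 wint] wD g0 mg.
have mw : measurable_fun (@rdisc R) (fun u => w (cplx u)).
  by apply/measurable_EFinP; exact: measurable_int wint.
clear wint.
have S1 (x : lplane * lplane) : near_diag k x -> rdisc x.1 /\ rdisc x.2.
  by move=> [].
have W1 (a : lplane) : rdisc a -> 0 <= w (cplx a) by move=> da; rewrite ltW ?w0.
have Q1 (a : lplane) : 0 <= boundary_weight (cplx a) by exact: powR_ge0.
have G1 (a : lplane) : 0 <= g (cplx a) by exact: g0.
have WD (a u : lplane) : near_diag k (a, u) -> w (cplx a) <= D * w (cplx u).
  by move=> [da du h]; exact: wD.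
have Y1 (u : lplane) : rdisc u -> (\int[@area R]_(a in ysection (near_diag k) u) (boundary_weight (cplx a))%:E <=
   (512 * k^-1 ^+ 4)%:E)%E.
  by move=> du; exact: integral_near_diag_le.
have := @schur_double_integral _ lplane R (@area R) (@rdisc R) (near_diag k)
  (fun a => w (cplx a)) (fun a => boundary_weight (cplx a)) (fun u => g (cplx u))
  D (512 * k^-1 ^+ 4) measurable_rdisc (measurable_near_diag k) S1 W1 Q1 G1
  mw measurable_boundary_weight mg D0 c0 WD Y1.
apply: le_trans.
rewrite le_eqVlt; apply/orP; left; apply/eqP.
by apply: eq_integral => a; rewrite inE => da; rewrite near_diag_xsection.
Qed.

End DoubleIntegral.

(** * Dyadic means over radii *)

Section DyadicMeans.
Variable R : realType.
Implicit Types (a b : nat -> R) (t x y : R).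

(** The mean of [a 0, a 1, ..., a K] with the weights [1/2, 1/4, ...], the last
    one counted twice so that the weights add up to 1. *)
Fixpoint dyadic_mean a K : R :=
  if K is K'.+1 then (a 0%N + dyadic_mean (fun n => a n.+1) K') / 2 else a 0%N.

Lemma eq_dyadic_mean a b K : (forall n, a n = b n) -> dyadic_mean a K = dyadic_mean b K.
Proof.
by elim: K a b => [|K IH] a b ab /=; rewrite ?ab// (IH _ (fun n => b n.+1)).
Qed.

Lemma dyadic_meanD a b K :
  dyadic_mean (fun n => a n + b n) K = dyadic_mean a K + dyadic_mean b K.
Proof.
elim: K a b => [|K IH] a b //=; rewrite (IH (fun n => a n.+1) (fun n => b n.+1)); by field.
Qed.

Lemma dyadic_meanZ x a K : dyadic_mean (fun n => x * a n) K = x * dyadic_mean a K.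
Proof.
elim: K a => [|K IH] a //=; rewrite (IH (fun n => a n.+1)); by field.
Qed.

Lemma dyadic_mean_cst x K : dyadic_mean (fun=> x) K = x.
Proof. by elim: K => //= K ->; field. Qed.

Lemma dyadic_mean_sum (I : Type) (s : seq I) (a : I -> nat -> R) K :
  dyadic_mean (fun n => \sum_(i <- s) a i n) K = \sum_(i <- s) dyadic_mean (a i) K.
Proof.
elim: s => [|i s IH].
  rewrite big_nil -[RHS](dyadic_mean_cst 0 K).
  by apply: eq_dyadic_mean => n; rewrite big_nil.
rewrite big_cons -IH -dyadic_meanD; apply: eq_dyadic_mean => n.
by rewrite big_cons.
Qed.

Lemma expR_mid x y : expR ((x + y) / 2) <= (expR x + expR y) / 2.
Proof.
rewrite mulrDl expRD.
have -> : expR x = expR (x / 2) ^+ 2 by rewrite expr2 -expRD -splitr.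
have -> : expR y = expR (y / 2) ^+ 2 by rewrite expr2 -expRD -splitr.
have := sqr_ge0 (expR (x / 2) - expR (y / 2)); rewrite sqrrB => h.
lra.
Qed.

(** Arithmetic-geometric means with the weights [2 ^- n]; the powers of [t] cost
    only the factor [t ^- 2] because [\sum_n n 2 ^- n = 2]. *)
Lemma dyadic_AMGM (A : nat -> R) t K : 0 < t -> t <= 1 -> (forall n, 0 < A n) ->
  t ^+ 2 * expR (dyadic_mean (fun n => ln (A n)) K) <=
  \sum_(n < K.+1) 2^-1 ^+ n * t ^+ n.+1 * A n.
Proof.
move=> t0 t1; elim: K A => [|K IH] A A0.
  rewrite big_ord_recl big_ord0 /= expr0 mul1r addr0 lnK ?posrE// ler_wpM2r ?(ltW (A0 _))//.
  by rewrite expr2 expr1 ler_piMl// ltW.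
rewrite big_ord_recl /= expr0 mul1r expr1.
set b := dyadic_mean _ K.
have -> : t ^+ 2 * expR ((ln (A 0%N) + b) / 2) = expR ((ln (t * A 0%N) + (ln (t ^+ 3) + b)) / 2).
  have -> : (ln (t * A 0%N) + (ln (t ^+ 3) + b)) / 2 = ln (t ^+ 2) + (ln (A 0%N) + b) / 2.
    rewrite lnM ?posrE// (lnXn 3 t0) (lnXn 2 t0); move: (ln t) (ln (A 0%N)) b => x y z; by field.
  by rewrite expRD lnK// posrE exprn_gt0.
apply: (le_trans (expR_mid _ _)).
rewrite expRD !lnK ?posrE ?exprn_gt0 ?mulr_gt0//.
have := IH (fun n => A n.+1) (fun n => A0 n.+1); rewrite -/b => h.
have -> : \sum_(i < K.+1) 2^-1 ^+ bump 0 i * t ^+ (bump 0 i).+1 * A (bump 0 i) =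
    t / 2 * \sum_(n < K.+1) 2^-1 ^+ n * t ^+ n.+1 * A n.+1.
  rewrite mulr_sumr; apply: eq_bigr => i _.
  by rewrite /bump leq0n add1n !exprS; ring.
rewrite mulrDl; apply: lerD.
  by rewrite ler_pdivrMr// ler_peMr ?mulr_ge0 ?(ltW t0) ?(ltW (A0 _))// ler1n.
have -> : t ^+ 3 * expR b / 2 = t / 2 * (t ^+ 2 * expR b) by rewrite exprS; ring.
by apply: ler_wpM2l => //; rewrite divr_ge0// ltW.
Qed.

Lemma ln_le_ratio x y : 0 < x -> 0 < y -> ln x - ln y <= x / y - 1.
Proof.
move=> x0 y0; rewrite -ln_div ?posrE//.
have := @le_ln1Dx R (x / y - 1).
rewrite addrCA subrr addr0; apply; rewrite ltrBrDl subrr divr_gt0//.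
Qed.

Let f t K y := t * dyadic_mean (fun n => ln (Num.max y (1 - t * 2^-1 ^+ n.+1))) K + (1 - t) * ln y.

(** To the left of [1 - t / 2] all the maxima are constant in [y], and only the
    term [(1 - t) * ln y] varies; it is controlled by [ln x <= x - 1]. *)
Lemma dyadic_log_left t K y : 0 < t -> t <= 1 -> 1 - t <= y -> y <= 1 - t / 2 ->
  f t K (1 - t / 2) - (1 - t / 2) <= f t K y - y.
Proof.
move=> t0 t1 ty; set r := 1 - t / 2 => yr.
have r0 : 0 < r by rewrite /r; lra.
rewrite /f.
rewrite [in leRHS](@eq_dyadic_mean _ (fun n => ln (Num.max r (1 - t * 2^-1 ^+ n.+1)))); last first.
  move=> n; have h : r <= 1 - t * 2^-1 ^+ n.+1.
    rewrite /r lerB// ler_wpM2l ?(ltW t0)// exprS ler_piMr ?invr_ge0// exprn_ile1 ?invr_ge0// invf_le1// ler1n//.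
  by rewrite !max_r ?(le_trans yr).
set S := t * _.
suff : (1 - t) * (ln r - ln y) <= r - y by lra.
have [t1'|t1'] := eqVneq t 1; first by rewrite t1' subrr mul0r subr_ge0.
have ut : 0 < 1 - t by rewrite subr_gt0 lt_neqAle t1'.
have y0 : 0 < y by apply: lt_le_trans ty.
apply: (@le_trans _ _ ((1 - t) * (r / y - 1))); first by rewrite ler_wpM2l ?(ltW ut)// ln_le_ratio.
have -> : r / y - 1 = (r - y) / y by field; exact: lt0r_neq0.
by rewrite mulrA ler_pdivrMr// mulrC ler_wpM2l// subr_ge0.
Qed.

(** Induction over scales, [t] being the distance to 1 of the previous radius:
    to the right of [1 - t / 2] the first maximum equals [y], and its logarithm
    merges with the other one to give the claim at scale [t / 2]. *)
Lemma dyadic_log_aux K t y : 0 < t -> t <= 1 -> 1 - t <= y -> y <= 1 ->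
  y - 1 - t * 2^-1 ^+ K.+1 <= f t K y.
Proof.
elim: K t y => [|K IH] t y t0 t1 ty y1.
  have W z : 1 - t / 2 <= z -> z <= 1 -> z - 1 - t * 2^-1 ^+ 1 <= f t 0 z.
    move=> rz z1; rewrite /f /= expr1 max_l//.
    have z0 : 0 < z by apply: lt_le_trans rz; lra.
    have := ln_le_ratio ltr01 z0; rewrite ln1 div1r => h.
    have h1 : (1 - z) * (z^-1 - 1) = z^-1 - 2 + z by field; exact: lt0r_neq0.
    have h2 : (1 - z) * (z^-1 - 1) <= 1 - z.
      rewrite ler_piMr ?subr_ge0// lerBlDr; have -> : (1 + 1 : R) = (2^-1)^-1 by rewrite invrK.
      rewrite lef_pV2 ?posrE ?invr_gt0//; lra.
    by move: h h1 h2; set v := z^-1; lra.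
  have [ry|yr] := leP (1 - t / 2) y; first exact: W.
  have := W (1 - t / 2) (lexx _) ltac:(lra).
  have := dyadic_log_left 0 t0 t1 ty (ltW yr).
  by set u := f _ _ _; set v := f _ _ _; lra.
have W z : 1 - t / 2 <= z -> z <= 1 -> z - 1 - t * 2^-1 ^+ K.+2 <= f t K.+1 z.
  move=> rz z1; rewrite /f /= expr1 max_l//.
  have := IH (t / 2) z ltac:(lra) ltac:(lra) rz z1; rewrite /f.
  rewrite (@eq_dyadic_mean _ (fun n => ln (Num.max z (1 - t * 2^-1 ^+ n.+2)))); last first.
    by move=> n; rewrite [in RHS]exprS mulrA.
  set S := dyadic_mean _ _ => h.
  have -> : t * 2^-1 ^+ K.+2 = t / 2 * 2^-1 ^+ K.+1 by rewrite [in LHS]exprS mulrA.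
  by move: h; set A := t / 2 * _; move: (ln z) => l; have -> : t / 2 * S = (t * S) / 2; [ring|lra].
have [ry|yr] := leP (1 - t / 2) y; first exact: W.
have := W (1 - t / 2) (lexx _) ltac:(lra).
have := dyadic_log_left K.+1 t0 t1 ty (ltW yr).
by set u := f _ _ _; set v := f _ _ _; lra.
Qed.

(** The weights [2 ^- n] are sharp here: near [y = 1] the total weight of the
    radii below [y] must not exceed [y], and the radius [1 - 2 ^- n] is where it
    reaches this value. *)
Lemma dyadic_log_bound K y : 0 <= y -> y <= 1 ->
  y - 1 - 2^-1 ^+ K.+1 <= dyadic_mean (fun n => ln (Num.max y (1 - 2^-1 ^+ n.+1))) K.
Proof.
move=> y0 y1; have := @dyadic_log_aux K 1 y ltr01 (lexx 1).
rewrite subrr mul1r => /(_ y0 y1); rewrite /f subrr mul0r addr0 mul1r.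
by rewrite (@eq_dyadic_mean _ (fun n => ln (Num.max y (1 - 2^-1 ^+ n.+1))))// => n; rewrite mul1r.
Qed.

Lemma powR_le_affine y t : 0 <= y -> 0 < t -> t <= 1 -> y `^ t <= 1 - t + t * y.
Proof.
move=> y0 t0 t1; have [->|yn0] := eqVneq y 0.
  by rewrite powR0 ?lt0r_neq0// mulr0 addr0 subr_ge0.
have y0' : 0 < y by rewrite lt_neqAle eq_sym yn0.
have [->|t1'] := eqVneq t 1; first by rewrite powRr1// subrr add0r mul1r.
have ut : 0 < 1 - t by rewrite subr_gt0 lt_neqAle t1'.
have := @conjugate_powR R (y `^ t) 1 t^-1 (1 - t)^-1 (powR_ge0 _ _) ler01.
rewrite !invr_gt0 !invrK mulr1 powR1 mul1r -powRrM divff ?lt0r_neq0// powRr1//.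
have -> : t + (1 - t) = 1 by ring.
by move=> /(_ t0 ut erefl); move: (_ `^ _) => b; lra.
Qed.

(** Concavity of [y `^ (q / m)] makes the two exponents of the factorization
    comparable through the common variable [x `^ m]. *)
Lemma blaschke_mean_le (p q m s x : R) : 0 < q -> q <= m -> 0 < s -> p = s * q ->
  0 <= x -> x <= 1 ->
  1 - s + s * x `^ q <= expR (- (p / m) * (1 - x `^ m)).
Proof.
move=> q0 qm s0 -> x0 x1; have m0 : 0 < m by apply: lt_le_trans qm.
apply: le_trans (expR_ge1Dx _).
have -> : x `^ q = (x `^ m) `^ (q / m) by rewrite -powRrM mulrC divfK ?lt0r_neq0.
have := @powR_le_affine (x `^ m) (q / m) (powR_ge0 _ _).
rewrite divr_gt0// ler_pdivrMr// mul1r => /(_ isT qm).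
move: (x `^ m) => y h.
have -> : s * q / m = s * (q / m) by rewrite mulrA.
by have := ler_wpM2l (ltW s0) h; move: (powR y (q / m)) (q / m) => b t; lra.
Qed.

(** The [m]-th roots of the radii of [dyadic_log_bound], as the variable there
    is the [m]-th power of a pseudohyperbolic distance. *)
Definition dyadic_radius (m : R) n : R := (1 - 2^-1 ^+ n.+1) `^ m^-1.

Lemma half_powS n : 2^-1 ^+ n.+1 <= 2^-1 :> R.
Proof. by rewrite exprS ler_piMr ?invr_ge0// exprn_ile1 ?invr_ge0// invf_le1// ler1n. Qed.

Lemma dyadic_radius_base n : 2^-1 <= 1 - 2^-1 ^+ n.+1 :> R.
Proof. by have := half_powS n; lra. Qed.

Lemma dyadic_radius_gt0 m n : 0 < dyadic_radius m n.
Proof.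
by apply: powR_gt0; apply: lt_le_trans (dyadic_radius_base n); rewrite invr_gt0.
Qed.

(** Bernoulli's inequality: taking roots keeps the distance to 1 of order [2 ^- n]. *)
Lemma dyadic_radius_lt m n : 1 <= m -> dyadic_radius m n <= 1 - m^-1 * 2^-1 ^+ n.+1.
Proof.
move=> m1; have m0 : 0 < m by apply: lt_le_trans m1.
have h0 : 0 <= 1 - 2^-1 ^+ n.+1 :> R.
  by apply: le_trans (dyadic_radius_base n); rewrite invr_ge0.
have := @powR_le_affine _ m^-1 h0; rewrite invr_gt0 invf_le1// => /(_ m0 m1).
by rewrite /dyadic_radius; move: (2^-1 ^+ n.+1) (m^-1) => a c; set b := _ `^ _; lra.
Qed.

(** The exponential decay in each [1 - x `^ m] is converted into a weighted
    geometric mean over the radii, each factor of which is a value of a function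
    of the zeros only through [Num.max x (dyadic_radius m n)]. *)
Lemma zeros_dyadic_le (p m g t : R) (xs : seq R) K : 0 < p -> 1 <= m -> 0 < g ->
  0 < t -> t <= 1 ->
  (forall x, x \in xs -> 0 <= x /\ x <= 1) -> (size xs)%:R * (p / m) <= 2 ^+ K.+1 ->
  g `^ p * \prod_(x <- xs) expR (- (p / m) * (1 - x `^ m)) <=
  expR 1 * t^-2 * \sum_(n < K.+1) 2^-1 ^+ n * t ^+ n.+1 *
     (g * \prod_(x <- xs) Num.max x (dyadic_radius m n)) `^ p.
Proof.
move=> p0 m1 g0 t0 t1 xs01 hK; have m0 : 0 < m by apply: lt_le_trans m1.
pose A n := (g * \prod_(x <- xs) Num.max x (dyadic_radius m n)) `^ p.
have M0 n x : 0 < Num.max x (dyadic_radius m n) by rewrite lt_max dyadic_radius_gt0 orbT.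
have P0 n (s : seq R) : 0 < \prod_(x <- s) Num.max x (dyadic_radius m n) by apply: prodr_gt0.
have A0 n : 0 < A n by apply: powR_gt0; rewrite mulr_gt0.
have := dyadic_AMGM K t0 t1 A0 => h.
apply: (@le_trans _ _ (expR 1 * expR (dyadic_mean (fun n => ln (A n)) K))); last first.
  rewrite -mulrA ler_wpM2l ?expR_ge0// -ler_pdivrMl ?invr_gt0 ?exprn_gt0// invrK.
  exact: h.
have lnA n : ln (A n) = p * ln g + \sum_(x <- xs) p / m * ln (Num.max (x `^ m) (1 - 2^-1 ^+ n.+1)).
  rewrite /A ln_powR lnM ?posrE// mulrDr; congr (_ + _).
  have -> : ln (\prod_(x <- xs) Num.max x (dyadic_radius m n)) = \sum_(x <- xs) ln (Num.max x (dyadic_radius m n)).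
    clear -M0 P0; elim: xs => [|x s IH]; first by rewrite !big_nil ln1.
    by rewrite !big_cons lnM ?posrE// IH.
  rewrite mulr_sumr big_seq [RHS]big_seq; apply: eq_bigr => x /xs01[x0 x1].
  rewrite -mulrA; congr (_ * _).
  have -> : Num.max (x `^ m) (1 - 2^-1 ^+ n.+1) = (Num.max x (dyadic_radius m n)) `^ m.
    have dm : (dyadic_radius m n) `^ m = 1 - 2^-1 ^+ n.+1.
      rewrite /dyadic_radius -powRrM mulVf ?lt0r_neq0// powRr1//.
      by apply: le_trans (dyadic_radius_base n); rewrite invr_ge0.
    rewrite -dm; have [xd|dx] := leP x (dyadic_radius m n).
      by rewrite max_r// ge0_ler_powR ?nnegrE ?(ltW m0) ?(ltW (dyadic_radius_gt0 _ _)).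
    by rewrite max_l// ge0_ler_powR ?nnegrE ?(ltW m0) ?(ltW (dyadic_radius_gt0 _ _)) ?(ltW dx).
  by rewrite ln_powR mulKf ?lt0r_neq0.
have -> : g `^ p * \prod_(x <- xs) expR (- (p / m) * (1 - x `^ m)) =
    expR (p * ln g + \sum_(x <- xs) - (p / m) * (1 - x `^ m)).
  by rewrite expRD expR_sum -ln_powR lnK// posrE powR_gt0.
rewrite -expRD ler_expR (eq_dyadic_mean _ lnA) dyadic_meanD dyadic_mean_cst addrCA lerD2l.
rewrite dyadic_mean_sum.
apply: (@le_trans _ _ (\sum_(x <- xs) (p / m * 2^-1 ^+ K.+1 +
   dyadic_mean (fun n => p / m * ln (Num.max (x `^ m) (1 - 2^-1 ^+ n.+1))) K))).
  rewrite big_seq [leRHS]big_seq; apply: ler_sum => x /xs01[x0 x1].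
  rewrite dyadic_meanZ -mulrDr mulNr -mulrN ler_wpM2l ?divr_ge0 ?(ltW p0) ?(ltW m0)//.
  have y1 : x `^ m <= 1.
    have : powR x m <= powR 1 m by rewrite ge0_ler_powR ?nnegrE ?(ltW m0).
    by rewrite powR1.
  by have := dyadic_log_bound K (powR_ge0 x m) y1; lra.
rewrite big_split/= lerD2r big_const_seq count_predT iter_addr addr0.
by rewrite -[leLHS]mulr_natl mulrA exprVn ler_pdivrMr ?exprn_gt0// mul1r.
Qed.

End DyadicMeans.

(** * Zeros of a polynomial and Jensen maxima *)

Section ZerosInDisc.
Variable R : realType.
Implicit Types (a c u z : R[i]) (r t L : R) (cs : seq R[i]).

Definition zeros_in cs : seq R[i] := [seq c <- cs | cmod c < 1].

Definition zeros_out cs : seq R[i] := [seq c <- cs | ~~ (cmod c < 1)].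

(** The modulus of a polynomial with leading coefficient of modulus [L] and zeros
    [cs] after division by the Blaschke product of its zeros in the disc. *)
Definition outer L cs z : R :=
  L * \prod_(c <- zeros_out cs) cmod (z - c) * \prod_(c <- zeros_in cs) cmod (1 - c^*%R * z).

Definition blaschke_seq cs a : seq R := [seq cmod (mobius c a) | c <- zeros_in cs].

Lemma zeros_inP cs c : c \in zeros_in cs -> disc c.
Proof. by rewrite mem_filter => /andP[]. Qed.

Lemma outer_gt0 L cs z : 0 < L -> disc z -> 0 < outer L cs z.
Proof.
move=> L0 dz; rewrite /outer !mulr_gt0//; rewrite big_seq; apply: prodr_gt0 => c cc.
- rewrite cmod_gt0 subr_eq0; apply: contraTneq cc => <-.
  by rewrite mem_filter negb_and negbK; apply/orP; left.
- by rewrite disc_cross//; exact: zeros_inP cc.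
Qed.

Lemma blaschke_seq01 cs a x : disc a -> x \in blaschke_seq cs a -> 0 <= x /\ x <= 1.
Proof.
move=> da /mapP[c cc ->]; split; first exact: cmod_ge0.
exact: ltW (disc_mobius (zeros_inP cc) da).
Qed.

Lemma near_neq_scale (x y : R) : (x != 0) || (y != 0) ->
  \forall t \near (1 : R)^'-, x != y * t.
Proof.
move=> xy; have [y0|y0] := eqVneq y 0.
  by near=> t; rewrite y0 mul0r; move: xy; rewrite y0 eqxx orbF.
have : \forall t \near (1 : R)^'-, t != x / y.
  have [h|h] := ltP (x / y) 1; near=> t; last by rewrite lt_eqF// (lt_le_trans _ h).
  by rewrite gt_eqF//; near: t; exact: nbhs_left_gt.
apply: filterS => t; apply: contraNneq => ->.
by rewrite mulrAC divff// mul1r.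
Unshelve. all: by end_near. Qed.

Lemma near_all (T : eqType) (s : seq T) (Q : T -> R -> Prop) :
  (forall i, i \in s -> \forall t \near (1 : R)^'-, Q i t) ->
  \forall t \near (1 : R)^'-, forall i, i \in s -> Q i t.
Proof.
elim: s => [|i s IH] h; first by near=> t => j; rewrite in_nil.
have h1 := h i (mem_head _ _).
have h2 := IH (fun j js => h j (@mem_behead _ (i :: s) j js)).
near=> t => j; rewrite in_cons => /orP[/eqP->|js]; first by near: t.
by move: j js; near: t.
Unshelve. all: by end_near. Qed.

Lemma le_limit_scale (x M : R) n :
  (\forall t \near (1 : R)^'-, t ^+ n * x <= M) -> x <= M.
Proof.
move=> h; have cv : t ^+ n * x @[t --> (1 : R)^'-] --> x.
  have e : x = 1 ^+ n * x by rewrite expr1n mul1r.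
  rewrite [X in _ --> X]e.
  apply: cvg_at_left_filter; apply: cvgM; last exact: cvg_cst.
  exact: exprn_continuous.
rewrite -(cvg_lim _ cv)//; apply: limr_le; last exact: h.
by apply/cvg_ex; eexists; exact: cv.
Qed.

Lemma mobius_zero_modulus a c z : disc a -> cmod z < 1 ->
  cmod (mobius a z - c) = cmod ((a - c) - (1 - c * a^*%R) * z) * (cmod (1 - a^*%R * z))^-1.
Proof.
move=> da dz; have h : 1 - a^*%R * z != 0 by rewrite -cmod_gt0 disc_cross.
rewrite -cmodV -cmodM; congr cmod; rewrite /mobius.
by field.
Qed.

(** Jensen's formula for [P \o mobius a]: the factor that a zero [c] contributes
    is linear up to a common denominator, and for [c] in the disc the maximum of
    its two terms on the circle of radius [r] is [cmod (1 - c^*%R * a)] times the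
    maximum of [cmod (mobius c a)] and [r].  Radii
    at which the two terms have equal modulus are avoided by letting the radius
    tend to [r]. *)
Lemma outer_max_le L cs a r M : 0 < L -> disc a -> 0 < r -> r < 1 ->
  (forall z, cmod z <= r -> L * \prod_(c <- cs) cmod (mobius a z - c) <= M) ->
  outer L cs a * \prod_(x <- blaschke_seq cs a) Num.max x r <= M.
Proof.
move=> L0 da r0 r1 hM; have a1 : cmod a < 1 := da.
pose s := rcons [seq (a - c, 1 - c * a^*%R, 1 : R) | c <- cs] (1, a^*%R, - (size cs)%:R).
have sE z : cmod z < 1 -> loglin L s z = L * \prod_(c <- cs) cmod (mobius a z - c).
  move=> dz; rewrite /loglin big_rcons/= big_map; congr (_ * _).
  have -> : \prod_(c <- cs) cmod (mobius a z - c) =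
      \prod_(c <- cs) (cmod ((a - c) - (1 - c * a^*%R) * z) * (cmod (1 - a^*%R * z))^-1).
    by apply: eq_bigr => c _; exact: mobius_zero_modulus.
  rewrite big_split/=; congr (_ * _).
    by apply: eq_bigr => c _; rewrite powRr1 ?cmod_ge0.
  rewrite powR_invn ?cmod_ge0// big_const_seq count_predT.
  by rewrite -exprVn; elim: (size cs) => [|n IH] /=; rewrite ?expr0// exprS IH.
apply: (@le_limit_scale _ _ (size cs)).
have gen : \forall t \near (1 : R)^'-, forall c, c \in cs -> cmod (a - c) != (cmod (1 - c * a^*%R) * r) * t.
  apply: (@near_all _ cs (fun c t => cmod (a - c) != (cmod (1 - c * a^*%R) * r) * t)) => c _.
  apply: near_neq_scale; rewrite mulf_eq0 (gt_eqF r0) orbF !cmod_eq0.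
  have [<-|ac] := eqVneq a c; last by rewrite subr_eq0 ac.
  by rewrite -[X in _ || X]/(~~ _) -cmod_eq0 mulrC -cmod_gt0 ?disc_cross ?orbT//.
near=> t.
have t0 : 0 < t by near: t; exact: nbhs_left_gt.
have t1 : t < 1 by near: t; exact: nbhs_left_lt.
have tr0 : 0 < t * r by rewrite mulr_gt0.
have trr : t * r <= r by rewrite ler_piMl ?(ltW r0)// ltW.
have tr1 : t * r < 1 by apply: le_lt_trans r1.
have cr : cmod ((t * r)%:C) = t * r by rewrite cmod_real ger0_norm ?(ltW tr0).
have := @loglin_max_le _ L s ((t * r)%:C) M (ltW L0).
have h1 i : i \in s -> cmod i.1.1 != cmod (i.1.2 * (t * r)%:C).
  rewrite mem_rcons in_cons => /orP[/eqP->|/mapP[c cc ->]]; cbn [fst snd].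
    rewrite cmod1 cmodM cmodJ cr gt_eqF// mulr_ilt1 ?cmod_ge0 ?(ltW tr0)//.
  rewrite cmodM cr mulrA.
  have g : forall c, c \in cs -> cmod (a - c) != (cmod (1 - c * a^*%R) * r) * t by near: t.
  by rewrite mulrAC; exact: g.
move=> /(_ h1) /= hm.
apply: le_trans (hm _) => [|u u1]; last first.
  have zu : cmod ((t * r)%:C * u) = t * r by rewrite cmodM u1 mulr1.
  by rewrite sE ?zu//; apply: hM; rewrite zu.
rewrite /loglin_max big_rcons/= big_map/=.
have -> : Num.max (cmod (1 : R[i])) (cmod (a^*%R * (t * r)%:C)) = 1.
  by rewrite cmod1 max_l// cmodM cmodJ cr mulr_ile1 ?cmod_ge0 ?(ltW tr0) ?(ltW a1) ?(ltW tr1).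
rewrite powR1 mulr1.
pose F c := if cmod c < 1 then Num.max (cmod (a - c)) (cmod (1 - c * a^*%R) * r) else cmod (a - c).
have F0 c : 0 <= F c by rewrite /F; case: ifP => _; rewrite ?le_max ?cmod_ge0.
have -> : outer L cs a * \prod_(x <- blaschke_seq cs a) Num.max x r = L * \prod_(c <- cs) F c.
  rewrite /outer /blaschke_seq big_map /zeros_in /zeros_out !big_filter -!mulrA; congr (L * _).
  rewrite [in RHS](bigID (fun c => cmod c < 1))/= mulrC [in LHS]mulrC.
  rewrite [LHS](_ : _ = (\prod_(c <- cs | cmod c < 1) cmod (1 - c^*%R * a) * \prod_(c <- cs | cmod c < 1) Num.max (cmod (mobius c a)) r) * \prod_(c <- cs | ~~ (cmod c < 1)) cmod (a - c)); last by ring.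
  congr (_ * _).
    rewrite -big_split/=; apply: eq_bigr => c c1; rewrite /F c1.
    have d0 : 0 < cmod (1 - c^*%R * a) by rewrite disc_cross.
    have -> : cmod (1 - c * a^*%R) = cmod (1 - c^*%R * a) by rewrite -cmodJ !conjE.
    rewrite /mobius cmodM cmodV [cmod (c - a)]cmodB maxr_pMr ?(ltW d0)//.
    by congr (Num.max _ _); rewrite mulrC divfK// gt_eqF.
  by apply: eq_bigr => c /negbTE c1; rewrite /F c1.
rewrite mulrCA ler_wpM2l ?(ltW L0)//.
have -> : t ^+ size cs * \prod_(c <- cs) F c = \prod_(c <- cs) (t * F c).
  rewrite big_split/= big_const_seq count_predT; congr (_ * _).
  by elim: (size cs) => //= n <-; rewrite exprS.
apply: ler_prod => c _; rewrite mulr_ge0 ?(ltW t0)//= powRr1 ?le_max ?cmod_ge0// cmodM cr.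
rewrite /F; case: ifP => _; last by rewrite ler_piMl ?cmod_ge0 ?(ltW t1).
rewrite maxr_pMr ?(ltW t0)// !ge_max [t * (_ * r)]mulrCA lexx.
have h : t * cmod (a - c) <= cmod (a - c) by rewrite ler_piMl ?cmod_ge0 ?(ltW t1).
rewrite h /= andbT.
case: (leP (cmod (1 - c * a^*%R) * (t * r)) (cmod (a - c))) => //= h'.
by rewrite (le_trans h) ?(ltW h').
Unshelve. all: by end_near. Qed.

End ZerosInDisc.

(** * The core estimate *)

Section WeightedZeros.
Variable R : realType.
Local Notation lplane := (lebesgue_plane R).
Implicit Types (a u z : R[i]) (L m p k : R) (cs : seq R[i]) (n : nat).

Definition zeros_modulus L cs u : R := L * \prod_(c <- cs) cmod (u - c).

Lemma zeros_modulus_loglin L cs p u : 0 <= L ->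
  zeros_modulus L cs u `^ p = loglin (L `^ p) [seq (c, 1, p) | c <- cs] u.
Proof.
move=> L0; have -> : zeros_modulus L cs u = loglin L [seq (c, 1, 1 : R) | c <- cs] u.
  rewrite /zeros_modulus /loglin big_map; congr (_ * _).
  by apply: eq_bigr => c _; rewrite /= mul1r powRr1 ?cmod_ge0// cmodB.
rewrite loglin_powR// -map_comp; congr loglin.
by apply: eq_map => c; rewrite /= mul1r.
Qed.

Lemma zeros_modulus_ge0 L cs u : 0 <= L -> 0 <= zeros_modulus L cs u.
Proof. by move=> L0; rewrite mulr_ge0// prodr_ge0// => c _; exact: cmod_ge0. Qed.

Lemma measurable_zeros_modulus L cs p (D : set lplane) : measurable D -> 0 <= L ->
  measurable_fun D (fun u : lplane => zeros_modulus L cs (cplx u) `^ p).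
Proof.
move=> mD L0; under eq_fun do rewrite zeros_modulus_loglin//.
exact: (measurable_loglin _ _ (cmeasurable_cplx_lebesgue mD)).
Qed.

Definition near_radius m n : R := (9 * m)^-1 * 2^-1 ^+ n.+1.

Lemma near_radius_gt0 m n : 0 < m -> 0 < near_radius m n.
Proof. by move=> m0; rewrite mulr_gt0 ?invr_gt0 ?exprn_gt0 ?mulr_gt0 ?invr_gt0. Qed.

Lemma near_radius_le m n z : 1 <= m -> cmod z <= dyadic_radius m n ->
  9 * near_radius m n <= 1 - cmod z ^+ 2.
Proof.
move=> m1 h; have m0 : 0 < m by apply: lt_le_trans m1.
have := dyadic_radius_lt n m1; have := cmod_ge0 z.
have -> : 9 * near_radius m n = m^-1 * 2^-1 ^+ n.+1.
  rewrite /near_radius; move: (2^-1 ^+ n.+1) => x; field; exact: lt0r_neq0.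
have : 0 < m^-1 * 2^-1 ^+ n.+1 by rewrite mulr_gt0 ?exprn_gt0 ?invr_gt0.
move: h; move: (m^-1 * _) (dyadic_radius _ _) (cmod z) => e d x; nra.
Qed.

Lemma cplx_eta a : a = cplx (complex.Re a, complex.Im a).
Proof. by case: a. Qed.

(** The sub-mean value property of [cmod P `^ p] on the disc of centre
    [mobius a z] whose radius is half the distance to the boundary: this disc
    stays in a hyperbolic neighbourhood of [a] of controlled size. *)
Lemma zeros_modulus_near L cs p m n a z : 0 <= L -> 0 < p -> 1 <= m -> disc a ->
  cmod z <= dyadic_radius m n ->
  ((zeros_modulus L cs (mobius a z) `^ p)%:E <=
   (pi * (near_radius m n)^-1 ^+ 2 * boundary_weight a)%:E *
   \int[dA R]_(u in near_set (near_radius m n) a) (zeros_modulus L cs (cplx u) `^ p)%:E)%E.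
Proof.
move=> L0 p0 m1 da hz; have m0 : 0 < m by apply: lt_le_trans m1.
have k0 := near_radius_gt0 n m0; have kz := near_radius_le m1 hz.
set k := near_radius m n in k0 kz *.
have dz : disc z.
  have h : 0 < 1 - cmod z ^+ 2 by apply: lt_le_trans kz; rewrite mulr_gt0.
  by rewrite /disc/= -(@expr_lt1 _ 2) ?cmod_ge0// -subr_gt0.
set x := mobius a z; have dx : disc x by exact: disc_mobius.
have hkx : 9 * k <= hk a x.
  by rewrite hk_mobius// mobiusK.
pose r := (1 - cmod x) / 2.
have x1 : 0 < 1 - cmod x by rewrite subr_gt0.
have a1 : 0 < 1 - cmod a by rewrite subr_gt0.
have r0 : 0 < r by rewrite divr_gt0.
have rk : k * (1 - cmod a) <= r.
  rewrite hkC in hkx; have [|h _] := hk_boundary dx da _ hkx; first by rewrite mulr_gt0.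
  have : 0 < k * (1 - cmod a) by rewrite mulr_gt0.
  by move: h; rewrite /r -mulrA; move: (k * _) (1 - cmod x) => e f; lra.
pose s := [seq (c, 1 : R[i], p) | c <- cs].
have adm : loglin_admissible [seq (i.1.1 - i.1.2 * x, i.1.2, i.2) | i <- s] r.
  move=> i /mapP[j /mapP[c _ ->] ->]; split; first by rewrite /= oner_eq0 orbT.
  by left; rewrite /= ltW.
have := loglin_submean (powR_ge0 L p) r0 adm.
have sub : (eball x r : set lplane) `<=` near_set k a.
  move=> u ux; have [du _] := ball_sub_disc dx ux; split => //.
  apply: le_trans (hk_ball da dx ux).
  by rewrite ler_pdivlMr// mulrC.
have mN : measurable (near_set k a) by rewrite (cplx_eta a); apply: measurable_near_set; rewrite -cplx_eta.
have mE : measurable (eball x r : set lplane) by apply: borel_lebesgue; exact: measurable_eball.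
rewrite -zeros_modulus_loglin//.
under eq_integral do rewrite -zeros_modulus_loglin//.
move=> hI; have {hI}hI : ((zeros_modulus L cs x `^ p * (r ^+ 2 / pi))%:E <=
    \int[dA R]_(u in near_set k a) (zeros_modulus L cs (cplx u) `^ p)%:E)%E.
  apply: (le_trans hI); apply: ge0_subset_integral; [exact: mE|exact: mN| | |exact: sub].
    by apply/measurable_EFinP; exact: measurable_zeros_modulus.
  by move=> u _; rewrite lee_fin powR_ge0.
have b0 : 0 <= pi * k^-1 ^+ 2 * boundary_weight a.
  by rewrite !mulr_ge0 ?powR_ge0 ?pi_ge0 ?exprn_ge0 ?invr_ge0 ?(ltW k0).
apply: le_trans (lee_wpmul2l _ hI); last by rewrite lee_fin.
rewrite -EFinM lee_fin mulrCA ler_peMr ?powR_ge0// boundary_weightE//.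
rewrite [leRHS](_ : _ = (r / (k * (1 - cmod a))) ^+ 2); last first.
  have := pi_gt0 R; clearbody r; move: (pi : R) => y y0; field.
  by rewrite !gt_eqF.
have ka0 : 0 < k * (1 - cmod a) by rewrite mulr_gt0.
by apply: exprn_ege1; rewrite (ler_pdivlMr _ _ ka0) mul1r.
Qed.

(** [outer_max_le] with the bounds of [zeros_modulus_near] on the circle. *)
Lemma outer_near_le L cs p m n a : 0 < L -> 0 < p -> 1 <= m -> disc a ->
  (((outer L cs a * \prod_(x <- blaschke_seq cs a) Num.max x (dyadic_radius m n)) `^ p)%:E <=
   (pi * (near_radius m n)^-1 ^+ 2 * boundary_weight a)%:E *
   \int[dA R]_(u in near_set (near_radius m n) a) (zeros_modulus L cs (cplx u) `^ p)%:E)%E.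
Proof.
move=> L0 p0 m1 da; have := fun z => @zeros_modulus_near L cs p m n a z (ltW L0) p0 m1 da.
set I := (_ * _)%E.
have : (0 <= I)%E.
  have m0 : 0 < m by apply: lt_le_trans m1.
  apply: mule_ge0; last by apply: integral_ge0 => u _; rewrite lee_fin powR_ge0.
  by rewrite lee_fin !mulr_ge0 ?powR_ge0 ?pi_ge0 ?exprn_ge0 ?invr_ge0 ?(ltW (near_radius_gt0 n m0)).
move: I => [M||]; [|by move=> *; rewrite leey|by []].
rewrite lee_fin => M0 h; rewrite lee_fin.
have -> : M = (M `^ p^-1) `^ p by rewrite -powRrM mulVf ?lt0r_neq0// powRr1.
have r1 : dyadic_radius m n < 1.
  apply: le_lt_trans (dyadic_radius_lt n m1) _; rewrite ltrBlDr ltrDl.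
  by rewrite mulr_gt0 ?invr_gt0 ?exprn_gt0 ?invr_gt0// (lt_le_trans ltr01).
have g0 : 0 <= outer L cs a * \prod_(x <- blaschke_seq cs a) Num.max x (dyadic_radius m n).
  rewrite mulr_ge0 ?(ltW (outer_gt0 cs L0 da))// prodr_ge0// => x _.
  by rewrite le_max (ltW (dyadic_radius_gt0 _ _)) orbT.
rewrite ge0_ler_powR ?nnegrE ?powR_ge0 ?(ltW p0)//.
apply: outer_max_le => //; first exact: dyadic_radius_gt0.
move=> z hz; have := h z hz; rewrite lee_fin => hp.
rewrite -[leLHS]/(zeros_modulus L cs (mobius a z)).
rewrite -[leLHS]powRr1 ?zeros_modulus_ge0 ?(ltW L0)//.
have <- : p / p = 1 by rewrite divff ?lt0r_neq0.
rewrite powRrM.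
by rewrite ge0_ler_powR ?nnegrE ?powR_ge0 ?invr_ge0 ?(ltW p0).
Qed.

Lemma measurable_outer L cs : measurable_fun (@rdisc R) (fun a : lplane => outer L cs (cplx a)).
Proof.
have mc := cmeasurable_cplx_lebesgue (@measurable_rdisc R).
apply: measurable_funM; first apply: measurable_funM.
- exact: measurable_cst.
- apply: measurable_fun_prods => c; apply: cmeasurable_cmod; apply: cmeasurableD => //.
- apply: measurable_fun_prods => c; apply: cmeasurable_cmod; apply: cmeasurableD.
    exact: cmeasurable_cst.
  by apply: cmeasurableN; apply: cmeasurableM => //; exact: cmeasurable_cst.
Qed.

Lemma measurable_mobius_modulus c : measurable_fun (@rdisc R) (fun a : lplane => cmod (mobius c (cplx a))).
Proof.
have mc := cmeasurable_cplx_lebesgue (@measurable_rdisc R).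
have -> : (fun a : lplane => cmod (mobius c (cplx a))) = (fun a : lplane => loglin 1 [:: (c, 1, 1); (1, c^*%R, -1)] (cplx a)).
  apply/funext => a; rewrite /loglin !big_cons big_nil mul1r mulr1; cbn [fst snd].
  by rewrite mul1r powRr1 ?cmod_ge0// powR_inv1 ?cmod_ge0// /mobius cmodM cmodV.
exact: measurable_loglin.
Qed.

(** The average of [\prod_(c in S) cmod (mobius c a) `^ q] over random sets [S]
    that contain each zero independently with probability [s]. *)
Definition mean_factor (s q : R) cs a : R := \prod_(c <- cs) (1 - s + s * cmod (mobius c a) `^ q).

Lemma measurable_mean_factor s q cs : measurable_fun (@rdisc R) (fun a : lplane => mean_factor s q cs (cplx a)).
Proof.
apply: measurable_fun_prods => c; apply: measurable_funD; first exact: measurable_cst.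
apply: measurable_funM; first exact: measurable_cst.
by apply: measurable_powR_fun; exact: measurable_mobius_modulus.
Qed.

Lemma mean_factor_ge0 s q cs a : 0 <= s -> s <= 1 -> 0 <= mean_factor s q cs a.
Proof.
move=> s0 s1; apply: prodr_ge0 => c _.
by rewrite addr_ge0 ?subr_ge0// mulr_ge0// powR_ge0.
Qed.

Lemma mean_factors_le p p1 p2 m cs a : 0 < p -> 0 < p1 -> 0 < p2 -> p1 <= m -> p2 <= m ->
  p / p1 + p / p2 = 1 -> disc a ->
  p / p1 * mean_factor (p / p1) p1 (zeros_in cs) a + p / p2 * mean_factor (p / p2) p2 (zeros_in cs) a <=
  \prod_(x <- blaschke_seq cs a) expR (- (p / m) * (1 - x `^ m)).
Proof.
move=> p0 p10 p20 m1 m2 s1 da.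
have h q : 0 < q -> q <= m -> p / q <= 1 -> mean_factor (p / q) q (zeros_in cs) a <=
    \prod_(x <- blaschke_seq cs a) expR (- (p / m) * (1 - x `^ m)).
  move=> q0 qm s1'; rewrite /blaschke_seq big_map /mean_factor big_seq [leRHS]big_seq.
  apply: ler_prod => c cc.
  have x1 : cmod (mobius c a) <= 1 by exact: ltW (disc_mobius (zeros_inP cc) da).
  apply/andP; split.
    by rewrite addr_ge0 ?subr_ge0// mulr_ge0 ?powR_ge0// divr_ge0 ?(ltW p0) ?(ltW q0).
  apply: blaschke_mean_le => //; rewrite ?cmod_ge0 ?divr_gt0//.
  by rewrite divfK// lt0r_neq0.
have a1 : 0 < p / p1 by rewrite divr_gt0.
have a2 : 0 < p / p2 by rewrite divr_gt0.
have l1 : p / p1 <= 1 by lra.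
have l2 : p / p2 <= 1 by lra.
set B := \prod_(x <- _) _.
have -> : B = p / p1 * B + p / p2 * B by rewrite -mulrDl s1 mul1r.
by apply: lerD; rewrite ler_wpM2l ?(ltW a1) ?(ltW a2)//; apply: h.
Qed.

Lemma geometric_half_le n : \sum_(i < n) 2^-1 ^+ i <= 2 :> R.
Proof.
suff -> : \sum_(i < n) 2^-1 ^+ i = 2 - 2 * 2^-1 ^+ n :> R.
  by rewrite gerBl mulr_ge0 ?exprn_ge0 ?invr_ge0.
elim: n => [|n IH]; first by rewrite big_ord0 expr0; ring.
by rewrite big_ord_recr/= IH exprS; field.
Qed.

Lemma measurable_near_term (w : R[i] -> R) L cs p k :
  measurable_fun (@rdisc R) (fun u : lplane => w (cplx u)) -> 0 <= L ->
  measurable_fun (@rdisc R) (fun a : lplane => ((w (cplx a) * boundary_weight (cplx a))%:E *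
    \int[dA R]_(u in near_set k (cplx a)) (zeros_modulus L cs (cplx u) `^ p)%:E)%E).
Proof.
move=> mw L0.
have mz : measurable_fun (@rdisc R) (fun u : lplane => zeros_modulus L cs (cplx u) `^ p).
  by apply: measurable_zeros_modulus; [exact: measurable_rdisc|exact: L0].
apply: emeasurable_funM.
  apply/measurable_EFinP; apply: measurable_funM; first exact: mw.
  apply: measurable_funS (@measurable_boundary_weight R); [exact: measurableT|exact: subsetT].
have S2 (x : lplane * lplane) : near_diag k x -> rdisc x.2 by move=> [].
have Z0 (u : lplane) : 0 <= zeros_modulus L cs (cplx u) `^ p by exact: powR_ge0.
have mX := @measurable_integral_xsection _ lplane R (@area R) (@rdisc R) (near_diag k)
  (fun u : lplane => zeros_modulus L cs (cplx u) `^ p) (@measurable_rdisc R) (measurable_near_diag k) S2 Z0 mz.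
apply: (@eq_measurable_fun _ _ lplane (\bar R) (@rdisc R) (fun a : lplane => \int[@area R]_(u in xsection (near_diag k) a) (zeros_modulus L cs (cplx u) `^ p)%:E)%E).
  by move=> a; rewrite inE => da; rewrite near_diag_xsection.
apply: measurable_funS mX; [exact: measurableT|exact: subsetT].
Qed.

Lemma measurable_mean_integrand (w : R[i] -> R) L cs cs' p s1 s2 q1 q2 :
  measurable_fun (@rdisc R) (fun u : lplane => w (cplx u)) ->
  measurable_fun (@rdisc R) (fun a : lplane =>
    ((s1 * mean_factor s1 q1 cs' (cplx a) + s2 * mean_factor s2 q2 cs' (cplx a)) *
     outer L cs (cplx a) `^ p * w (cplx a))%:E).
Proof.
move=> mw; apply/measurable_EFinP; apply: measurable_funM; last exact: mw.
apply: measurable_funM; last by apply: measurable_powR_fun; exact: measurable_outer.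
by apply: measurable_funD; (apply: measurable_funM; [exact: measurable_cst|exact: measurable_mean_factor]).
Qed.

Lemma weighted_zeros_const t m D y e n n0 : 0 < t -> 0 < m -> 0 < D -> t = (64 * D)^-1 ->
  e * t^-2 * (2^-1 ^+ n * t ^+ n.+1) * (y * (near_radius m n)^-1 ^+ 2) *
    (512 * (near_radius m n)^-1 ^+ 4 * D ^+ (n.+1 + n0).+1) =
  e * t^-1 * y * (18 * m) ^+ 6 * 512 * D ^+ n0.+2 * 2^-1 ^+ n.
Proof.
move=> t0 m0 D0 tE.
have -> : D ^+ (n.+1 + n0).+1 = D ^+ n * D ^+ n0.+2.
  by rewrite -exprD; congr (_ ^+ _); rewrite addnS addSn !addnS.
have tD : t ^+ n * D ^+ n = (2^-1 ^+ n) ^+ 6.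
  rewrite -exprMn -[RHS]exprM mulnC exprM; congr (_ ^+ _).
  have h : 2 ^+ 6 = 64 :> R by rewrite -natrX.
  by rewrite tE invfM divfK ?(lt0r_neq0 D0)// exprVn h.
rewrite /near_radius !exprS.
have X0 : 0 < 2^-1 ^+ n :> R by rewrite exprn_gt0 ?invr_gt0.
clear -tD X0 t0 m0; move: tD X0 t0; move: (D ^+ n0) (D ^+ n) (t ^+ n) (2^-1 ^+ n) => D2 Dn tn X tD X0 t0.
rewrite !expr0 !mulr1.
transitivity (e * t^-1 * y * (18 * m) ^+ 6 * 512 * (D * (D * D2)) * X * (tn * Dn / X ^+ 6)).
  by field; rewrite !lt0r_neq0.
by rewrite tD divff ?mulr1// expf_neq0// lt0r_neq0.
Qed.

(** Both averages are at most the product of exponentials in [zeros_dyadic_le],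
    whose means over radii are bounded by local integrals in [outer_near_le].
    Only the number of terms depends on the polynomial. *)
Lemma mean_integrand_le (w : R[i] -> R) p p1 p2 t : 0 < p -> 0 < p1 -> 0 < p2 ->
  p / p1 + p / p2 = 1 -> 0 < t -> t <= 1 ->
  forall L cs, 0 < L -> exists K : nat, forall a, disc a -> 0 <= w a ->
  (((p / p1 * mean_factor (p / p1) p1 (zeros_in cs) a +
     p / p2 * mean_factor (p / p2) p2 (zeros_in cs) a) * outer L cs a `^ p * w a)%:E <=
   \sum_(n < K.+1) ((expR 1 * t^-2 * (2^-1 ^+ n * t ^+ n.+1) *
      (pi * (near_radius (p1 + p2 + 1) n)^-1 ^+ 2))%:E *
      ((w a * boundary_weight a)%:E * \int[dA R]_(u in near_set (near_radius (p1 + p2 + 1) n) a)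
          (zeros_modulus L cs (cplx u) `^ p)%:E)))%E.
Proof.
move=> p0 p10 p20 s1 t0 t1 L cs L0.
(* Any exponent that is at least [1], [p1] and [p2] serves. *)
set m := p1 + p2 + 1.
have m1 : 1 <= m by rewrite /m lerDr addr_ge0// ltW.
have m0 : 0 < m by apply: lt_le_trans m1.
have pm1 : p1 <= m by rewrite /m -addrA lerDl addr_ge0// ltW.
have pm2 : p2 <= m by rewrite /m addrAC lerDr addr_ge0// ltW.
have [K hK] : exists K, (size (blaschke_seq cs 0))%:R * (p / m) <= 2 ^+ K.+1 :> R.
  have h0 : 0 <= 2^-1 :> R by rewrite invr_ge0.
  have h1 : 2^-1 < 1 :> R by rewrite invf_lt1// ltr1n.
  set x := _ * _; have x0 : 0 <= x by rewrite mulr_ge0 ?ler0n// divr_ge0 ?(ltW p0) ?(ltW m0).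
  have [|K hK] := cvg_pow_lt h0 h1 (e := (x + 1)^-1); first by rewrite invr_gt0 ltr_wpDl.
  exists K; move: hK; rewrite exprVn lef_pV2 ?posrE ?exprn_gt0 ?ltr_wpDl// => h.
  have h2 : (2 ^+ K : R) <= 2 ^+ K.+1 by rewrite exprS ler_peMl ?exprn_ge0// ler1n.
  by apply: le_trans h2; apply: le_trans h; rewrite lerDl.
exists K => a da wa0.
pose k n := near_radius m n.
pose c n := expR 1 * t^-2 * (2^-1 ^+ n * t ^+ n.+1).
have c0 n : 0 <= c n.
  apply: mulr_ge0; last by apply: mulr_ge0; apply: exprn_ge0; [rewrite invr_ge0|exact: ltW].
  by apply: mulr_ge0; [exact: expR_ge0|rewrite invr_ge0 exprn_ge0// ltW].
pose I n := (\int[dA R]_(u in near_set (k n) a) (zeros_modulus L cs (cplx u) `^ p)%:E)%E.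
have hT := mean_factors_le cs p0 p10 p20 pm1 pm2 s1 da.
have o0 := outer_gt0 cs L0 da.
have xs01 x : x \in blaschke_seq cs a -> 0 <= x /\ x <= 1 by exact: blaschke_seq01.
have hK' : (size (blaschke_seq cs a))%:R * (p / m) <= 2 ^+ K.+1.
  by move: hK; rewrite !size_map.
have hz := zeros_dyadic_le p0 m1 o0 t0 t1 xs01 hK'.
pose G n := (outer L cs a * \prod_(x <- blaschke_seq cs a) Num.max x (dyadic_radius m n)) `^ p.
apply: (@le_trans _ _ (\sum_(n < K.+1) (w a * c n)%:E * (G n)%:E)%E).
  rewrite (eq_bigr (fun n : 'I_K.+1 => (w a * c n * G n)%:E)); last by move=> n _; rewrite EFinM.
  rewrite sumEFin lee_fin mulrC.
  rewrite (eq_bigr (fun n : 'I_K.+1 => w a * (c n * G n))); last by move=> n _; rewrite mulrA.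
  rewrite -mulr_sumr; apply: ler_wpM2l; first exact: wa0.
  apply: (@le_trans _ _ (outer L cs a `^ p * \prod_(x <- blaschke_seq cs a) expR (- (p / m) * (1 - x `^ m)))).
    by rewrite mulrC; apply: ler_wpM2l; [exact: powR_ge0|exact: hT].
  apply: (le_trans hz); rewrite mulr_sumr le_eqVlt; apply/orP; left; apply/eqP.
  by apply: eq_bigr => n _; rewrite /c /G !mulrA.
apply: lee_sum => n _.
have -> : ((c n * (pi * (k n)^-1 ^+ 2))%:E * ((w a * boundary_weight a)%:E * I n) = (w a * c n)%:E *
   ((pi * (k n)^-1 ^+ 2 * boundary_weight a)%:E * I n))%E.
  by rewrite !muleA -!EFinM; congr (_%:E * _)%E; ring.
apply: lee_wpmul2l; first by rewrite lee_fin mulr_ge0.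
exact: outer_near_le.
Qed.

(** The core estimate.  Integrating the pointwise bound by local means against
    [w], the mean over the hyperbolic neighbourhood of size [near_radius m n]
    costs a factor geometric in [n], by the growth of invariant weights; the
    weights [t ^+ n] in [zeros_dyadic_le] make the sum converge, uniformly in the
    polynomial. *)
Lemma weighted_zeros_le (w : R[i] -> R) p p1 p2 : 0 < p -> 0 < p1 -> 0 < p2 ->
  p / p1 + p / p2 = 1 -> invariant_weight w ->
  exists2 C, 0 < C & forall L cs, 0 < L ->
    (\int[dA R]_(a in @rdisc R) ((p / p1 * mean_factor (p / p1) p1 (zeros_in cs) (cplx a) +
        p / p2 * mean_factor (p / p2) p2 (zeros_in cs) (cplx a)) *
        outer L cs (cplx a) `^ p * w (cplx a))%:E <=
     C%:E * \int[dA R]_(u in @rdisc R) (zeros_modulus L cs (cplx u) `^ p * w (cplx u))%:E)%E.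
Proof.
move=> p0 p10 p20 s1 iw; have [D D1 wD] := invariant_growth iw.
have [[w0 wint] _] := iw.
have mw := measurable_weight iw.1.
have sp1 : 0 <= p / p1 by rewrite divr_ge0 ?(ltW p0) ?(ltW p10).
have sp2 : 0 <= p / p2 by rewrite divr_ge0 ?(ltW p0) ?(ltW p20).
have s1le : p / p1 <= 1 by rewrite -s1 lerDl.
have s2le : p / p2 <= 1 by rewrite -s1 lerDr.
pose m := p1 + p2 + 1.
have m1 : 1 <= m by rewrite /m lerDr addr_ge0// ltW.
have m0 : 0 < m by apply: lt_le_trans m1.
have D0 : 0 < D by apply: lt_le_trans D1.
have h0 : 0 <= 2^-1 :> R by rewrite invr_ge0.
have h1 : 2^-1 < 1 :> R by rewrite invf_lt1// ltr1n.
have [|n0 hn0] := cvg_pow_lt h0 h1 (e := (9 * m)^-1); first by rewrite invr_gt0 mulr_gt0.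
(* The six factors [(near_radius m n)^-1] contribute [64 ^+ n] and the weight [D ^+ n];
   with this [t] a factor [2 ^- n] is left. *)
pose t := (64 * D)^-1.
have t0 : 0 < t by rewrite invr_gt0 mulr_gt0.
have t1 : t <= 1 by rewrite invf_le1 ?mulr_gt0// (le_trans D1)// ler_peMl ?(ltW D0)// ler1n.
pose E := expR 1 * t^-1 * pi * (18 * m) ^+ 6 * 512 * D ^+ n0.+2.
have E0 : 0 < E.
  apply: mulr_gt0; last exact: exprn_gt0.
  apply: mulr_gt0; last exact: ltr0Sn.
  apply: mulr_gt0; last by apply: exprn_gt0; apply: mulr_gt0 => //; exact: ltr0Sn.
  apply: mulr_gt0; last exact: pi_gt0.
  by apply: mulr_gt0; [exact: expR_gt0|rewrite invr_gt0].
have kw n a u : disc a -> disc u -> near_radius m n <= hk a u -> w a <= D ^+ (n.+1 + n0).+1 * w u.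
  move=> da du h; apply: wD; [exact: da|exact: du|apply: le_trans h].
  by rewrite -exprVn addnC exprD /near_radius ler_wpM2r ?exprn_ge0.
have iE n : expR 1 * t^-2 * (2^-1 ^+ n * t ^+ n.+1) * (pi * (near_radius m n)^-1 ^+ 2) *
    (512 * (near_radius m n)^-1 ^+ 4 * D ^+ (n.+1 + n0).+1) = E * 2^-1 ^+ n.
  exact: weighted_zeros_const.
exists (E * 2); first by rewrite mulr_gt0.
move=> L cs L0.
have [K hK] := mean_integrand_le w p0 p10 p20 s1 t0 t1 cs L0.
rewrite -/m in hK.
pose J := (\int[dA R]_(u in @rdisc R) (zeros_modulus L cs (cplx u) `^ p * w (cplx u))%:E)%E.
rewrite -/J.
have J0 : (0 <= J)%E.
  by apply: integral_ge0 => u du; rewrite lee_fin; apply: mulr_ge0; [exact: powR_ge0|exact: ltW (w0 _ du)].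
have Dn0 n : 0 <= D ^+ n by apply: exprn_ge0; exact: ltW.
have k0 n : 0 < near_radius m n by exact: near_radius_gt0.
have mz : measurable_fun (@rdisc R) (fun u : lplane => zeros_modulus L cs (cplx u) `^ p).
  by apply: measurable_zeros_modulus; [exact: measurable_rdisc|exact: ltW].
have hd n := @double_integral_le R w (fun u => zeros_modulus L cs u `^ p) (near_radius m n) _
  (k0 n) (Dn0 _) (conj w0 wint) (kw n) (fun u => powR_ge0 _ _) mz.
clear wint D1 wD kw Dn0 h0 h1 hn0 mz iw.
pose b n := expR 1 * t^-2 * (2^-1 ^+ n * t ^+ n.+1) * (pi * (near_radius m n)^-1 ^+ 2).
have b0 n : 0 <= b n.
  apply: mulr_ge0.
    apply: mulr_ge0; last by apply: mulr_ge0; apply: exprn_ge0; [rewrite invr_ge0|exact: ltW].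
    by apply: mulr_ge0; [exact: expR_ge0|rewrite invr_ge0 exprn_ge0// ltW].
  by apply: mulr_ge0; [exact: pi_ge0|rewrite exprn_ge0// invr_ge0; exact: ltW].
pose F n (a : lplane) := ((w (cplx a) * boundary_weight (cplx a))%:E *
  \int[dA R]_(u in near_set (near_radius m n) (cplx a)) (zeros_modulus L cs (cplx u) `^ p)%:E)%E.
have F0 n (a : lplane) : rdisc a -> (0 <= F n a)%E.
  move=> da; apply: mule_ge0.
    by rewrite lee_fin; apply: mulr_ge0; [exact: ltW (w0 _ da)|exact: powR_ge0].
  by apply: integral_ge0 => u _; rewrite lee_fin; exact: powR_ge0.
have mF n : measurable_fun (@rdisc R) (F n) by exact: measurable_near_term mw (ltW L0).
apply: (@le_trans _ _ (\int[dA R]_(a in @rdisc R) (\sum_(n < K.+1) ((b n)%:E * F n a)))%E).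
  apply: ge0_le_integral.
  - exact: measurable_rdisc.
  - move=> a da; rewrite lee_fin; apply: mulr_ge0; last exact: ltW (w0 _ da).
    apply: mulr_ge0; last exact: powR_ge0.
    by apply: addr_ge0; (apply: mulr_ge0; [|apply: mean_factor_ge0]).
  - exact: measurable_mean_integrand.
  - by apply: emeasurable_sum => n; apply: measurable_funeM; exact: mF.
  - by move=> a da; apply: hK; [exact: da|exact: ltW (w0 _ da)].
rewrite ge0_integral_sum; first last.
- by move=> n a da; apply: mule_ge0; [rewrite lee_fin|exact: F0].
- by move=> n; apply: measurable_funeM; exact: mF.
- exact: measurable_rdisc.
apply: (@le_trans _ _ (\sum_(n < K.+1) (E * 2^-1 ^+ n)%:E * J)%E).
  apply: lee_sum => n _; rewrite ge0_integralZl; first last.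
  - by rewrite lee_fin.
  - exact: F0.
  - exact: mF.
  - exact: measurable_rdisc.
  have -> : ((E * 2^-1 ^+ n)%:E * J = (b n)%:E * ((512 * (near_radius m n)^-1 ^+ 4 * D ^+ (n.+1 + n0).+1)%:E * J))%E.
    by rewrite muleA -EFinM -iE.
  apply: lee_wpmul2l; first by rewrite lee_fin.
  exact: hd.
rewrite -ge0_sume_distrl; last first.
  by move=> n _; rewrite lee_fin; apply: mulr_ge0; [exact: ltW|rewrite exprn_ge0 ?invr_ge0].
apply: lee_wpmul2r; first exact: J0.
rewrite sumEFin lee_fin -mulr_sumr; apply: ler_wpM2l; first exact: ltW.
exact: geometric_half_le.
Qed.

End WeightedZeros.

(** * Approximate factorizations into polynomials *)

Section Splitting.
Variable R : realType.
Local Notation lplane := (lebesgue_plane R).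
Implicit Types (a u z c l v : R[i]) (r e L s : R) (cs zs : seq R[i]) (A B : R[i] -> R) (P : R[i] -> R[i]).

(** [P] is, locally uniformly in the disc, a limit of products of two polynomials
    whose moduli tend to [A] and [B]. *)
Definition splits A B P : Prop :=
  forall r e, r < 1 -> 0 < e -> exists q1 q2 : {poly R[i]}, forall z, cmod z <= r ->
    [/\ `|cmod q1.[z] - A z| <= e, `|cmod q2.[z] - B z| <= e & cmod (q1.[z] * q2.[z] - P z) <= e].

Lemma cmod_mul_dist (x y x' y' : R[i]) d b : d <= 1 -> 0 <= b ->
  cmod (x - x') <= d -> cmod (y - y') <= d -> cmod x' <= b -> cmod y' <= b ->
  cmod (x * y - x' * y') <= d * (2 * b + 1).
Proof.
move=> d1 b0 hx hy hx' hy'; have d0 : 0 <= d by exact: le_trans (cmod_ge0 _) hx.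
have -> : x * y - x' * y' = (x - x') * (y - y') + ((x - x') * y' + x' * (y - y')) by ring.
apply: (le_trans (cmodD _ _)).
have -> : d * (2 * b + 1) = d * 1 + (d * b + b * d) by ring.
apply: lerD; first by rewrite cmodM ler_pM ?cmod_ge0// (le_trans hy).
by apply: (le_trans (cmodD _ _)); rewrite !cmodM; apply: lerD; rewrite ler_pM ?cmod_ge0.
Qed.

Lemma norm_mul_dist (x y x' y' d b : R) : d <= 1 -> 0 <= b ->
  `|x - x'| <= d -> `|y - y'| <= d -> `|x'| <= b -> `|y'| <= b ->
  `|x * y - x' * y'| <= d * (2 * b + 1).
Proof.
move=> d1 b0; rewrite -!(@cmod_real R) !rmorphB !rmorphM; exact: cmod_mul_dist.
Qed.

Lemma splits_bounded A B P r : splits A B P -> r < 1 -> exists2 M, 0 <= M &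
  forall z, cmod z <= r -> [/\ `|A z| <= M, `|B z| <= M & cmod (P z) <= M].
Proof.
move=> h r1; have [q1 [q2 hq]] := h r 1 r1 ltr01.
have [M1 M10 hM1] := bounded_poly q1 r; have [M2 M20 hM2] := bounded_poly q2 r.
have [M3 M30 hM3] := bounded_poly (q1 * q2) r.
exists (1 + M1 + M2 + M3); first by rewrite !addr_ge0.
move=> z zr; have [h1 h2 h3] := hq z zr.
have := hM1 z zr; have := hM2 z zr; have := hM3 z zr; rewrite hornerM => e3 e2 e1.
split.
- have := ler_normB (cmod q1.[z]) (cmod q1.[z] - A z).
  rewrite opprB addrCA subrr addr0 [X in _ <= X + _]ger0_norm ?cmod_ge0// => h4; lra.
- have := ler_normB (cmod q2.[z]) (cmod q2.[z] - B z).
  rewrite opprB addrCA subrr addr0 [X in _ <= X + _]ger0_norm ?cmod_ge0// => h4; lra.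
- have := cmodD (q1.[z] * q2.[z]) (- (q1.[z] * q2.[z] - P z)).
  by rewrite cmodN opprB addrCA subrr addr0 => h4; lra.
Qed.

Lemma splits_mul A B P A' B' P' : splits A B P -> splits A' B' P' ->
  splits (fun z => A z * A' z) (fun z => B z * B' z) (fun z => P z * P' z).
Proof.
move=> h h' r e r1 e0.
have [M M0 hM] := splits_bounded h r1; have [M' M'0 hM'] := splits_bounded h' r1.
pose b := M + M'; have b0 : 0 <= b by rewrite addr_ge0.
have [Mb M'b] : M <= b /\ M' <= b by rewrite /b; split; lra.
pose d := Num.min 1 (e / (2 * b + 1)).
have b1 : 0 < 2 * b + 1 by rewrite ltr_wpDl// mulr_ge0.
have d0 : 0 < d by rewrite lt_min ltr01 divr_gt0.
have d1 : d <= 1 by rewrite ge_min lexx.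
have db : d * (2 * b + 1) <= e by rewrite -ler_pdivlMr// ge_min lexx orbT.
have [q1 [q2 hq]] := h r d r1 d0; have [q1' [q2' hq']] := h' r d r1 d0.
exists (q1 * q1'), (q2 * q2') => z zr.
have [h1 h2 h3] := hq z zr; have [h1' h2' h3'] := hq' z zr.
have [m1 m2 m3] := hM z zr; have [m1' m2' m3'] := hM' z zr.
rewrite !hornerM !cmodM; split; apply: le_trans db.
- by apply: norm_mul_dist => //; [exact: le_trans Mb|exact: le_trans M'b].
- by apply: norm_mul_dist => //; [exact: le_trans Mb|exact: le_trans M'b].
- rewrite mulrACA; apply: cmod_mul_dist => //; [exact: le_trans Mb|exact: le_trans M'b].
Qed.

Lemma splits_swap A B P : splits A B P -> splits B A P.
Proof.
move=> h r e r1 e0; have [q1 [q2 hq]] := h r e r1 e0.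
by exists q2, q1 => z zr; have [h1 h2 h3] := hq z zr; split; rewrite // mulrC.
Qed.

Lemma splits_ext A B P A' B' P' : splits A B P ->
  (forall z, disc z -> A z = A' z) -> (forall z, disc z -> B z = B' z) ->
  (forall z, disc z -> P z = P' z) -> splits A' B' P'.
Proof.
move=> h hA hB hP r e r1 e0; have [q1 [q2 hq]] := h r e r1 e0.
exists q1, q2 => z zr; have dz : disc z by exact: le_lt_trans r1.
by rewrite -hA// -hB// -hP//; exact: hq.
Qed.

Lemma splits_prod (I : eqType) (t : seq I) (A B : I -> R[i] -> R) (P : I -> R[i] -> R[i]) :
  (forall i, i \in t -> splits (A i) (B i) (P i)) ->
  splits (fun z => \prod_(i <- t) A i z) (fun z => \prod_(i <- t) B i z) (fun z => \prod_(i <- t) P i z).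
Proof.
elim: t => [|i t IH] h.
  move=> r e r1 e0; exists 1, 1 => z _; rewrite !big_nil hornerE cmod1 mulr1 !subrr normr0 cmod0.
  by split; exact: ltW.
have h1 := h i (mem_head _ _).
have h2 := IH (fun j jt => h j (@mem_behead _ (i :: t) j jt)).
by apply: splits_ext (splits_mul h1 h2) _ _ _ => z _; rewrite big_cons.
Qed.

Lemma splits_poly (q : {poly R[i]}) : splits (fun z => cmod q.[z]) (fun=> 1) (horner q).
Proof.
move=> r e r1 e0; exists q, 1 => z _; rewrite hornerE cmod1 mulr1 !subrr normr0 cmod0.
by split; exact: ltW.
Qed.

Lemma splits_const l s : l != 0 -> splits (fun=> cmod l `^ s) (fun=> cmod l `^ (1 - s)) (fun=> l).
Proof.
move=> l0 r e r1 e0; have cl : 0 < cmod l by rewrite cmod_gt0.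
have k0 : 0 < cmod l `^ s by exact: powR_gt0.
pose k := (cmod l `^ s)%:C; have ck : cmod k = cmod l `^ s by rewrite cmod_real ger0_norm ?(ltW k0).
have kn0 : k != 0 by rewrite -cmod_gt0 ck.
exists k%:P, (l / k)%:P => z _; rewrite !hornerC cmodM cmodV ck [k * _]mulrC divfK// !subrr cmod0 normr0.
rewrite powRD ?(gt_eqF cl) ?implybT// powRr1 ?(ltW cl)// powRN subrr normr0.
by split; exact: ltW.
Qed.

Lemma horner_scaled (q : {poly R[i]}) v z : (q \Po (v *: 'X)).[z] = q.[v * z].
Proof. by rewrite horner_comp hornerZ hornerX. Qed.

Lemma splits_binpoly s t v (q : {poly R[i]}) : -1 <= s <= 1 -> -1 <= t <= 1 -> -1 <= s + t <= 1 ->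
  cmod v <= 1 -> (forall n, (1 < n)%N -> binpoly (s + t) n = q) ->
  splits (fun z => cmod (1 - v * z) `^ s) (fun z => cmod (1 - v * z) `^ t) (fun z => q.[v * z]).
Proof.
move=> i1 i2 i3 v1 hq r e r1 e0.
have [N1 h1] := binpoly_cvg i1 r1 e0; have [N2 h2] := binpoly_cvg i2 r1 e0.
have [N3 h3] := binpoly_mul i1 i2 i3 r1 e0.
pose n := (N1 + N2 + N3 + 2)%N.
exists (binpoly s n \Po (v *: 'X)), (binpoly t n \Po (v *: 'X)) => z zr.
have vz : cmod (v * z) <= r by rewrite cmodM (le_trans _ zr)// ler_piMl ?cmod_ge0.
rewrite !horner_scaled; split.
- by apply: h1 => //; rewrite /n -!addnA leq_addr.
- by apply: h2 => //; rewrite /n -!addnA addnCA leq_addr.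
- have := h3 n _ (v * z) vz; rewrite hq; last by rewrite /n addn2.
  by apply; rewrite /n -addnA addnC -!addnA leq_addr.
Qed.

Lemma splits_binomial s v : 0 <= s <= 1 -> cmod v <= 1 ->
  splits (fun z => cmod (1 - v * z) `^ s) (fun z => cmod (1 - v * z) `^ (1 - s)) (fun z => 1 - v * z).
Proof.
move=> /andP[s0 s1] v1; have e1 : s + (1 - s) = 1 by ring.
have h : splits (fun z => cmod (1 - v * z) `^ s) (fun z => cmod (1 - v * z) `^ (1 - s))
    (fun z => (1 - 'X : {poly R[i]}).[v * z]).
  apply: splits_binpoly => //; rewrite ?e1; try by apply/andP; split; lra.
  by move=> n n1; rewrite binpoly1.
by apply: splits_ext h _ _ _ => z _ //; rewrite !hornerE.
Qed.

Lemma splits_inverse s v : 0 <= s <= 1 -> cmod v <= 1 ->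
  splits (fun z => cmod (1 - v * z) `^ (- s)) (fun z => cmod (1 - v * z) `^ s) (fun z => 1).
Proof.
move=> /andP[s0 s1] v1; have e0 : - s + s = 0 by ring.
have h : splits (fun z => cmod (1 - v * z) `^ (- s)) (fun z => cmod (1 - v * z) `^ s)
    (fun z => (1 : {poly R[i]}).[v * z]).
  apply: splits_binpoly => //; rewrite ?e0; try by apply/andP; split; lra.
  by move=> n n1; rewrite binpoly0// ltnW.
by apply: splits_ext h _ _ _ => z _ //; rewrite hornerE.
Qed.

(** A zero outside the disc is shared by the two factors. *)
Lemma splits_zero_out s c : 0 <= s <= 1 -> 1 <= cmod c ->
  splits (fun z => cmod (z - c) `^ s) (fun z => cmod (z - c) `^ (1 - s)) (fun z => z - c).
Proof.
move=> s01 c1; have cc : 0 < cmod c by exact: lt_le_trans c1.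
have c0 : c != 0 by rewrite -cmod_gt0.
have v1 : cmod c^-1 <= 1 by rewrite cmodV invf_le1.
have nc0 : - c != 0 by rewrite oppr_eq0.
have e z : z - c = - c * (1 - c^-1 * z) by field.
by apply: splits_ext (splits_mul (splits_const s nc0) (splits_binomial s01 v1)) _ _ _ => z _;
  rewrite -?powRM ?cmod_ge0// -?cmodM -e.
Qed.

(** The linear factor is multiplied by [(1 - c^* z)^(s - 1)] in the first
    factor, and the second factor receives the inverse power. *)
Lemma splits_zero_in s c : 0 <= s <= 1 -> disc c ->
  splits (fun z => cmod (1 - c^*%R * z) `^ s * cmod (mobius c z)) (fun z => cmod (1 - c^*%R * z) `^ (1 - s))
    (fun z => z - c).
Proof.
move=> /andP[s0 s1] dc; have v1 : cmod c^*%R <= 1 by rewrite cmodJ ltW.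
have s01 : 0 <= 1 - s <= 1 by apply/andP; split; lra.
apply: splits_ext (splits_mul (splits_poly ('X - c%:P)) (splits_inverse s01 v1)) _ _ _ => z dz.
- have d0 : 0 < cmod (1 - c^*%R * z) by exact: disc_cross.
  rewrite hornerXsubC opprB powRD ?(gt_eqF d0) ?implybT// powRN powRr1 ?(ltW d0)//.
  by rewrite /mobius cmodM cmodV [cmod (c - z)]cmodB mulrCA.
- by rewrite mul1r.
- by rewrite hornerXsubC mulr1.
Qed.

(** The modulus of a factor: a power of the outer part and the Blaschke factors
    of the zeros [zs] that were assigned to it. *)
Definition half_factor s zs L cs z : R :=
  outer L cs z `^ s * \prod_(c <- zs) cmod (mobius c z).

Lemma outer_powR L cs s z : 0 <= L -> outer L cs z `^ s =
  L `^ s * (\prod_(c <- zeros_out cs) cmod (z - c) `^ s * \prod_(c <- zeros_in cs) cmod (1 - c^*%R * z) `^ s).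
Proof.
move=> L0; have h t (f : R[i] -> R) : (forall c, 0 <= f c) -> 0 <= \prod_(c <- t) f c by move=> f0; apply: prodr_ge0.
rewrite /outer -mulrA !powRM ?mulr_ge0 ?h// => *; rewrite ?cmod_ge0//.
by rewrite -!prod_powR// => *; rewrite cmod_ge0.
Qed.

Lemma splits_zeros l cs zs1 zs2 s1 s2 : l != 0 -> 0 <= s1 -> 0 <= s2 -> s1 + s2 = 1 ->
  perm_eq (zs1 ++ zs2) (zeros_in cs) ->
  splits (half_factor s1 zs1 (cmod l) cs) (half_factor s2 zs2 (cmod l) cs)
    (fun z => l * \prod_(c <- cs) (z - c)).
Proof.
move=> l0 s10 s20 s12 pz.
have i1 : 0 <= s1 <= 1 by apply/andP; split; lra.
have i2 : 0 <= s2 <= 1 by apply/andP; split; lra.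
have e2 : 1 - s1 = s2 by lra.
have e1 : 1 - s2 = s1 by lra.
have din c : c \in zs1 ++ zs2 -> disc c by rewrite (perm_mem pz) => /zeros_inP.
have hl := splits_const s1 l0.
have ho : splits (fun z => \prod_(c <- zeros_out cs) cmod (z - c) `^ s1)
    (fun z => \prod_(c <- zeros_out cs) cmod (z - c) `^ s2) (fun z => \prod_(c <- zeros_out cs) (z - c)).
  apply: (@splits_prod _ _ (fun c z => cmod (z - c) `^ s1) (fun c z => cmod (z - c) `^ s2) (fun c z => z - c)).
  by move=> c; rewrite mem_filter -leNgt => /andP[c1 _]; rewrite -e2; exact: splits_zero_out.
have h1 : splits (fun z => \prod_(c <- zs1) (cmod (1 - c^*%R * z) `^ s1 * cmod (mobius c z)))
    (fun z => \prod_(c <- zs1) cmod (1 - c^*%R * z) `^ s2) (fun z => \prod_(c <- zs1) (z - c)).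
  apply: (@splits_prod _ _ (fun c z => cmod (1 - c^*%R * z) `^ s1 * cmod (mobius c z)) (fun c z => cmod (1 - c^*%R * z) `^ s2) (fun c z => z - c)).
  by move=> c cz; rewrite -e2; apply: splits_zero_in => //; apply: din; rewrite mem_cat cz.
have h2 : splits (fun z => \prod_(c <- zs2) cmod (1 - c^*%R * z) `^ s1)
    (fun z => \prod_(c <- zs2) (cmod (1 - c^*%R * z) `^ s2 * cmod (mobius c z))) (fun z => \prod_(c <- zs2) (z - c)).
  apply: splits_swap.
  apply: (@splits_prod _ _ (fun c z => cmod (1 - c^*%R * z) `^ s2 * cmod (mobius c z)) (fun c z => cmod (1 - c^*%R * z) `^ s1) (fun c z => z - c)).
  by move=> c cz; rewrite -e1; apply: splits_zero_in => //; apply: din; rewrite mem_cat cz orbT.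
have pin (f : R[i] -> R) : \prod_(c <- zeros_in cs) f c = \prod_(c <- zs1) f c * \prod_(c <- zs2) f c.
  by rewrite -big_cat; apply: perm_big; rewrite perm_sym.
apply: splits_ext (splits_mul hl (splits_mul ho (splits_mul h1 h2))) _ _ _ => z dz.
- rewrite /half_factor outer_powR ?cmod_ge0// pin big_split/=; ring.
- rewrite /half_factor e2 outer_powR ?cmod_ge0// pin big_split/=; ring.
- congr (l * _); rewrite -big_cat (perm_big _ pz) /zeros_in /zeros_out !big_filter.
  by rewrite [RHS](bigID (fun c => cmod c < 1))/= mulrC.
Qed.

End Splitting.

(** * Distribution of the zeros *)

Section ChooseZeros.
Variable R : realType.
Local Notation lplane := (lebesgue_plane R).
Local Open Scope ereal_scope.

Lemma convex_comb_min (s1 s2 : R) (x y B : \bar R) : (0 <= s1)%R -> (0 <= s2)%R ->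
  (s1 + s2 = 1)%R -> s1%:E * x + s2%:E * y <= B -> x <= B \/ y <= B.
Proof.
move=> s10 s20 s12 h.
have e z : z = s1%:E * z + s2%:E * z by rewrite -ge0_muleDl ?lee_fin// -EFinD s12 mul1e.
have [xy|yx] := leP x y; [left|right]; apply: le_trans h.
  by rewrite [leLHS]e; apply: leeD => //; apply: lee_wpmul2l; rewrite ?lee_fin.
by rewrite [leLHS]e; apply: leeD => //; apply: lee_wpmul2l; rewrite ?lee_fin// ltW.
Qed.

(** The zeros in the disc are distributed between the two factors one after the
    other: the integral with the factors [s2 + s1 * x `^ q1] and
    [s1 + s2 * x `^ q2] of a zero is a convex combination of the integrals for its
    two possible assignments. *)
Lemma choose_zeros (zs : seq R[i]) (s1 s2 q1 q2 : R) (B : \bar R) (U1 U2 : lplane -> R) :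
  (0 <= s1)%R -> (0 <= s2)%R -> (s1 + s2 = 1)%R ->
  measurable_fun (@rdisc R) U1 -> measurable_fun (@rdisc R) U2 ->
  (forall a, rdisc a -> (0 <= U1 a)%R) -> (forall a, rdisc a -> (0 <= U2 a)%R) ->
  \int[dA R]_(a in @rdisc R) (s1 * (mean_factor s1 q1 zs (cplx a) * U1 a) +
     s2 * (mean_factor s2 q2 zs (cplx a) * U2 a))%:E <= B ->
  exists zs1 zs2, perm_eq (zs1 ++ zs2) zs /\
  \int[dA R]_(a in @rdisc R) (s1 * (\prod_(c <- zs1) cmod (mobius c (cplx a)) `^ q1 * U1 a) +
     s2 * (\prod_(c <- zs2) cmod (mobius c (cplx a)) `^ q2 * U2 a))%:E <= B.
Proof.
move=> s10 s20 s12; elim: zs U1 U2 => [|c zs IH] U1 U2 mU1 mU2 U10 U20 h.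
  exists [::], [::]; split => //; apply: le_trans h.
  rewrite le_eqVlt; apply/orP; left; apply/eqP; apply: eq_integral => a _.
  by rewrite /mean_factor !big_nil.
pose X q (a : lplane) := (cmod (mobius c (cplx a)) `^ q)%R.
have mX q : measurable_fun (@rdisc R) (X q).
  by apply: measurable_powR_fun; exact: measurable_mobius_modulus.
have X0 q a : (0 <= X q a)%R by exact: powR_ge0.
pose I (V1 V2 : lplane -> R) (a : lplane) := (s1 * (mean_factor s1 q1 zs (cplx a) * V1 a) +
     s2 * (mean_factor s2 q2 zs (cplx a) * V2 a))%R.
have s11 : (s1 <= 1)%R by rewrite -s12 lerDl.
have s21 : (s2 <= 1)%R by rewrite -s12 lerDr.
have I0 V1 V2 : (forall a, rdisc a -> (0 <= V1 a)%R) -> (forall a, rdisc a -> (0 <= V2 a)%R) ->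
    forall a, rdisc a -> 0 <= (I V1 V2 a)%:E.
  move=> h1 h2 a da; rewrite lee_fin; apply: addr_ge0; (apply: mulr_ge0; [by []|]);
    by apply: mulr_ge0; [exact: mean_factor_ge0|auto].
have mI V1 V2 : measurable_fun (@rdisc R) V1 -> measurable_fun (@rdisc R) V2 ->
    measurable_fun (@rdisc R) (fun a => (I V1 V2 a)%:E).
  move=> m1 m2; apply/measurable_EFinP; apply: measurable_funD;
    (apply: measurable_funM; [exact: measurable_cst|]);
    by apply: measurable_funM; [exact: measurable_mean_factor|].
pose W1 (a : lplane) := (X q1 a * U1 a)%R; pose W2 (a : lplane) := (X q2 a * U2 a)%R.
have mW1 : measurable_fun (@rdisc R) W1 by apply: measurable_funM; [exact: mX|exact: mU1].
have mW2 : measurable_fun (@rdisc R) W2 by apply: measurable_funM; [exact: mX|exact: mU2].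
have W10 a : rdisc a -> (0 <= W1 a)%R by move=> da; apply: mulr_ge0; auto.
have W20 a : rdisc a -> (0 <= W2 a)%R by move=> da; apply: mulr_ge0; auto.
have E : \int[dA R]_(a in @rdisc R) (s1 * (mean_factor s1 q1 (c :: zs) (cplx a) * U1 a) +
     s2 * (mean_factor s2 q2 (c :: zs) (cplx a) * U2 a))%:E =
  s1%:E * \int[dA R]_(a in @rdisc R) (I W1 U2 a)%:E + s2%:E * \int[dA R]_(a in @rdisc R) (I U1 W2 a)%:E.
  have mD := @measurable_rdisc R.
  rewrite -(ge0_integralZl (dA R) mD (mI _ _ mW1 mU2)); [|exact: I0|by rewrite lee_fin].
  rewrite -(ge0_integralZl (dA R) mD (mI _ _ mU1 mW2)); [|exact: I0|by rewrite lee_fin].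
  rewrite -ge0_integralD; first last.
  - by apply: measurable_funeM; exact: mI.
  - by move=> a da; apply: mule_ge0; [rewrite lee_fin|exact: I0].
  - by apply: measurable_funeM; exact: mI.
  - by move=> a da; apply: mule_ge0; [rewrite lee_fin|exact: I0].
  - exact: mD.
  apply: eq_integral => a _; rewrite -!EFinM -EFinD; congr (_%:E).
  rewrite /I /W1 /W2 /X /mean_factor !big_cons.
  have -> : (1 - s1 = s2)%R by rewrite -s12; ring.
  have -> : (1 - s2 = s1)%R by rewrite -s12; ring.
  by ring.
rewrite E in h.
have [h1|h1] := convex_comb_min s10 s20 s12 h.
- have [zs1 [zs2 [pz hz]]] := IH W1 U2 mW1 mU2 W10 U20 h1.
  exists (c :: zs1), zs2; split; first by rewrite cat_cons perm_cons.
  apply: le_trans hz; rewrite le_eqVlt; apply/orP; left; apply/eqP; apply: eq_integral => a _.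
  by rewrite /W1 /X big_cons; congr (_%:E); ring.
- have [zs1 [zs2 [pz hz]]] := IH U1 W2 mU1 mW2 U10 W20 h1.
  exists zs1, (c :: zs2); split; first by rewrite -[c :: zs2]cat1s perm_catCA /= perm_cons.
  apply: le_trans hz; rewrite le_eqVlt; apply/orP; left; apply/eqP; apply: eq_integral => a _.
  by rewrite /W2 /X big_cons; congr (_%:E); ring.
Qed.

End ChooseZeros.

(** * Measurability of analytic functions *)

Section ContinuousMeasurable.
Variable R : realType.
Local Notation borelR := (measurableTypeR R).
Local Notation plane := (borelR * borelR)%type.
Local Notation lplane := (lebesgue_plane R).

(** Open sets of the plane are countable unions of discs with rational centres
    and radii. *)
Lemma measurable_open_plane (O : set plane) :
  (forall u, O u -> exists2 e : R, 0 < e & eball (cplx u) e `<=` O) -> measurable O.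
Proof.
move=> hO.
pose B (q1 q2 q3 : rat) : set plane := [set u | eball (cplx (ratr q1 : R, ratr q2 : R)) (ratr q3) u /\
  eball (cplx (ratr q1 : R, ratr q2 : R)) (ratr q3) `<=` O].
have mB q1 q2 q3 : measurable (B q1 q2 q3).
  have [h|h] := pselect (eball (cplx (ratr q1 : R, ratr q2 : R)) (ratr q3) `<=` O).
    rewrite (_ : B q1 q2 q3 = eball (cplx (ratr q1 : R, ratr q2 : R)) (ratr q3)); first exact: measurable_eball.
    by apply/seteqP; split => [u []//|u hu]; split.
  rewrite (_ : B q1 q2 q3 = set0); first exact: measurable0.
  by apply/seteqP; split => [u []//|u []].
have -> : O = \bigcup_q1 \bigcup_q2 \bigcup_q3 B q1 q2 q3.
  apply/seteqP; split; last first.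
    by move=> u [q1 _ [q2 _ [q3 _ [hu h]]]]; exact: h.
  move=> u Ou; have [e e0 he] := hO u Ou.
  have ex x : x < x + e / 8 by rewrite ltrDl divr_gt0.
  have [q1 /[!in_itv]/= /andP[a1 b1]] := rat_in_itvoo (ex u.1).
  have [q2 /[!in_itv]/= /andP[a2 b2]] := rat_in_itvoo (ex u.2).
  have e42 : e / 4 < e / 2 by lra.
  have [q3 /[!in_itv]/= /andP[a3 b3]] := rat_in_itvoo e42.
  pose c : R[i] := cplx (ratr q1 : R, ratr q2 : R).
  have cu : cmod (cplx u - c) < e / 4.
    apply: le_lt_trans (cmod_ReIm _) _; rewrite /c /cplx /=.
    rewrite -[`|_ - ratr q1|]normrN -[`|_ - ratr q2|]normrN !opprB !ger0_norm ?subr_ge0 ?(ltW a1) ?(ltW a2)//; lra.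
  exists q1 => //; exists q2 => //; exists q3 => //; split.
    by apply: lt_trans a3.
  move=> v hv; apply: he; rewrite /eball /mkset.
  have -> : cplx v - cplx u = (cplx v - c) - (cplx u - c) by ring.
  apply: le_lt_trans (cmodD _ _) _; rewrite cmodN.
  have {}hv : cmod (cplx v - c) < ratr q3 := hv.
  lra.
by apply: bigcupT_measurable_rat => q1; apply: bigcupT_measurable_rat => q2;
  apply: bigcupT_measurable_rat.
Qed.

Lemma measurable_continuous_disc (g : R[i] -> R) :
  (forall z e, disc z -> 0 < e -> exists2 d, 0 < d & forall u, cmod (u - z) <= d -> `|g u - g z| <= e) ->
  measurable_fun (@rdisc R) (fun u : lplane => g (cplx u)).
Proof.
move=> cg; apply: (measurability _ (RGenOInfty.measurableE R)).
move=> /= _ [_ [x ->] <-].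
apply: (@borel_lebesgue R (@rdisc R `&` (fun u : plane => g (cplx u)) @^-1` `]x, +oo[%classic)).
apply: measurable_open_plane => u [du]; rewrite /preimage/= in_itv/= andbT => gu.
have e0 : 0 < (g (cplx u) - x) / 2 by rewrite divr_gt0// subr_gt0.
have [d d0 hd] := cg _ _ du e0.
have du' : 0 < 1 - cmod (cplx u) by rewrite subr_gt0.
exists (Num.min d (1 - cmod (cplx u))); first by rewrite lt_min d0.
move=> v; rewrite /eball /mkset lt_min => /andP[h1 h2]; split.
  have h3 := cmodD (cplx v - cplx u) (cplx u); rewrite subrK in h3.
  by change (cmod (cplx v) < 1); lra.
rewrite /preimage/= in_itv/= andbT; have := hd _ (ltW h1); rewrite ler_norml => /andP[h3 _]; lra.
Qed.

Lemma analytic_cmeasurable (f : R[i] -> R[i]) : analytic_disc f ->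
  cmeasurable (@rdisc R) (fun u : lplane => f (cplx u)).
Proof.
move=> af; split.
  apply: (measurable_continuous_disc (g := fun z => complex.Re (f z))) => z e dz e0.
  have [d d0 hd] := derivable_continuous (af z dz) e0.
  exists d => // u hu; apply: le_trans (hd u hu); apply: le_trans (cmod_Re _).
  by case: (f u) (f z) => a b [a' b'].
apply: (measurable_continuous_disc (g := fun z => complex.Im (f z))) => z e dz e0.
have [d d0 hd] := derivable_continuous (af z dz) e0.
exists d => // u hu; apply: le_trans (hd u hu); apply: le_trans (cmod_Im _).
by case: (f u) (f z) => a b [a' b'].
Qed.

End ContinuousMeasurable.

(** * The factorization of polynomials *)

Section PolynomialFactors.
Variable R : realType.
Local Notation lplane := (lebesgue_plane R).
Implicit Types (a u z c l v : R[i]) (r e L s q : R) (cs zs : seq R[i]) (A B : R[i] -> R).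

(** Sub-mean value on the disc about [z] of half the distance to the circle. *)
Definition sub_mean A : Prop := forall z, disc z ->
  ((A z * (((1 - cmod z) / 2) ^+ 2 / pi))%:E <=
   \int[dA R]_(u in (eball z ((1 - cmod z) / 2) : set lplane)) (A (cplx u))%:E)%E.

Definition half_items s zs cs q : seq (R[i] * R[i] * R) :=
  [seq (c, 1, s * q) | c <- zeros_out cs] ++ [seq (1, c^*%R, s * q) | c <- zeros_in cs] ++
  [seq (c, 1, q) | c <- zs] ++ [seq (1, c^*%R, - q) | c <- zs].

Lemma half_factor_loglin s zs L cs q z : 0 <= L ->
  half_factor s zs L cs z `^ q = loglin ((L `^ s) `^ q) (half_items s zs cs q) z.
Proof.
move=> L0; have p0 (t : seq R[i]) (f : R[i] -> R) : (forall c, 0 <= f c) -> 0 <= \prod_(c <- t) f c by move=> f0; apply: prodr_ge0.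
rewrite /half_factor outer_powR// !powRM ?mulr_ge0 ?p0 ?powR_ge0// => *; rewrite ?powR_ge0 ?cmod_ge0//.
rewrite -!prod_powR; try by move=> i; rewrite ?powR_ge0 ?cmod_ge0.
rewrite /loglin /half_items !big_cat/= !big_map -!mulrA; congr (_ * (_ * _)).
- by apply: eq_bigr => c _; rewrite /= mul1r cmodB powRrM.
rewrite /=; congr (_ * _); first by apply: eq_bigr => c _; rewrite /= powRrM.
rewrite -big_split/=; apply: eq_bigr => c _.
by rewrite mul1r /mobius cmodM cmodV powRM ?invr_ge0 ?cmod_ge0// -powR_inv1 ?cmod_ge0// -powRrM mulN1r.
Qed.

(** The factors with negative exponent come from Blaschke factors of zeros in
    the disc, and have no zeros in the disc themselves. *)
Lemma half_factor_sub_mean s zs L cs q : 0 <= s -> 0 < q -> 0 <= L ->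
  (forall c, c \in zs -> disc c) -> sub_mean (fun z => half_factor s zs L cs z `^ q).
Proof.
move=> s0 q0 L0 dzs z dz; set r := (1 - cmod z) / 2.
have z1 : 0 < 1 - cmod z by rewrite subr_gt0.
have r0 : 0 < r by rewrite divr_gt0.
rewrite half_factor_loglin//; under eq_integral do rewrite half_factor_loglin//.
apply: loglin_submean => //; first exact: powR_ge0.
move=> i /mapP[j jin ->]; move: jin; rewrite !mem_cat => /or4P[] /mapP[c cc ->]; cbn [fst snd].
- by split; [rewrite oner_eq0 orbT|left; rewrite mulr_ge0 ?(ltW q0)].
- have dc := zeros_inP cc; have n0 : 1 - c^*%R * z != 0 by rewrite -cmod_gt0 disc_cross.
  by split; [rewrite n0|left; rewrite mulr_ge0 ?(ltW q0)].
- by split; [rewrite oner_eq0 orbT|left; exact: ltW].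
- have dc := dzs c cc; have n0 : 1 - c^*%R * z != 0 by rewrite -cmod_gt0 disc_cross.
  split; first by rewrite n0.
  right => h hr; have c1 : cmod c < 1 := dc.
  apply: (@le_lt_trans _ _ (cmod h)); first by rewrite cmodM cmodJ ler_piMl ?cmod_ge0// ltW.
  apply: (lt_trans hr); apply: (@lt_le_trans _ _ (1 - cmod z)); first by rewrite /r; lra.
  have := cmodD (1 - c^*%R * z) (c^*%R * z); rewrite subrK cmod1 cmodM cmodJ.
  have : cmod c * cmod z <= cmod z by rewrite ler_piMl ?cmod_ge0// ltW.
  by lra.
Qed.

Lemma half_factor_ge0 s zs L cs z : 0 <= half_factor s zs L cs z.
Proof. by rewrite mulr_ge0 ?powR_ge0// prodr_ge0// => c _; exact: cmod_ge0. Qed.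

(** The average over all distributions of the zeros is bounded by
    [weighted_zeros_le], so that [choose_zeros] finds one which is as good, and
    [splits_zeros] realizes its two moduli by polynomials. The zero polynomial
    is its own pair of factors. *)
Lemma poly_factors (w : R[i] -> R) p p1 p2 : 0 < p -> 0 < p1 -> 0 < p2 ->
  p / p1 + p / p2 = 1 -> invariant_weight w ->
  exists2 C, 0 < C & forall P : {poly R[i]}, exists A B,
    [/\ splits A B (horner P), (forall z, 0 <= A z) /\ (forall z, 0 <= B z),
      sub_mean (fun z => A z `^ p1), sub_mean (fun z => B z `^ p2) &
      [/\ measurable_fun (@rdisc R) (fun u : lplane => A (cplx u)),
          measurable_fun (@rdisc R) (fun u : lplane => B (cplx u)) &
      (\int[dA R]_(u in @rdisc R) ((p / p1 * A (cplx u) `^ p1 + p / p2 * B (cplx u) `^ p2) * w (cplx u))%:E <=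
       C%:E * \int[dA R]_(u in @rdisc R) (cmod P.[cplx u] `^ p * w (cplx u))%:E)%E]].
Proof.
move=> p0 p10 p20 s12 iw; have [C C0 hC] := weighted_zeros_le p0 p10 p20 s12 iw.
exists C => // P; have [P0|Pn0] := eqVneq P 0.
  exists (fun=> 0), (fun=> 0); split => //.
  - by move=> r e r1 e0; exists 0, 0 => z _; rewrite P0 !horner0 mulr0 cmod0 !subrr normr0 cmod0; split; exact: ltW.
  - move=> z _; rewrite powR0 ?lt0r_neq0// mul0r; apply: integral_ge0 => u _; exact: lexx.
  - move=> z _; rewrite powR0 ?lt0r_neq0// mul0r; apply: integral_ge0 => u _; exact: lexx.
  - split; [exact: measurable_cst|exact: measurable_cst|].
    rewrite integral0_eq; last by move=> u _; rewrite !powR0 ?lt0r_neq0// !mulr0 addr0 mul0r.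
    apply: mule_ge0; first by rewrite lee_fin ltW.
    apply: integral_ge0 => u du; rewrite lee_fin mulr_ge0 ?powR_ge0// ltW//.
    by have [[w0 _] _] := iw; exact: w0.
have [cs Pcs] := closed_field_poly_normal P.
set l := lead_coef P in Pcs; have l0 : l != 0 by rewrite lead_coef_eq0.
have L0 : 0 < cmod l by rewrite cmod_gt0.
have PE z : P.[z] = l * \prod_(c <- cs) (z - c).
  rewrite Pcs hornerZ horner_prod; congr (_ * _); apply: eq_bigr => c _; by rewrite hornerXsubC.
have cP z : cmod P.[z] = zeros_modulus (cmod l) cs z by rewrite PE cmodM cmod_prod.
have s10 : 0 <= p / p1 by rewrite divr_ge0 ?(ltW p0) ?(ltW p10).
have s20 : 0 <= p / p2 by rewrite divr_ge0 ?(ltW p0) ?(ltW p20).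
have mw := measurable_weight iw.1.
have [w0 _] := iw.1.
pose U (a : lplane) := outer (cmod l) cs (cplx a) `^ p * w (cplx a).
have mU : measurable_fun (@rdisc R) U.
  by apply: measurable_funM; [apply: measurable_powR_fun; exact: measurable_outer|exact: mw].
have U0 (a : lplane) : rdisc a -> 0 <= U a.
  by move=> da; apply: mulr_ge0; [exact: powR_ge0|exact: ltW (w0 _ da)].
have hI := hC (cmod l) cs L0.
have [] := @choose_zeros R (zeros_in cs) (p / p1) (p / p2) p1 p2
  (C%:E * \int[dA R]_(u in @rdisc R) (cmod P.[cplx u] `^ p * w (cplx u))%:E)%E U U s10 s20 s12 mU mU U0 U0.
  under [X in (_ <= _ * X)%E]eq_integral do rewrite cP.
  apply: le_trans hI; rewrite le_eqVlt; apply/orP; left; apply/eqP; apply: eq_integral => a _.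
  by rewrite /U; congr (_%:E); ring.
move=> zs1 [zs2 [pz hz]].
have mA s zs : measurable_fun (@rdisc R) (fun u : lplane => half_factor s zs (cmod l) cs (cplx u)).
  apply: measurable_funM; first by apply: measurable_powR_fun; exact: measurable_outer.
  by apply: measurable_fun_prods => c; exact: measurable_mobius_modulus.
have pin c : c \in zs1 ++ zs2 -> disc c by rewrite (perm_mem pz) => /zeros_inP.
exists (half_factor (p / p1) zs1 (cmod l) cs), (half_factor (p / p2) zs2 (cmod l) cs); split.
- by apply: splits_ext (splits_zeros l0 s10 s20 s12 pz) _ _ _ => z _; rewrite ?PE.
- by split=> z; exact: half_factor_ge0.
- by apply: half_factor_sub_mean => //; [exact: ltW|move=> c cz; apply: pin; rewrite mem_cat cz].
- by apply: half_factor_sub_mean => //; [exact: ltW|move=> c cz; apply: pin; rewrite mem_cat cz orbT].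
- split; [exact: mA|exact: mA|].
  apply: le_trans hz; rewrite le_eqVlt; apply/orP; left; apply/eqP; apply: eq_integral => a.
  rewrite inE => da; have o0 : 0 <= outer (cmod l) cs (cplx a) by exact: ltW (outer_gt0 cs L0 da).
  have hp q zs : 0 < q -> half_factor (p / q) zs (cmod l) cs (cplx a) `^ q =
      \prod_(c <- zs) cmod (mobius c (cplx a)) `^ q * outer (cmod l) cs (cplx a) `^ p.
    move=> q0; rewrite /half_factor powRM ?powR_ge0 ?prodr_ge0// => [|c _]; last exact: cmod_ge0.
    rewrite -powRrM divfK ?lt0r_neq0// mulrC prod_powR// => c; exact: cmod_ge0.
  by rewrite !hp// /U; congr (_%:E); ring.
Qed.

End PolynomialFactors.

(** * Limits of integrals and local bounds *)

Section LimitTools.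
Variable R : realType.
Local Notation lplane := (lebesgue_plane R).
Implicit Types (z : R[i]) (r e p : R) (A : R[i] -> R).

Lemma cvg_powR_seq (u : nat -> R) (l p : R) : 0 < p -> (forall n, 0 <= u n) ->
  u @ \oo --> l -> (u n `^ p) @[n --> \oo] --> l `^ p.
Proof.
move=> p0 u0 ul.
have l0 : 0 <= l.
  by rewrite -(cvg_lim _ ul)//; apply: limr_ge; [by apply/cvg_ex; exists l|exact: nearW].
have [l0'|ln0] := eqVneq l 0.
  rewrite l0' in ul *; rewrite powR0 ?lt0r_neq0//; apply/cvgrPdist_le => e e0.
  have ep : 0 < e `^ p^-1 by exact: powR_gt0.
  move/cvgrPdist_le : ul => /(_ _ ep); apply: filterS => n.
  rewrite !sub0r !normrN !ger0_norm ?powR_ge0// => h.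
  have -> : e = (e `^ p^-1) `^ p by rewrite -powRrM mulVf ?lt0r_neq0// powRr1// ltW.
  by apply: ge0_ler_powR; rewrite ?nnegrE ?(ltW p0) ?(ltW ep).
have lp : 0 < l by rewrite lt_neqAle eq_sym ln0.
have up : \forall n \near \oo, 0 < u n by exact: (cvgr_gt l ul).
have -> : l `^ p = expR (p * ln l) by rewrite -ln_powR lnK// posrE powR_gt0.
have : expR (p * ln (u n)) @[n --> \oo] --> expR (p * ln l).
  apply: continuous_cvg; first exact: continuous_expR.
  apply: cvgM; first exact: cvg_cst.
  by apply: continuous_cvg => //; exact: continuous_ln.
apply: cvg_trans; apply: near_eq_cvg; near=> n.
rewrite -ln_powR lnK// posrE powR_gt0//; near: n; exact: up.
Unshelve. all: by end_near. Qed.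

(** In this form a bound on the integrals of a tail of the sequence is enough. *)
Lemma fatou_le (F : nat -> lplane -> R) (g : lplane -> R) (c : \bar R) :
  (forall n, measurable_fun (@rdisc R) (F n)) -> (forall n u, rdisc u -> 0 <= F n u) ->
  (forall u, rdisc u -> F n u @[n --> \oo] --> g u) ->
  (forall n, \int[dA R]_(u in @rdisc R) (F n u)%:E <= c)%E ->
  (\int[dA R]_(u in @rdisc R) (g u)%:E <= c)%E.
Proof.
move=> mF F0 Fg Fc.
have mF' n : measurable_fun (@rdisc R) (fun u => (F n u)%:E) by exact/measurable_EFinP.
have F0' n u : rdisc u -> (0 <= (F n u)%:E)%E by move=> du; rewrite lee_fin; exact: F0.
have := @fatou _ lplane R (dA R) (@rdisc R) (@measurable_rdisc R) (fun n u => (F n u)%:E) mF' F0'.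
set I := (X in (X <= _)%E -> _).
have -> : I = (\int[dA R]_(u in @rdisc R) (g u)%:E)%E.
  apply: eq_integral => u; rewrite inE => du.
  have cv : (F n u)%:E @[n --> \oo] --> (g u)%:E by apply: cvg_EFin; [exact: nearW|exact: Fg].
  by rewrite (cvg_limn_einf_sup cv).
move=> h; apply: (le_trans h).
rewrite limn_einf_lim; apply: lime_le; first exact: is_cvg_einfs.
apply: nearW => n; rewrite /einfs; apply: le_trans (Fc n).
apply: ereal_inf_lbound; exists n => //=.
Qed.

(** Functions with the sub-mean value property and bounded weighted integral are
    locally bounded, since invariant weights are bounded below on compact sets. *)
Lemma sub_mean_bounded (w : R[i] -> R) : invariant_weight w -> forall r, r < 1 ->
  exists2 c, 0 <= c & forall A M, (forall z, 0 <= A z) -> sub_mean A ->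
    measurable_fun (@rdisc R) (fun u : lplane => A (cplx u)) ->
    (\int[dA R]_(u in @rdisc R) (A (cplx u) * w (cplx u))%:E <= M%:E)%E ->
    forall z, cmod z <= r -> A z <= c * M.
Proof.
move=> iw r r1; have [D D1 wD] := invariant_growth iw.
have mw := measurable_weight iw.1.
have [w0 _] := iw.1.
have h0 : 0 <= 2^-1 :> R by rewrite invr_ge0.
have h1 : 2^-1 < 1 :> R by rewrite invf_lt1// ltr1n.
have r2 : 0 < (1 - r) / 2 by rewrite divr_gt0// subr_gt0.
have [n hn] := cvg_pow_lt h0 h1 r2.
have d0 : disc (0 : R[i]) by rewrite /disc/mkset cmod0.
have w00 := w0 _ d0.
pose k := D ^+ n.+1 / w 0.
have k0 : 0 <= k by rewrite divr_ge0 ?(ltW w00)// exprn_ge0// (le_trans ler01).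
have wk u : disc u -> (1 - r) / 2 <= 1 - cmod u -> 1 <= k * w u.
  move=> du hu; rewrite mulrAC ler_pdivlMr// mul1r; apply: wD => //.
  have c0 : (0 : R[i])^*%R = 0 by exact: rmorph0.
  rewrite /hk cmod0 c0 mul0r subr0 cmod1 expr0n subr0 mul1r expr1n divr1 -exprVn.
  apply: (le_trans hn); apply: (le_trans hu).
  by rewrite lerB// ler_piMl ?cmod_ge0// ltW.
have pi0 := pi_gt0 R.
exists (k * pi / ((1 - r) / 2) ^+ 2); first by apply: divr_ge0; [apply: mulr_ge0 => //; exact: ltW|apply: exprn_ge0; exact: ltW].
move=> A M A0 sA mA hM z zr; have dz : disc z by exact: le_lt_trans r1.
set t := (1 - cmod z) / 2.
have rt : (1 - r) / 2 <= t by rewrite /t ler_pM2r ?invr_gt0// lerB.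
have t0 : 0 < t by exact: lt_le_trans rt.
have mE : measurable (eball z t : set lplane) by apply: borel_lebesgue; exact: measurable_eball.
have sub : (eball z t : set lplane) `<=` @rdisc R.
  by move=> u hu; have [] := ball_sub_disc dz hu.
have mAw : measurable_fun (@rdisc R) (fun u : lplane => (A (cplx u) * w (cplx u))%:E).
  by apply/measurable_EFinP; apply: measurable_funM; [exact: mA|exact: mw].
have Aw0 (u : lplane) : rdisc u -> (0 <= (A (cplx u) * w (cplx u))%:E)%E.
  by move=> du; rewrite lee_fin; apply: mulr_ge0; [exact: A0|exact: ltW (w0 _ du)].
have h : (\int[dA R]_(u in (eball z t : set lplane)) (A (cplx u))%:E <= (k * M)%:E)%E.
  apply: (@le_trans _ _ (\int[dA R]_(u in (eball z t : set lplane)) (k%:E * (A (cplx u) * w (cplx u))%:E))%E).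
    apply: ge0_le_integral.
    - exact: mE.
    - by move=> u _; rewrite lee_fin; exact: A0.
    - by apply/measurable_EFinP; apply: measurable_funS mA; [exact: measurable_rdisc|exact: sub].
    - by apply: measurable_funeM; apply: measurable_funS mAw; [exact: measurable_rdisc|exact: sub].
    - move=> u hu; rewrite -EFinM lee_fin mulrCA ler_peMr//.
      by have [du hu'] := ball_sub_disc dz hu; apply: wk => //; exact: le_trans hu'.
  rewrite ge0_integralZl; first last.
  - by rewrite lee_fin.
  - by move=> u hu; apply: Aw0; exact: sub.
  - by apply: measurable_funS mAw; [exact: measurable_rdisc|exact: sub].
  - exact: mE.
  rewrite (EFinM k M); apply: lee_wpmul2l; first by rewrite lee_fin.
  apply: le_trans hM; apply: ge0_subset_integral; [exact: mE|exact: measurable_rdisc|exact: mAw|exact: Aw0|exact: sub].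
have := le_trans (sA z dz) h; rewrite lee_fin mulrA ler_pdivrMr// => h3.
rewrite mulrAC ler_pdivlMr ?exprn_gt0//.
have -> : k * pi * M = k * M * pi by ring.
apply: le_trans h3; rewrite ler_wpM2l// lerXn2r ?nnegrE ?(ltW r2) ?(ltW t0)//.
Qed.

Lemma powRD_le (a b p : R) : 0 < p -> 0 <= a -> 0 <= b ->
  (a + b) `^ p <= 2 `^ p * (a `^ p + b `^ p).
Proof.
move=> p0 a0 b0; have m0 : 0 <= Num.max a b by rewrite le_max a0.
apply: (@le_trans _ _ ((2 * Num.max a b) `^ p)).
  apply: ge0_ler_powR; rewrite ?nnegrE ?(ltW p0) ?addr_ge0 ?mulr_ge0//.
  have : a <= Num.max a b by rewrite le_max lexx.
  have : b <= Num.max a b by rewrite le_max lexx orbT.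
  by lra.
rewrite powRM// ler_wpM2l ?powR_ge0//.
by have [_|_] := leP a b; rewrite ?lerDl ?lerDr powR_ge0.
Qed.

(** A positive value would persist on a small disc, which has positive area. *)
Lemma integral0_continuous (w : R[i] -> R) (g : R[i] -> R) p :
  (forall z, disc z -> 0 < w z) -> measurable_fun (@rdisc R) (fun u : lplane => w (cplx u)) ->
  (forall z, 0 <= g z) ->
  (forall z e, disc z -> 0 < e -> exists2 d, 0 < d & forall u, cmod (u - z) <= d -> `|g u - g z| <= e) ->
  (\int[dA R]_(u in @rdisc R) (g (cplx u) `^ p * w (cplx u))%:E = 0)%E ->
  forall z, disc z -> g z = 0.
Proof.
move=> w0 mw g0 cg I0 z dz; apply/eqP; rewrite -[_ == _]negbK; apply/negP => gz.
have gz0 : 0 < g z by rewrite lt_neqAle eq_sym gz g0.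
have [d d0 hd] := cg z (g z / 2) dz (divr_gt0 gz0 (ltr0n _ 2)).
have z1 : 0 < (1 - cmod z) / 2 by rewrite divr_gt0// subr_gt0.
pose t := Num.min d ((1 - cmod z) / 2).
have t0 : 0 < t by rewrite lt_min d0.
have mg : measurable_fun (@rdisc R) (fun u : lplane => g (cplx u)) by exact: measurable_continuous_disc.
have mgw : measurable_fun (@rdisc R) (fun u : lplane => (g (cplx u) `^ p * w (cplx u))%:E).
  by apply/measurable_EFinP; apply: measurable_funM; [apply: measurable_powR_fun; exact: mg|exact: mw].
have I0' : (\int[dA R]_(u in @rdisc R) `|(g (cplx u) `^ p * w (cplx u))%:E| = 0)%E.
  rewrite -[RHS]I0; apply: eq_integral => u; rewrite inE => du.
  by rewrite gee0_abs// lee_fin; apply: mulr_ge0; [exact: powR_ge0|exact: ltW (w0 _ du)].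
have [/(_ I0') [N [mN N0 sN]] _] := @ae_eq_integral_abs _ lplane R (dA R) (@rdisc R) (@measurable_rdisc R) _ mgw.
have sub : (eball z t : set lplane) `<=` N.
  move=> u hu; apply: sN => /=.
  have [du _] : disc (cplx u) /\ (1 - cmod z) / 2 <= 1 - cmod (cplx u).
    by apply: ball_sub_disc => //; apply: lt_le_trans hu _; rewrite ge_min lexx orbT.
  move=> /(_ du) /eqP; apply/negP; rewrite eqe mulf_eq0 negb_or (gt_eqF (w0 _ du)) andbT.
  have := hd (cplx u) (ltW (lt_le_trans hu _)); rewrite ge_min lexx => /(_ isT).
  rewrite ler_norml => /andP[h1 _]; apply: lt0r_neq0; apply: powR_gt0; lra.
have mE : measurable (eball z t : set lplane) by apply: borel_lebesgue; exact: measurable_eball.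
have E0 : dA R (eball z t : set lplane) = 0%E.
  by apply/eqP; rewrite eq_le measure_ge0 andbT -[leRHS]N0; apply: le_measure; rewrite ?inE.
have adm : loglin_admissible [seq (i.1.1 - i.1.2 * z, i.1.2, i.2) | i <- [::] : seq (R[i] * R[i] * R)] t by move=> i.
have l1 u : loglin 1 [::] u = 1 :> R by rewrite /loglin big_nil mulr1.
have := loglin_submean ler01 t0 adm; rewrite l1 mul1r.
rewrite (eq_integral (cst 1%E)); last by move=> u _; rewrite l1.
rewrite (integral_cst (dA R) mE) E0 mule0 lee_fin => h.
have := divr_gt0 (exprn_gt0 2 t0) (pi_gt0 R); lra.
Qed.

End LimitTools.

(** * Bergman integrals *)

Section BergmanIntegrals.
Variable R : realType.
Local Notation lplane := (lebesgue_plane R).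
Implicit Types (f F : R[i] -> R[i]) (w : R[i] -> R) (z : R[i]) (p e : R).

Lemma bergman_integral_ge0 p w f : (forall z, disc z -> 0 < w z) -> (0 <= bergman_integral p w f)%E.
Proof.
move=> w0; apply: integral_ge0 => u du; rewrite lee_fin.
by apply: mulr_ge0; [exact: powR_ge0|exact: ltW (w0 _ du)].
Qed.

Lemma bergman_norm_powR p w f : p != 0 -> (forall z, disc z -> 0 < w z) ->
  (bergman_norm p w f `^ p = bergman_integral p w f)%E.
Proof.
by move=> p0 w0; rewrite /bergman_norm -poweRrM mulVf// poweRe1// bergman_integral_ge0.
Qed.

Lemma dense_approx p w f e : 0 < p -> (forall z, disc z -> 0 < w z) -> polynomials_dense p w ->
  bergman p w f -> 0 < e ->
  exists P : {poly R[i]}, (bergman_integral p w (fun z => (f z - P.[z])%R) <= e%:E)%E.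
Proof.
move=> p0 w0 hd bf e0; have [P [_ hP]] := hd f bf (e `^ p^-1) (powR_gt0 _ e0).
exists P; rewrite -bergman_norm_powR ?lt0r_neq0//.
have -> : e = (e `^ p^-1) `^ p by rewrite -powRrM mulVf ?lt0r_neq0// powRr1// ltW.
rewrite -poweR_EFin; apply: gt0_ler_poweR; rewrite ?(ltW p0) ?in_itv/= ?leey ?andbT ?lee_fin ?powR_ge0 ?poweR_ge0//.
exact: ltW.
Qed.

Lemma cmeasurable_poly (P : {poly R[i]}) : cmeasurable (@rdisc R) (fun u : lplane => P.[cplx u]).
Proof. by apply: cmeasurable_horner; apply: cmeasurable_cplx_lebesgue; exact: measurable_rdisc. Qed.

Lemma measurable_bergman p w f : cmeasurable (@rdisc R) (fun u : lplane => f (cplx u)) ->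
  measurable_fun (@rdisc R) (fun u : lplane => w (cplx u)) ->
  measurable_fun (@rdisc R) (fun u : lplane => cmod (f (cplx u)) `^ p * w (cplx u)).
Proof.
move=> mf mw; apply: measurable_funM; last exact: mw.
by apply: measurable_powR_fun; exact: cmeasurable_cmod.
Qed.

Lemma bergman_integralB_le p w f F : 0 < p -> (forall z, disc z -> 0 < w z) ->
  measurable_fun (@rdisc R) (fun u : lplane => w (cplx u)) ->
  cmeasurable (@rdisc R) (fun u : lplane => f (cplx u)) ->
  cmeasurable (@rdisc R) (fun u : lplane => F (cplx u)) ->
  (bergman_integral p w F <= (2 `^ p)%:E * (bergman_integral p w f +
    bergman_integral p w (fun z => (f z - F z)%R)))%E.
Proof.
move=> p0 w0 mw mf mF; have mD := @measurable_rdisc R.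
have mB : cmeasurable (@rdisc R) (fun u : lplane => f (cplx u) - F (cplx u)).
  by apply: cmeasurableD; [exact: mf|apply: cmeasurableN; exact: mF].
have pos g (u : lplane) : rdisc u -> (0 <= (cmod (g (cplx u)) `^ p * w (cplx u))%:E)%E.
  by move=> du; rewrite lee_fin; apply: mulr_ge0; [exact: powR_ge0|exact: ltW (w0 _ du)].
have m1 := measurable_bergman p mf mw; have m2 := measurable_bergman p mF mw.
have m3 := @measurable_bergman p w (fun z => f z - F z) mB mw.
rewrite /bergman_integral -ge0_integralD; first last.
- by apply/measurable_EFinP; exact: m3.
- by move=> u du; apply: (pos (fun z => f z - F z)).
- by apply/measurable_EFinP; exact: m1.
- by move=> u du; exact: pos.
- exact: mD.
rewrite -ge0_integralZl; first last.
- by rewrite lee_fin powR_ge0.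
- by move=> u du; apply: adde_ge0; [exact: pos|exact: (pos (fun z => f z - F z))].
- by apply: emeasurable_funD; apply/measurable_EFinP; [exact: m1|exact: m3].
- exact: mD.
apply: ge0_le_integral.
- exact: mD.
- by move=> u du; exact: pos.
- by apply/measurable_EFinP; exact: m2.
- by apply: measurable_funeM; apply: emeasurable_funD; apply/measurable_EFinP; [exact: m1|exact: m3].
- move=> u du; rewrite -EFinD -EFinM lee_fin -mulrDl mulrA.
  apply: ler_wpM2r; first exact: ltW (w0 _ du).
  apply: le_trans (powRD_le p0 (cmod_ge0 _) (cmod_ge0 _)).
  apply: ge0_ler_powR; rewrite ?nnegrE ?addr_ge0 ?cmod_ge0 ?(ltW p0)//.
  have := cmodD (f (cplx u)) (- (f (cplx u) - F (cplx u))).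
  by rewrite cmodN opprB addrCA subrr addr0.
Qed.

Lemma integral_part_le (s K : R) (X T : lplane -> R) : 0 < s ->
  measurable_fun (@rdisc R) X -> measurable_fun (@rdisc R) T ->
  (forall u, rdisc u -> 0 <= X u) -> (forall u, rdisc u -> s * X u <= T u) ->
  (\int[dA R]_(u in @rdisc R) (T u)%:E <= K%:E)%E ->
  (\int[dA R]_(u in @rdisc R) (X u)%:E <= (s^-1 * K)%:E)%E.
Proof.
move=> s0 mX mT X0 XT hT; have mD := @measurable_rdisc R.
have T0 u : rdisc u -> 0 <= T u by move=> du; apply: le_trans (XT u du); apply: mulr_ge0; [exact: ltW|exact: X0].
apply: (@le_trans _ _ (s^-1%:E * \int[dA R]_(u in @rdisc R) (T u)%:E)%E); last first.
  by rewrite EFinM; apply: lee_wpmul2l; [rewrite lee_fin invr_ge0 ltW|].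
rewrite -ge0_integralZl; first last.
- by rewrite lee_fin invr_ge0 ltW.
- by move=> u du; rewrite lee_fin; exact: T0.
- by apply/measurable_EFinP.
- exact: mD.
apply: ge0_le_integral.
- exact: mD.
- by move=> u du; rewrite lee_fin; exact: X0.
- by apply/measurable_EFinP.
- by apply: measurable_funeM; apply/measurable_EFinP.
- by move=> u du; rewrite -EFinM lee_fin ler_pdivlMl//; exact: XT.
Qed.

Lemma cvg_eps (a : nat -> R) l : (forall e, 0 < e -> exists N, forall m, (N <= m)%N -> `|a m - l| <= e) ->
  a @ \oo --> l.
Proof.
move=> h; apply/cvgrPdist_le => e e0; have [N hN] := h e e0.
by exists N => // m Nm; rewrite distrC; exact: hN.
Qed.

Lemma half_pow_le1 n : 2^-1 ^+ n <= 1 :> R.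
Proof. by rewrite exprn_ile1 ?invr_ge0// invf_le1// ler1n. Qed.

Lemma half_pow_le m n : (m <= n)%N -> 2^-1 ^+ n <= 2^-1 ^+ m :> R.
Proof. by move=> mn; apply: ler_wiXn2l => //; rewrite ?invr_ge0// invf_le1// ler1n. Qed.

Lemma half_pow_lt e : 0 < e -> exists n, 2^-1 ^+ n <= e.
Proof. by apply: cvg_pow_lt; rewrite ?invr_ge0// invf_lt1// ltr1n. Qed.

End BergmanIntegrals.

(** * The factorization theorem *)

Section BergmanFactorization.
Variable R : realType.
Local Notation lplane := (lebesgue_plane R).
Implicit Types (f F : R[i] -> R[i]) (w : R[i] -> R) (z : R[i]) (p e : R).

Lemma analytic_continuous_error f F1 F2 : analytic_disc f -> analytic_disc F1 -> analytic_disc F2 ->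
  forall z e, disc z -> 0 < e -> exists2 d, 0 < d & forall u, cmod (u - z) <= d ->
    `|cmod (f u - F1 u * F2 u) - cmod (f z - F1 z * F2 z)| <= e.
Proof.
move=> af a1 a2 z e dz e0.
have dd : derivable ((fun u => f u - F1 u * F2 u) : R[i]^o -> R[i]^o) z 1.
  by apply: derivableB; [exact: af|apply: derivableM; [exact: a1|exact: a2]].
have [d d0 hd] := derivable_continuous dd e0.
by exists d => // u hu; apply: le_trans (cmod_dist _ _) (hd u hu).
Qed.

Lemma cvg_loc_sub (q : nat -> {poly R[i]}) F (phi : nat -> nat) : (forall m, (m <= phi m)%N) ->
  cvg_loc (fun n => horner (q n)) F -> cvg_loc (fun n => horner (q (phi n))) F.
Proof.
move=> hphi cq r e r1 e0; have [N hN] := cq r e r1 e0.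
by exists N => n Nn z zr; apply: hN => //; exact: leq_trans (hphi n).
Qed.

(** The polynomials [q n] inherit local bounds from [A n], which has the sub-mean
    value property and bounded weighted integral. *)
Lemma sub_mean_bounded_loc w (A : nat -> R[i] -> R) (q : nat -> {poly R[i]}) s K : invariant_weight w ->
  0 < s -> (forall n z, 0 <= A n z) -> (forall n, sub_mean (fun z => A n z `^ s)) ->
  (forall n, measurable_fun (@rdisc R) (fun u : lplane => A n (cplx u))) ->
  (forall n, \int[dA R]_(u in @rdisc R) (A n (cplx u) `^ s * w (cplx u))%:E <= K%:E)%E ->
  (forall n z, cmod z <= 1 - 2^-1 ^+ n -> `|cmod (q n).[z] - A n z| <= 2^-1 ^+ n) ->
  bounded_loc (fun n => horner (q n)).
Proof.
move=> iw s0 A0 sA mA hK hq r r1; have [c c0 hc] := sub_mean_bounded iw r1.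
have r2 : 0 < 1 - r by rewrite subr_gt0.
have [N hN] := half_pow_lt r2.
exists ((c * K) `^ s^-1 + 1), N => n Nn z zr.
have zn : cmod z <= 1 - 2^-1 ^+ n.
  have h := half_pow_le R Nn; apply: (le_trans zr).
  by move: (2^-1 ^+ n) (2^-1 ^+ N) h hN => x y h hN; lra.
have mAs : measurable_fun (@rdisc R) (fun u : lplane => A n (cplx u) `^ s).
  by apply: measurable_powR_fun; exact: mA.
have hA : A n z `^ s <= c * K.
  exact: (hc (fun z => A n z `^ s) K (fun y => powR_ge0 _ _) (sA n) mAs (hK n) z zr).
have cK : 0 <= c * K by apply: le_trans hA; exact: powR_ge0.
have hA' : A n z <= (c * K) `^ s^-1.
  rewrite -[leLHS]powRr1// -(divff (lt0r_neq0 s0)) powRrM.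
  by apply: ge0_ler_powR; rewrite ?nnegrE ?powR_ge0 ?invr_ge0 ?(ltW s0).
have := hq n z zn; rewrite ler_norml => /andP[_ h]; have := half_pow_le1 R n; lra.
Qed.

Lemma cvg_modulus (A : nat -> R[i] -> R) (q : nat -> {poly R[i]}) F (phi : nat -> nat) k z :
  (forall n z, cmod z <= 1 - 2^-1 ^+ n -> `|cmod (q n).[z] - A n z| <= 2^-1 ^+ n) ->
  (forall m, (m <= phi m)%N) -> cvg_loc (fun m => horner (q (phi m))) F -> disc z ->
  A (phi (m + k)%N) z @[m --> \oo] --> cmod (F z).
Proof.
move=> hq hphi cF dz; apply: cvg_eps => e e0.
have e2 : 0 < e / 2 by rewrite divr_gt0.
have [N1 h1] := half_pow_lt e2.
have z1 : 0 < 1 - cmod z by rewrite subr_gt0.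
have [N2 h2] := half_pow_lt z1.
have [N3 h3] := cF _ _ dz e2.
exists (N1 + N2 + N3)%N => m Nm.
have le1 : (N1 <= phi (m + k))%N.
  apply: leq_trans (hphi _); apply: leq_trans (leq_addr k m); apply: leq_trans Nm.
  by rewrite -addnA leq_addr.
have le2 : (N2 <= phi (m + k))%N.
  apply: leq_trans (hphi _); apply: leq_trans (leq_addr k m); apply: leq_trans Nm.
  by rewrite addnAC leq_addl.
have le3 : (N3 <= m + k)%N.
  by apply: leq_trans (leq_addr k m); apply: leq_trans Nm; rewrite leq_addl.
have hz : cmod z <= 1 - 2^-1 ^+ phi (m + k)%N.
  by have := le_trans (half_pow_le R le2) h2; move: (2^-1 ^+ _) => x hx; lra.
have g1 := hq _ _ hz; have g2 := le_trans (half_pow_le R le1) h1.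
have g3 := le_trans (cmod_dist _ _) (h3 _ le3 z (lexx _)).
move: g1 g2 g3; move: (2^-1 ^+ _) (A _ z) (cmod (F z)) (cmod _) => x a b c.
rewrite !ler_norml => /andP[g1 g1'] g2 /andP[g3 g3'].
by apply/andP; split; lra.
Qed.

Lemma cvg_product_error (P q1 q2 : nat -> {poly R[i]}) F1 F2 (phi : nat -> nat) k y z :
  (forall n z, cmod z <= 1 - 2^-1 ^+ n -> cmod ((q1 n).[z] * (q2 n).[z] - (P n).[z]) <= 2^-1 ^+ n) ->
  (forall m, (m <= phi m)%N) ->
  cvg_loc (fun m => horner (q1 (phi m))) F1 -> cvg_loc (fun m => horner (q2 (phi m))) F2 -> disc z ->
  cmod (y - (P (phi (m + k)%N)).[z]) @[m --> \oo] --> cmod (y - F1 z * F2 z).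
Proof.
move=> hq hphi c1 c2 dz; apply: cvg_eps => e e0.
have e2 : 0 < e / 2 by rewrite divr_gt0.
have [N1 h1] := half_pow_lt e2.
have z1 : 0 < 1 - cmod z by rewrite subr_gt0.
have [N2 h2] := half_pow_lt z1.
pose b := cmod (F1 z) + cmod (F2 z); have b0 : 0 <= b by rewrite addr_ge0 ?cmod_ge0.
have b1 : 0 < 2 * b + 1 by rewrite ltr_wpDl// mulr_ge0.
pose d := Num.min 1 (e / 2 / (2 * b + 1)).
have d0 : 0 < d by rewrite lt_min ltr01 divr_gt0.
have d1 : d <= 1 by rewrite ge_min lexx.
have db : d * (2 * b + 1) <= e / 2 by rewrite -ler_pdivlMr// ge_min lexx orbT.
have [N3 h3] := c1 _ _ dz d0; have [N4 h4] := c2 _ _ dz d0.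
exists (N1 + N2 + N3 + N4)%N => m Nm.
have mk : (N1 + N2 + N3 + N4 <= m + k)%N by apply: leq_trans Nm _; exact: leq_addr.
have le1 : (N1 <= phi (m + k))%N.
  by apply: leq_trans (hphi _); apply: leq_trans mk; rewrite -!addnA leq_addr.
have le2 : (N2 <= phi (m + k))%N.
  by apply: leq_trans (hphi _); apply: leq_trans mk; rewrite -!addnA addnCA leq_addr.
have le3 : (N3 <= m + k)%N by apply: leq_trans mk; rewrite -addnA addnCA leq_addr.
have le4 : (N4 <= m + k)%N by apply: leq_trans mk; exact: leq_addl.
have hz : cmod z <= 1 - 2^-1 ^+ phi (m + k)%N.
  by have := le_trans (half_pow_le R le2) h2; move: (2^-1 ^+ _) => x hx; lra.
have g1 := le_trans (hq _ _ hz) (le_trans (half_pow_le R le1) h1).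
have f1b : cmod (F1 z) <= b by rewrite lerDl cmod_ge0.
have f2b : cmod (F2 z) <= b by rewrite lerDr cmod_ge0.
have g2 := le_trans (cmod_mul_dist d1 b0 (h3 _ le3 z (lexx _)) (h4 _ le4 z (lexx _)) f1b f2b) db.
apply: (le_trans (cmod_dist _ _)); move: g1 g2.
set Q := _ * _; set G := F1 z * F2 z; set Pz := _.[z] => g1 g2.
have -> : y - Pz - (y - G) = (Q - Pz) - (Q - G) by ring.
by apply: (le_trans (cmodD _ _)); rewrite cmodN; lra.
Qed.

(** Polynomials close to [f] are split, with integrals under control; the
    polynomial factors are locally bounded by the sub-mean value property, and
    converge along a subsequence. Fatou's lemma is used twice: for the integrals
    of the factors, with a constant that does not see the error of
    approximation, and for [f - F1 * F2], which therefore vanishes. *)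
Lemma bergman_factorization w p p1 p2 : 0 < p -> 0 < p1 -> 0 < p2 ->
  p / p1 + p / p2 = 1 -> invariant_weight w -> polynomials_dense p w ->
  exists2 C, 0 < C & forall f, bergman p w f -> exists F1 F2,
    [/\ analytic_disc F1, analytic_disc F2, forall z, disc z -> f z = F1 z * F2 z &
     (\int[dA R]_(u in @rdisc R) ((p / p1 * cmod (F1 (cplx u)) `^ p1 +
        p / p2 * cmod (F2 (cplx u)) `^ p2) * w (cplx u))%:E <= C%:E * bergman_integral p w f)%E].
Proof.
move=> p0 p10 p20 s12 iw hd; have [C0 C00 hC0] := poly_factors p0 p10 p20 s12 iw.
have mw := measurable_weight iw.1.
have [w0 _] := iw.1.
have s10 : 0 < p / p1 by rewrite divr_gt0.
have s20 : 0 < p / p2 by rewrite divr_gt0.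
(* The factor [2 `^ p] compares the integral of a polynomial with those of [f] and of
   the error of approximation. *)
pose C := C0 * 2 `^ p.
have C_gt0 : 0 < C by rewrite mulr_gt0// powR_gt0.
exists C => // f bf; have [af fin] := bf.
have mf := analytic_cmeasurable af.
have I0 := bergman_integral_ge0 p f w0.
have [N NE] : exists N, bergman_integral p w f = N%:E.
  by move: fin I0; case: (bergman_integral p w f) => [x||]//; exists x.
have N0 : 0 <= N by move: I0; rewrite NE lee_fin.
have /choice[P hP] : forall n, exists P : {poly R[i]},
    (bergman_integral p w (fun z => (f z - P.[z])%R) <= (2^-1 ^+ n)%:E)%E.
  by move=> n; apply: dense_approx => //; rewrite exprn_gt0 ?invr_gt0.
have /choice[A /choice[B hAB]] := fun n => hC0 (P n).
have hI n : (\int[dA R]_(u in @rdisc R) ((p / p1 * A n (cplx u) `^ p1 + p / p2 * B n (cplx u) `^ p2) * w (cplx u))%:E <=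
    (C * (N + 2^-1 ^+ n))%:E)%E.
  have [_ _ _ _ [_ _ h]] := hAB n; apply: (le_trans h).
  have -> : ((C * (N + 2^-1 ^+ n))%:E = C0%:E * ((2 `^ p)%:E * (N%:E + (2^-1 ^+ n)%:E)))%E.
    by rewrite -EFinD -!EFinM mulrA.
  apply: lee_wpmul2l; first by rewrite lee_fin ltW.
  apply: le_trans (bergman_integralB_le p0 w0 mw mf (cmeasurable_poly (P n))) _.
  apply: lee_wpmul2l; first by rewrite lee_fin powR_ge0.
  by rewrite NE; apply: leeD => //; exact: hP.
pose dn n : R := 2^-1 ^+ n.
have dn0 n : 0 < dn n by rewrite exprn_gt0 ?invr_gt0.
have hq n : exists q1 q2 : {poly R[i]}, forall z, cmod z <= 1 - 2^-1 ^+ n ->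
    [/\ `|cmod q1.[z] - A n z| <= 2^-1 ^+ n, `|cmod q2.[z] - B n z| <= 2^-1 ^+ n &
      cmod (q1.[z] * q2.[z] - (P n).[z]) <= 2^-1 ^+ n].
  by have [h _ _ _ _] := hAB n; apply: h => //; rewrite ltrBlDr ltrDl; exact: dn0.
move/choice : hq => [q1 /choice[q2 hq]].
have A0 n z : 0 <= A n z by have [_ [h _] _ _ _] := hAB n.
have B0 n z : 0 <= B n z by have [_ [_ h] _ _ _] := hAB n.
have sA n : sub_mean (fun z => A n z `^ p1) by have [_ _ h _ _] := hAB n.
have sB n : sub_mean (fun z => B n z `^ p2) by have [_ _ _ h _] := hAB n.
have mA n : measurable_fun (@rdisc R) (fun u : lplane => A n (cplx u)) by have [_ _ _ _ [h _ _]] := hAB n.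
have mB n : measurable_fun (@rdisc R) (fun u : lplane => B n (cplx u)) by have [_ _ _ _ [_ h _]] := hAB n.
pose T n (u : lplane) := (p / p1 * A n (cplx u) `^ p1 + p / p2 * B n (cplx u) `^ p2) * w (cplx u).
have mT n : measurable_fun (@rdisc R) (T n).
  apply: measurable_funM; last exact: mw.
  apply: measurable_funD; (apply: measurable_funM; [exact: measurable_cst|]).
    by apply: measurable_powR_fun; exact: mA.
  by apply: measurable_powR_fun; exact: mB.
have T0 n (u : lplane) : rdisc u -> 0 <= T n u.
  move=> du; apply: mulr_ge0; last exact: ltW (w0 _ du).
  by apply: addr_ge0; (apply: mulr_ge0; [exact: ltW|exact: powR_ge0]).
pose K := C * (N + 1).
have hK n : (\int[dA R]_(u in @rdisc R) (T n u)%:E <= K%:E)%E.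
  apply: (le_trans (hI n)); rewrite lee_fin; apply: ler_wpM2l; first exact: ltW.
  by rewrite lerD2l half_pow_le1.
have bq1 : bounded_loc (fun n => horner (q1 n)).
  apply: (sub_mean_bounded_loc (K := (p / p1)^-1 * K) iw p10 A0 sA mA); last by move=> n z hz; have [] := hq n z hz.
  move=> n; apply: (integral_part_le s10 _ (mT n) _ _ (hK n)).
  - by apply: measurable_funM; [apply: measurable_powR_fun; exact: mA|exact: mw].
  - by move=> u du; apply: mulr_ge0; [exact: powR_ge0|exact: ltW (w0 _ du)].
  - move=> u du; rewrite mulrA; apply: ler_wpM2r; first exact: ltW (w0 _ du).
    by rewrite lerDl; apply: mulr_ge0; [exact: ltW|exact: powR_ge0].
have bq2 : bounded_loc (fun n => horner (q2 n)).
  apply: (sub_mean_bounded_loc (K := (p / p2)^-1 * K) iw p20 B0 sB mB); last by move=> n z hz; have [] := hq n z hz.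
  move=> n; apply: (integral_part_le s20 _ (mT n) _ _ (hK n)).
  - by apply: measurable_funM; [apply: measurable_powR_fun; exact: mB|exact: mw].
  - by move=> u du; apply: mulr_ge0; [exact: powR_ge0|exact: ltW (w0 _ du)].
  - move=> u du; rewrite mulrA; apply: ler_wpM2r; first exact: ltW (w0 _ du).
    by rewrite lerDr; apply: mulr_ge0; [exact: ltW|exact: powR_ge0].
have [phi1 [F1 [hphi1 c1]]] := montel bq1.
have bq2' : bounded_loc (fun n => horner ((q2 \o phi1) n)).
  move=> r r1; have [M [n0 hM]] := bq2 r r1.
  by exists M, n0 => n nn z zr; apply: hM => //; exact: leq_trans (hphi1 n).
have [phi2 [F2 [hphi2 c2]]] := montel bq2'.
pose phi n := phi1 (phi2 n).
have hphi n : (n <= phi n)%N by apply: leq_trans (hphi1 _); exact: hphi2.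
have {}c1 : cvg_loc (fun n => horner (q1 (phi n))) F1 by exact: (@cvg_loc_sub (q1 \o phi1) F1 phi2).
have {}c2 : cvg_loc (fun n => horner (q2 (phi n))) F2 by exact: c2.
have a1 := cvg_loc_analytic c1; have a2 := cvg_loc_analytic c2.
have hqA n z : cmod z <= 1 - 2^-1 ^+ n -> `|cmod (q1 n).[z] - A n z| <= 2^-1 ^+ n by move=> /(hq n)[].
have hqB n z : cmod z <= 1 - 2^-1 ^+ n -> `|cmod (q2 n).[z] - B n z| <= 2^-1 ^+ n by move=> /(hq n)[].
have hqP n z : cmod z <= 1 - 2^-1 ^+ n -> cmod ((q1 n).[z] * (q2 n).[z] - (P n).[z]) <= 2^-1 ^+ n by move=> /(hq n)[].
exists F1, F2; split; [exact: a1|exact: a2| |].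
  move=> z dz; apply/eqP; rewrite -subr_eq0 -cmod_eq0; apply/eqP.
  apply: (@integral0_continuous R w (fun z => cmod (f z - F1 z * F2 z)) p w0 mw _ _ _ z dz).
  - by move=> y; exact: cmod_ge0.
  - exact: analytic_continuous_error.
  - apply/eqP; rewrite eq_le; apply/andP; split; last first.
      by apply: integral_ge0 => u du; rewrite lee_fin; apply: mulr_ge0; [exact: powR_ge0|exact: ltW (w0 _ du)].
    apply/lee_addgt0Pr => e e0; rewrite add0e; have [k hk] := half_pow_lt e0.
    apply: (@fatou_le R (fun m (u : lplane) => cmod (f (cplx u) - (P (phi (m + k)%N)).[cplx u]) `^ p * w (cplx u))).
    + move=> m; apply: (@measurable_bergman R p w (fun z => f z - (P (phi (m + k)%N)).[z]) _ mw).
      by apply: cmeasurableD; [exact: mf|apply: cmeasurableN; exact: cmeasurable_poly].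
    + by move=> m u du; apply: mulr_ge0; [exact: powR_ge0|exact: ltW (w0 _ du)].
    + move=> u du; apply: cvgM; last exact: cvg_cst.
      apply: cvg_powR_seq; [exact: p0|by move=> m; exact: cmod_ge0|].
      exact: (@cvg_product_error P q1 q2 F1 F2 phi k (f (cplx u)) (cplx u) hqP hphi c1 c2 du).
    + move=> m; apply: le_trans (hP (phi (m + k)%N)) _; rewrite lee_fin; apply: le_trans hk.
      by apply: half_pow_le; apply: leq_trans (hphi _); exact: leq_addl.
(* The error of approximation is absorbed by passing to a tail of the sequence. *)
rewrite NE -EFinM; apply/lee_addgt0Pr => e e0.
have eC : 0 < e / C by rewrite divr_gt0.
have [k hk] := half_pow_lt eC.
apply: (@fatou_le R (fun m => T (phi (m + k)%N))).
- by move=> m; exact: mT.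
- by move=> m u; exact: T0.
- move=> u du; apply: cvgM; last exact: cvg_cst.
  by apply: cvgD; (apply: cvgM; [exact: cvg_cst|]); apply: cvg_powR_seq => //;
    [exact: (cvg_modulus k hqA hphi c1 du)|exact: (cvg_modulus k hqB hphi c2 du)].
- move=> m; apply: (le_trans (hI _)); rewrite -EFinD lee_fin mulrDr lerD2l.
  rewrite mulrC -ler_pdivlMr//; apply: le_trans hk; apply: half_pow_le.
  by apply: leq_trans (hphi _); exact: leq_addl.
Qed.

Lemma lty_summand (s : R) (X Z M : \bar R) : 0 < s -> (0 <= Z)%E ->
  (s%:E * X + Z <= M)%E -> (M < +oo)%E -> (X < +oo)%E.
Proof.
move=> s0 Z0 h hM; rewrite ltey; apply/eqP => XE; move: (le_lt_trans h hM).
by rewrite XE gt0_muley ?lte_fin// addye ?ltxx//; case: Z Z0 {h}.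
Qed.

(** Young's inequality with the conjugate exponents [p1 / p] and [p2 / p]. *)
Lemma young_poweR p p1 p2 (X Y : \bar R) : 0 < p -> 0 < p1 -> 0 < p2 -> p / p1 + p / p2 = 1 ->
  (0 <= X)%E -> (0 <= Y)%E -> (X < +oo)%E -> (Y < +oo)%E ->
  ((X `^ p1^-1) `^ p * (Y `^ p2^-1) `^ p <= (p / p1)%:E * X + (p / p2)%:E * Y)%E.
Proof.
move=> hp hp1 hp2 s12; case: X => [x||]//; case: Y => [y||]//.
move=> x0 y0 _ _; rewrite !lee_fin in x0 y0.
have e (a b c : R) : ((a%:E `^ b) `^ c = ((a `^ b) `^ c)%:E)%E by rewrite !poweR_EFin.
rewrite !e -!EFinM -EFinD lee_fin.
have := @conjugate_powR R ((x `^ p1^-1) `^ p) ((y `^ p2^-1) `^ p) (p1 / p) (p2 / p) (powR_ge0 _ _) (powR_ge0 _ _).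
rewrite !divr_gt0// !invf_div => /(_ isT isT s12); rewrite -!powRrM.
have -> : p1^-1 * p * (p1 / p) = 1 by field; rewrite !lt0r_neq0.
have -> : p2^-1 * p * (p2 / p) = 1 by field; rewrite !lt0r_neq0.
by rewrite !powRr1// [x * _]mulrC [y * _]mulrC.
Qed.

End BergmanFactorization.

Theorem theorem3p1 (R : realType) (p p1 p2 : R) (w : R[i] -> R)
    (hp : 0 < p) (hp1 : 0 < p1) (hp2 : 0 < p2)
    (hpp : p^-1 = p1^-1 + p2^-1)
    (hw : invariant_weight w) (hdense : polynomials_dense p w) :
  exists2 C : R, 0 < C &
    forall f : R[i] -> R[i], bergman p w f ->
      exists f1 f2 : R[i] -> R[i],
        [/\ bergman p1 w f1,
            bergman p2 w f2,
            (forall z, disc z -> f z = f1 z * f2 z),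
            (bergman_norm p1 w f1 `^ p * bergman_norm p2 w f2 `^ p <=
             (p / p1)%:E * bergman_norm p1 w f1 `^ p1
             + (p / p2)%:E * bergman_norm p2 w f2 `^ p2)%E &
            ((p / p1)%:E * bergman_norm p1 w f1 `^ p1
             + (p / p2)%:E * bergman_norm p2 w f2 `^ p2 <=
             C%:E * bergman_norm p w f `^ p)%E].
Proof.
have s12 : p / p1 + p / p2 = 1 by rewrite -mulrDr -hpp divff// lt0r_neq0.
have [C C0 hC] := bergman_factorization hp hp1 hp2 s12 hw hdense.
have mw := measurable_weight hw.1.
have [w0 _] := hw.1.
exists C => // f bf; have [F1 [F2 [a1 a2 fE hI]]] := hC f bf.
have s10 : 0 < p / p1 by rewrite divr_gt0.
have s20 : 0 < p / p2 by rewrite divr_gt0.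
have m1 := measurable_bergman p1 (analytic_cmeasurable a1) mw.
have m2 := measurable_bergman p2 (analytic_cmeasurable a2) mw.
have pos q F (u : lebesgue_plane R) : rdisc u -> 0 <= cmod (F (cplx u)) `^ q * w (cplx u).
  by move=> du; apply: mulr_ge0; [exact: powR_ge0|exact: ltW (w0 _ du)].
have sum : ((p / p1)%:E * bergman_integral p1 w F1 + (p / p2)%:E * bergman_integral p2 w F2 <=
    C%:E * bergman_integral p w f)%E.
  apply: le_trans hI; rewrite /bergman_integral.
  rewrite -(ge0_integralZl (dA R) (@measurable_rdisc R)); first last.
  - by rewrite lee_fin ltW.
  - by move=> u du; rewrite lee_fin; exact: pos.
  - by apply/measurable_EFinP; exact: m1.
  rewrite -(ge0_integralZl (dA R) (@measurable_rdisc R)); first last.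
  - by rewrite lee_fin ltW.
  - by move=> u du; rewrite lee_fin; exact: pos.
  - by apply/measurable_EFinP; exact: m2.
  rewrite -ge0_integralD; first last.
  - by apply: measurable_funeM; apply/measurable_EFinP; exact: m2.
  - by move=> u du; apply: mule_ge0; rewrite lee_fin; [exact: ltW|exact: pos].
  - by apply: measurable_funeM; apply/measurable_EFinP; exact: m1.
  - by move=> u du; apply: mule_ge0; rewrite lee_fin; [exact: ltW|exact: pos].
  - exact: measurable_rdisc.
  rewrite le_eqVlt; apply/orP; left; apply/eqP; apply: eq_integral => u _.
  by rewrite -!EFinM -EFinD; congr (_%:E); ring.
have X0 := bergman_integral_ge0 p1 F1 w0; have Y0 := bergman_integral_ge0 p2 F2 w0.
have fin : (C%:E * bergman_integral p w f < +oo)%E.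
  have [_ h] := bf; apply: lte_mul_pinfty; [by rewrite lee_fin ltW|by []|exact: h].
have n0 (q : R) (q0 : 0 < q) : q != 0 by exact: lt0r_neq0.
have s1E := bergman_norm_powR F1 (n0 _ hp1) w0.
have s2E := bergman_norm_powR F2 (n0 _ hp2) w0.
have sE := bergman_norm_powR f (n0 _ hp) w0.
have XE : (bergman_integral p1 w F1 < +oo)%E.
  apply: lty_summand s10 _ sum fin.
  by apply: mule_ge0; [rewrite lee_fin ltW|exact: Y0].
have YE : (bergman_integral p2 w F2 < +oo)%E.
  rewrite addeC in sum; apply: lty_summand s20 _ sum fin.
  by apply: mule_ge0; [rewrite lee_fin ltW|exact: X0].
exists F1, F2; rewrite s1E s2E sE; split.
- by split; [exact: a1|exact: XE].
- by split; [exact: a2|exact: YE].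
- exact: fE.
- exact: young_poweR hp hp1 hp2 s12 X0 Y0 XE YE.
- exact: sum.
Qed.
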